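(* Let $\Lambda(z)\in\mathbb{C}[z]$ be a monic polynomial of degree $m+n$ and assume that $\Lambda(0)\neq 0$. For every given choice $(x_{1}(0),\ldots,x_{m}(0),y_{1}(0),\ldots,y_{n}(0))\in\mathbb{C}^{m+n}$ of a solution of the infinite $qq$-system, i.e. such that $\prod_{i=1}^m(z+x_i(0))\prod_{j=1}^n(z+y_j(0))=\Lambda(z)$, there exist $\epsilon>0$ and analytic functions $x_{1}(t),\ldots,x_{m}(t),y_{1}(t),\ldots,y_{n}(t)$ (with the given values at $t=0$) that solve the finite $qq$-system with parameter $t$ for all $t\in\mathbb{C}$ such that $|t|<\epsilon$; that is, the polynomials $q_+^t(z)=\prod_{i=1}^m(z+x_i(t))$ and $q_-^t(z)=\prod_{j=1}^n(z+y_j(t))$ satisfy $$q_+^t(z)q_-^t(z)+t\,W(q_+^t,q_-^t)(z)=\Lambda(z).$$ Moreover, in this way we get all the solutions of this finite $qq$-system, and of the corresponding Bethe equations, for small enough $t$.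
   Context: The Wronskian is $W(f,g)(z)=f(z)\partial_z g(z)-g(z)\partial_z f(z)$. Solutions of the finite $\mathfrak{sl}_2$ $qq$-system with parameter $t$ are considered as pairs $(q_+,q_-)$ of monic polynomials of degrees $m$ and $n$, written as $q_+(z)=\prod_{i=1}^m(z+x_i)$, $q_-(z)=\prod_{j=1}^n(z+y_j)$. Write $\Lambda(z)=\prod_{k=1}^{N}(z-z_k)^{n_k}$ with distinct $z_k$. The corresponding Bethe equations (for the $\mathfrak{sl}_2$ inhomogeneous Gaudin model with $Z^H=\mathrm{diag}(\zeta,-\zeta)$, where $2\zeta=t^{-1}$, $t\neq0$) are the equations in unknowns $w_1,\ldots,w_m$: $$2\zeta+\sum_{j=1}^{N}\frac{n_j}{w_l-z_j}-\sum_{s\neq l}\frac{2}{w_l-w_s}=0,\qquad l=1,\ldots,m.$$ In a solution, the $w_l$ are pairwise distinct and none is a root of $\Lambda$. A solution $(q_+,q_-)$ of the $qq$-system such that $q_+$ has no multiple roots and no root in common with $\Lambda$ corresponds to the solution $\{w_l\}$ of the Bethe equations formed by the roots of $q_+$, i.e. $w_l=-x_l$. *)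

(* Defs.v *)
From HB Require Import structures.
From mathcomp Require Import all_boot all_order all_algebra.
From mathcomp Require Import complex.
From mathcomp Require Import all_classical all_reals all_analysis.
Set Implicit Arguments.
Unset Strict Implicit.
Unset Printing Implicit Defensive.
Import Order.TTheory GRing.Theory Num.Theory numFieldNormedType.Exports.
Local Open Scope classical_set_scope.
Local Open Scope ring_scope.
Local Open Scope complex_scope.

Definition Wronskian (R : realType) (f g : {poly R[i]}) : {poly R[i]} :=
  f * g^`() - g * f^`().

Definition finite_qq (R : realType) (Lambda : {poly R[i]}) (t : R[i])
    (qp qm : {poly R[i]}) : Prop :=
  qp * qm + t *: Wronskian qp qm = Lambda.

Definition infinite_qq (R : realType) (Lambda qp qm : {poly R[i]}) : Prop :=
  qp * qm = Lambda.

(* The parameters x_i are the opposites of the roots. *)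
Definition prodXaddC (R : realType) (m : nat) (x : 'I_m -> R[i]) : {poly R[i]} :=
  \prod_(i < m) ('X + (x i)%:P).

Definition disc (R : realType) (eps : R) : set R[i] :=
  [set t | `|t| < eps%:C].

Definition analytic_on (K : numFieldType) (D : set K) (f : K -> K) : Prop :=
  forall c, D c -> exists a : nat -> K,
    \forall h \near (0 : K),
      series (fun k => a k * h ^+ k) @ \oo --> f (c + h).

Definition qq_family (R : realType) (m n : nat) (Lambda : {poly R[i]}) (eps : R)
    (x0 : 'I_m -> R[i]) (y0 : 'I_n -> R[i])
    (x : 'I_m -> R[i] -> R[i]) (y : 'I_n -> R[i] -> R[i]) : Prop :=
  [/\ forall i, analytic_on (disc eps) (x i) /\ x i 0 = x0 i,
      forall j, analytic_on (disc eps) (y j) /\ y j 0 = y0 j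
    & forall t, disc eps t ->
        finite_qq Lambda t (prodXaddC (fun i => x i t)) (prodXaddC (fun j => y j t))].

(* Distinctness and nonvanishing of Lambda at the w_l make all the
   denominators of the equations nonzero. *)
Definition Bethe_solution (R : realType) (m N : nat) (z : 'I_N -> R[i])
    (nn : 'I_N -> nat) (zeta : R[i]) (w : 'I_m -> R[i]) : Prop :=
  [/\ injective w,
      forall l, ~~ root (\prod_(k < N) ('X - (z k)%:P) ^+ nn k) (w l)
    & forall l, 2%:R * zeta + \sum_(j < N) (nn j)%:R / (w l - z j)
                - \sum_(s < m | s != l) 2%:R / (w l - w s) = 0].

(* Main.v *)
Require Import Defs.
From HB Require Import structures.
From mathcomp Require Import all_boot all_order all_algebra.
From mathcomp Require Import perm complex.
From mathcomp Require Import all_classical all_reals all_analysis.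
From mathcomp Require Import ring lra zify.
Import Order.TTheory GRing.Theory Num.Theory numFieldNormedType.Exports.
Local Open Scope ring_scope.
Local Open Scope complex_scope.
Import Normc.
Set Implicit Arguments.
Unset Strict Implicit.
Unset Printing Implicit Defensive.

(** Let [w_i] be all the roots of [q+] and [q-], with sign [+1] or [-1] according to
    the factor.  At [w_i] only one term of the Wronskian survives, so the qq-equation
    says there that [t * \prod_(s != i) (w_i - w_s)] is minus the sign times
    [Lambda(w_i)].  For [t = 0] the roots are those of [Lambda], say [kappa_i].  When
    these are not simple, the equations for the [w_i] are degenerate, and the roots
    have to be rescaled: with [w_i = kappa_i + t * u_i], both sides acquire the
    factor [t] as often as [kappa_i] occurs, and after division the equations
    ([rescaled_equation]) are regular at [t = 0].  There the clusters of equal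
    [kappa_i] decouple, and each of them poses the same problem with parameter 1 and
    right-hand side ['X^k].

    A solution of the limiting equations with distinct roots in each cluster is
    nondegenerate ([cluster_nondegenerate]).  The reason is that [f = q+] satisfies a
    second order linear equation whose zeroth order coefficient [potential] is
    bilinear in [q+] and [q-].  For the right-hand side ['X^k] and [f(0) != 0] this
    coefficient is divisible by ['X^(k-1)], so by its degree it is a multiple of
    it; along a tangent vector its variation is also divisible by ['X^(k-1)] but has
    smaller degree, so it vanishes, and Kummer's equation leaves no tangent vector.
    The implicit function theorem ([implicit_function]) then gives an analytic family
    ([base_family]), which contains all solutions with nearby rescaled roots.

    These families are all the solutions.  A common root of [q+] and [q-] is a double
    root of [Lambda]; it can be kept constant and divided out ([all_families]).  For
    solutions without common root, one takes limits as [t] tends to 0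
    ([coprime_families]).  The rescaled roots stay bounded, because at the root of a
    cluster that is farthest from [kappa_i] the equation compares the [k]-th power of
    the distance with [t] times its [(k-1)]-st power.  The limit of the rescaled roots
    is a solution of the limiting equations with distinct roots in each cluster:
    divisibility of [potential] by ['X^(k-1)] passes to the limit, and the
    recursion of Kummer's equation then excludes the root 0
    ([limit_nonvanishing]), which is the only possible multiple root.  By the
    uniqueness in the implicit function theorem, solutions close to the limit belong
    to its family.  The parameter 0 is included, where the clusters of a solution
    without common root contain roots of one factor only and the limiting equations
    are linear ([one_sided_base]).  So every factorization of [Lambda] is the initial
    value of some family.

    Finally, the Bethe equations say that the roots of [q+] are simple, are not roots
    of [Lambda], and satisfy the relation between the values and first derivatives of
    both sides of the qq-equation from which [q-] can be eliminated; the polynomial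
    [q-] is recovered by interpolation ([bethe_at_qq]). *)

(** * Modulus of complex numbers and limits along an ultrafilter *)

Section Modulus.
Context {R : realType}.
Local Notation C := R[i].
Implicit Types x y z : C.

Lemma norm_normc x : `|x| = (normc x)%:C.
Proof. by []. Qed.

Lemma normc_ge0 x : 0 <= normc x.
Proof. by rewrite -lecR -norm_normc normr_ge0. Qed.

Lemma normcD x y : normc (x + y) <= normc x + normc y.
Proof. by rewrite -lecR rmorphD /= -!norm_normc ler_normD. Qed.

Lemma normcB x y : normc (x - y) = normc (y - x).
Proof. by rewrite -(opprB y x) normcN. Qed.

Lemma normc_eq0 x : (normc x == 0) = (x == 0).
Proof.
by apply/eqP/eqP => [/eq0_normc//|->]; rewrite normc0.
Qed.

Lemma normc_gt0 x : (0 < normc x) = (x != 0).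
Proof. by rewrite lt_def normc_ge0 andbT normc_eq0. Qed.

Lemma normcX x n : normc (x ^+ n) = normc x ^+ n.
Proof. by elim: n => [|n IH]; rewrite ?normc1 // !exprS normcM IH. Qed.

Lemma normc_prod (I : Type) (r : seq I) (P : pred I) (F : I -> C) :
  normc (\prod_(i <- r | P i) F i) = \prod_(i <- r | P i) normc (F i).
Proof. exact: (big_morph _ (@normcM R) (@normc1 R)). Qed.

Lemma normc_sum (I : Type) (r : seq I) (P : pred I) (F : I -> C) :
  normc (\sum_(i <- r | P i) F i) <= \sum_(i <- r | P i) normc (F i).
Proof.
elim/big_ind2: _ => [|a b c d h1 h2|//]; first by rewrite normc0.
by rewrite (le_trans (normcD _ _)) // lerD.
Qed.

Lemma normc_dist_le x y : normc x - normc y <= normc (x - y).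
Proof. by rewrite lerBlDr (le_trans _ (normcD _ _)) // subrK. Qed.

Lemma normc_ge_Re x : `|complex.Re x| <= normc x.
Proof. by rewrite -lecR -norm_normc complex.normc_ge_Re. Qed.

Lemma normc_ge_Im x : `|complex.Im x| <= normc x.
Proof.
case: x => a b /=; rewrite -sqrtr_sqr ler_wsqrtr // lerDr sqr_ge0 //.
Qed.

Lemma normc_le_ReIm x : normc x <= `|complex.Re x| + `|complex.Im x|.
Proof.
case: x => a b /=; rewrite -[leRHS]ger0_norm ?addr_ge0 //.
rewrite -sqrtr_sqr ler_wsqrtr // sqrrD !real_normK ?num_real //.
by rewrite addrAC lerDl mulrn_wge0 // mulr_ge0.
Qed.

End Modulus.

Section UltraLimit.
Context {R : realType}.
Local Notation C := R[i].

Definition ulim (U : set_system nat) (a : nat -> C) (l : C) : Prop :=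
  forall e : R, 0 < e -> U [set j | normc (a j - l) < e]%classic.

Section Filter.
Context {U : set_system nat} {FU : ProperFilter U}.
Implicit Types (a b : nat -> C) (l m : C).

Lemma filter_always (P : set nat) : (forall j, P j) -> U P.
Proof. by move=> h; apply: (@filterS _ U _ setT) => [j _|]; [exact: h|exact: filterT]. Qed.

Lemma ulim_cst l : ulim U (fun=> l) l.
Proof. by move=> e e0; apply: filter_always => j /=; rewrite subrr normc0. Qed.

Lemma eq_ulim a b l : (forall j, a j = b j) -> ulim U a l -> ulim U b l.
Proof. by move=> h; have -> : a = b by apply/funext. Qed.

Lemma ulim_near a b l : U [set j | a j = b j]%classic -> ulim U a l -> ulim U b l.
Proof.
by move=> h al e e0; apply: filterS (filterI h (al e e0)) => j /= [->].
Qed.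

Lemma ulimD a b l m :
  ulim U a l -> ulim U b m -> ulim U (fun j => a j + b j) (l + m).
Proof.
move=> al bm e e0; have e2 : 0 < e / 2 by rewrite divr_gt0.
apply: filterS (filterI (al _ e2) (bm _ e2)) => j /= [h1 h2].
rewrite opprD addrACA (le_lt_trans (normcD _ _)) //.
by rewrite [e]splitr ltrD.
Qed.

Lemma ulimM a b l m :
  ulim U a l -> ulim U b m -> ulim U (fun j => a j * b j) (l * m).
Proof.
move=> al bm e e0.
pose B := normc m + normc l + 1.
have B0 : 0 < B by rewrite ltr_wpDl // addr_ge0 // normc_ge0.
have eB : 0 < Num.min 1 (e / B) by rewrite lt_min ltr01 divr_gt0.
apply: filterS (filterI (al _ eB) (bm _ eB)) => j /= [].
rewrite !lt_min => /andP[_ h1] /andP[h3 h2].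
have -> : a j * b j - l * m = (a j - l) * (b j) + l * (b j - m) by ring.
rewrite (le_lt_trans (normcD _ _)) // !normcM.
have hb : normc (b j) < 1 + normc m.
  by rewrite -ltrBlDr (le_lt_trans (normc_dist_le _ _)).
have hb0 : 0 <= normc (b j) by exact: normc_ge0.
have hl0 := normc_ge0 l; have hm0 := normc_ge0 m.
have hx : normc (a j - l) * normc (b j) <= e / B * (1 + normc m).
  by apply: ler_pM; rewrite ?normc_ge0 // ltW.
have hy : normc l * normc (b j - m) <= normc l * (e / B).
  by apply: ler_wpM2l => //; rewrite ltW.
have eBp : 0 < e / B by rewrite divr_gt0.
have [l0|l0] := eqVneq (normc l) 0.
  rewrite l0 mul0r addr0.
  have BE : B = normc m + 1 by rewrite /B l0 addr0.
  rewrite (@lt_le_trans _ _ (e / B * (1 + normc m))) //; last first.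
    by rewrite [1 + _]addrC -BE divfK // gt_eqF.
  apply: (@le_lt_trans _ _ (e / B * normc (b j))).
    by apply: ler_wpM2r => //; rewrite ltW.
  by rewrite ltr_pM2l.
have l0' : 0 < normc l by rewrite lt_def l0.
apply: (@lt_le_trans _ _ (e / B * (1 + normc m) + normc l * (e / B))).
  by rewrite ler_ltD // ltr_pM2l.
by rewrite [normc l * _]mulrC -mulrDr -addrA [1 + _]addrC -/B divfK // gt_eqF.
Qed.

Lemma ulimN a l : ulim U a l -> ulim U (fun j => - a j) (- l).
Proof.
by move=> h e e0; apply: filterS (h e e0) => j /=; rewrite -opprD normcN.
Qed.

Lemma ulimB a b l m :
  ulim U a l -> ulim U b m -> ulim U (fun j => a j - b j) (l - m).
Proof. by move=> h k; apply: ulimD => //; apply: ulimN. Qed.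

Lemma ulim_sum (I : Type) (r : seq I) (P : pred I) (F : I -> nat -> C) (G : I -> C) :
  (forall i, P i -> ulim U (F i) (G i)) ->
  ulim U (fun j => \sum_(i <- r | P i) F i j) (\sum_(i <- r | P i) G i).
Proof.
move=> h; elim: r => [|i r IH].
  by rewrite big_nil; apply: eq_ulim (ulim_cst 0) => j; rewrite big_nil.
rewrite big_cons; case: ifP => Pi.
  by apply: eq_ulim (ulimD (h i Pi) IH) => j; rewrite big_cons Pi.
by apply: eq_ulim IH => j; rewrite big_cons Pi.
Qed.

Lemma ulim_prod (I : Type) (r : seq I) (P : pred I) (F : I -> nat -> C) (G : I -> C) :
  (forall i, P i -> ulim U (F i) (G i)) ->
  ulim U (fun j => \prod_(i <- r | P i) F i j) (\prod_(i <- r | P i) G i).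
Proof.
move=> h; elim: r => [|i r IH].
  by rewrite big_nil; apply: eq_ulim (ulim_cst 1) => j; rewrite big_nil.
rewrite big_cons; case: ifP => Pi.
  by apply: eq_ulim (ulimM (h i Pi) IH) => j; rewrite big_cons Pi.
by apply: eq_ulim IH => j; rewrite big_cons Pi.
Qed.

Lemma ulim_le a l (B : R) : ulim U a l -> U [set j | normc (a j) <= B]%classic ->
  normc l <= B.
Proof.
move=> al aB; rewrite leNgt; apply/negP => lB.
have e0 : 0 < normc l - B by rewrite subr_gt0.
have [j /= [h1 h2]] := filter_ex (filterI aB (al _ e0)).
move: h2; rewrite normcB => /(le_lt_trans (normc_dist_le _ _)).
by rewrite ltrD2l ltrN2 ltNge h1.
Qed.

Lemma ulim_unique a l m : ulim U a l -> ulim U a m -> l = m.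
Proof.
move=> al am; apply/eqP; rewrite -subr_eq0 -normc_eq0 eq_le normc_ge0 andbT.
apply: (ulim_le (ulimB al am)); apply: filter_always => j /=.
by rewrite subrr normc0.
Qed.

Lemma ulim_neq0 a l : ulim U a l -> l != 0 -> U [set j | a j != 0]%classic.
Proof.
move=> al l0; have e0 : 0 < normc l by rewrite normc_gt0.
apply: filterS (al _ e0) => j /=; apply: contraTneq => ->.
by rewrite sub0r normcN ltxx.
Qed.

End Filter.

(** An ultrafilter decides every set of indices, so the supremum of the
    values that the sequence exceeds along it is its limit. *)
Lemma ultra_real_limit (U : set_system nat) (UU : UltraFilter U)
    (a : nat -> R) (B : R) : (forall j, `|a j| <= B) ->
  exists l, forall e, 0 < e -> U [set j | `|a j - l| < e]%classic.
Proof.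
move=> aB; pose E := [set x | U [set j | x <= a j]%classic]%classic.
have E0 : (E !=set0)%classic.
  by exists (- B); apply: filter_always => j /=; have := aB j; rewrite ler_norml => /andP[].
have Eub : ubound E B.
  move=> x /filter_ex[j /= h]; apply: le_trans h _.
  exact: le_trans (ler_norm _) (aB j).
have hE : has_sup E by split => //; exists B.
exists (sup E) => e e0.
have lo : U [set j | sup E - e < a j]%classic.
  have [x Ex hx] := sup_adherent e0 hE.
  by apply: filterS Ex => j /= h; apply: lt_le_trans h.
have hi : U [set j | a j < sup E + e]%classic.
  have [h|h] := in_ultra_setVsetC [set j | sup E + e <= a j]%classic UU.
    have := sup_upper_bound hE h.
    by rewrite gerDl leNgt e0.
  by apply: filterS h => j /= /negP; rewrite -ltNge.
apply: filterS (filterI lo hi) => j /= [h1 h2].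
by rewrite ltr_norml ltrBrDl h1 ltrBlDl.
Qed.

Lemma ultra_limit (U : set_system nat) (UU : UltraFilter U)
    (a : nat -> C) (B : R) : U [set j | normc (a j) <= B]%classic ->
  exists l, ulim U a l.
Proof.
move=> aB.
have [j0 /(le_trans (normc_ge0 _)) B0] := filter_ex aB.
pose b j := if normc (a j) <= B then a j else 0.
have bB j : normc (b j) <= B by rewrite /b; case: ifP => // _; rewrite normc0.
have [x hx] := ultra_real_limit UU (fun j => le_trans (normc_ge_Re _) (bB j)).
have [y hy] := ultra_real_limit UU (fun j => le_trans (normc_ge_Im _) (bB j)).
(* [b] agrees with [a] eventually and is bounded at all indices. *)
exists (x +i* y); apply: (@ulim_near _ _ b).
  by apply: filterS aB => j /= h; rewrite /b h.
move=> e e0; have e2 : 0 < e / 2 by rewrite divr_gt0.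
apply: filterS (filterI (hx _ e2) (hy _ e2)) => j /= [h1 h2].
rewrite (le_lt_trans (normc_le_ReIm _)) // [e]splitr.
by case: (b j) h1 h2 => p q /= h1 h2; apply: ltrD.
Qed.

(** An ultrafilter refining convergence at infinity makes every bounded sequence
    converge without passing to subsequences. *)
Lemma ultra_nat : exists2 U : set_system nat, UltraFilter U & (\oo `<=` U)%classic.
Proof.
by have [U [UU h]] := @ultraFilterLemma nat \oo%classic _; exists U.
Qed.

Lemma nbhs_infty_half (e : R) : 0 < e -> \forall j \near \oo%classic, 2^-1 ^+ j < e.
Proof.
move=> e0; have /cvgrPdist_lt /(_ e e0) : ((fun j => (2^-1 : R) ^+ j) @ \oo --> (0:R))%classic.
  by apply: cvg_expr; rewrite ger0_norm // invf_lt1 // ltr1n.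
by apply: filterS => j; rewrite sub0r normrN ger0_norm // exprn_ge0.
Qed.

(** Geometric Cauchy sequences of complex numbers converge, with the expected
    rate: the limit along an ultrafilter is the limit. *)
Lemma geometric_limit (a : nat -> C) (M : R) :
  (forall j, normc (a j.+1 - a j) <= M * 2^-1 ^+ j) ->
  exists l, forall j, normc (a j - l) <= M * 2 * 2^-1 ^+ j.
Proof.
move=> h.
have M0 : 0 <= M by have := le_trans (normc_ge0 _) (h 0%N); rewrite expr0 mulr1.
have step j k : normc (a (j + k)%N - a j) <= M * 2 * 2^-1 ^+ j * (1 - 2^-1 ^+ k).
  elim: k => [|k IH]; first by rewrite addn0 subrr normc0 expr0 subrr mulr0.
  have -> : a (j + k.+1)%N - a j
      = (a (j + k).+1 - a (j + k)%N) + (a (j + k)%N - a j).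
    by rewrite addnS; ring.
  rewrite (le_trans (normcD _ _)) // (le_trans (lerD (h _) IH)) //.
  rewrite exprD exprS.
  set p := _ ^+ j; set q := _ ^+ k.
  rewrite le_eqVlt; apply/orP; left; apply/eqP; by field.
have step' j k : (j <= k)%N -> normc (a k - a j) <= M * 2 * 2^-1 ^+ j.
  move=> /subnKC <-; apply: le_trans (step _ _) _.
  rewrite ler_piMr ?mulr_ge0 ?exprn_ge0 // ?lerBlDr ?lerDl ?exprn_ge0 //.
have [U' UU' sU] := ultra_nat.
have [l hl] : exists l, ulim U' a l.
  apply: (@ultra_limit _ _ _ (M * 2 + normc (a 0%N))).
  apply: filter_always => j /=; rewrite -[a j](subrK (a 0%N)).
  rewrite (le_trans (normcD _ _)) // lerD2r.
  by have := step' 0%N j (leq0n j); rewrite expr0 mulr1.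
exists l; move=> j.
apply: (@ulim_le U' _ (fun k => a j - a k)); first by apply: ulimB => //; exact: ulim_cst.
apply: sU; apply: filterS (nbhs_infty_ge j) => k /= jk.
by rewrite normcB; exact: step'.
Qed.

End UltraLimit.

(** * Polynomial norms and analytic limits *)

Section PolyNorm.
Context {R : realType}.
Local Notation C := R[i].
Implicit Types (p q : {poly C}) (r : R).

(** The norm of the algebra of power series that converge absolutely on the closed
    disc of radius [r], restricted to polynomials. *)
Definition l1norm r p : R := \sum_(k < size p) normc p`_k * r ^+ k.

Lemma l1norm_wide r p n : (size p <= n)%N ->
  l1norm r p = \sum_(k < n) normc p`_k * r ^+ k.
Proof.
move=> pn; rewrite /l1norm (big_ord_widen n (fun k => normc p`_k * r ^+ k) pn).
rewrite big_mkcond /=; apply: eq_bigr => k _; case: ltnP => // h.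
by rewrite nth_default // normc0 mul0r.
Qed.

Lemma l1norm_ge0 r p : 0 <= r -> 0 <= l1norm r p.
Proof. by move=> r0; apply: sumr_ge0 => k _; rewrite mulr_ge0 ?normc_ge0 ?exprn_ge0. Qed.

Lemma l1normD r p q : 0 <= r -> l1norm r (p + q) <= l1norm r p + l1norm r q.
Proof.
move=> r0; set n := maxn (size p) (size q).
rewrite (@l1norm_wide r (p + q) n) ?size_polyD //.
rewrite (@l1norm_wide r p n) ?leq_maxl // (@l1norm_wide r q n) ?leq_maxr //.
rewrite -big_split /=; apply: ler_sum => k _.
by rewrite coefD -mulrDl ler_wpM2r ?exprn_ge0 // normcD.
Qed.

Lemma l1norm_MXaddC r p (c : C) : l1norm r (p * 'X + c%:P) = l1norm r p * r + normc c.
Proof.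
rewrite (@l1norm_wide r _ (size p).+1); last first.
  by rewrite size_MXaddC; case: ifP.
rewrite big_ord_recl /= addrC expr0 mulr1 coefD coefMX coefC /= add0r.
congr (_ + _); rewrite /l1norm mulr_suml; apply: eq_bigr => k _.
by rewrite coefD coefMX coefC /= addr0 /bump /= add1n exprSr mulrA.
Qed.

Lemma l1normC r (c : C) : l1norm r c%:P = normc c.
Proof.
by have := l1norm_MXaddC r 0 c; rewrite mul0r add0r /l1norm size_poly0 big_ord0 mul0r add0r.
Qed.

Lemma l1norm0 r : l1norm r 0 = 0.
Proof. by rewrite /l1norm size_poly0 big_ord0. Qed.

Lemma l1normMX r p : l1norm r (p * 'X) = l1norm r p * r.
Proof. by have := l1norm_MXaddC r p 0; rewrite normc0 !addr0. Qed.

Lemma l1normX r : l1norm r 'X = r.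
Proof. by rewrite -[X in l1norm r X]mul1r l1normMX -polyC1 l1normC normc1 mul1r. Qed.

Lemma l1normM r p q : 0 <= r -> l1norm r (p * q) <= l1norm r p * l1norm r q.
Proof.
move=> r0; elim/poly_ind: p => [|p c IH]; first by rewrite mul0r l1norm0 mul0r.
have -> : (p * 'X + c%:P) * q = p * q * 'X + c *: q by rewrite -mul_polyC; ring.
rewrite (le_trans (l1normD _ _ r0)) // l1norm_MXaddC mulrDl lerD //.
  by rewrite l1normMX mulrAC ler_wpM2r.
rewrite (@l1norm_wide r _ (size q)) ?size_scale_leq // /l1norm mulr_sumr.
by apply: ler_sum => k _; rewrite coefZ normcM mulrA.
Qed.

Lemma coef_l1norm r p k : 0 <= r -> normc p`_k * r ^+ k <= l1norm r p.
Proof.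
move=> r0; have [h|h] := leqP (size p) k.
  by rewrite nth_default // normc0 mul0r l1norm_ge0.
rewrite /l1norm (bigD1 (Ordinal h)) //= lerDl; apply: sumr_ge0 => i _.
by rewrite mulr_ge0 ?normc_ge0 ?exprn_ge0.
Qed.

Lemma horner_l1norm r p (t : C) : normc t <= r -> normc p.[t] <= l1norm r p.
Proof.
move=> tr; rewrite horner_coef (le_trans (normc_sum _ _ _)) //.
apply: ler_sum => k _; rewrite normcM normcX ler_wpM2l ?normc_ge0 //.
by rewrite lerXn2r ?nnegrE ?normc_ge0 // (le_trans (normc_ge0 t)).
Qed.

(** Recentring a polynomial at a point of the disc costs that much radius. *)
Lemma l1norm_shift (rho : R) p (c : C) : 0 <= rho ->
  l1norm rho (p \Po ('X + c%:P)) <= l1norm (rho + normc c) p.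
Proof.
move=> r0; elim/poly_ind: p => [|p a IH]; first by rewrite comp_poly0 !l1norm0.
rewrite comp_poly_MXaddC (le_trans (l1normD _ _ r0)) // l1norm_MXaddC l1normC lerD2r.
rewrite (le_trans (l1normM _ _ r0)) //.
have -> : l1norm rho ('X + c%:P) = rho + normc c.
  by rewrite -[X in X + c%:P]mul1r l1norm_MXaddC -polyC1 l1normC normc1 mul1r.
by apply: ler_wpM2r => //; rewrite addr_ge0 // normc_ge0.
Qed.

(** On the disc of half the radius each monomial loses the corresponding power of two. *)
Lemma horner_tail (s : R) p (h : C) n : 0 <= s -> normc h <= s ->
  normc (p.[h] - \sum_(k < n) p`_k * h ^+ k) <= l1norm (2 * s) p * 2^-1 ^+ n.
Proof.
move=> s0 hs; set N := (n + size p)%N.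
have sN : (size p <= N)%N by rewrite leq_addl.
have s2 : 0 <= 2 * s by rewrite mulr_ge0.
rewrite (horner_coef_wide _ sN) (l1norm_wide _ sN) /N !big_split_ord /=.
rewrite addrAC subrr add0r (le_trans (normc_sum _ _ _)) //.
rewrite mulrDl ler_wpDl //.
  by rewrite mulr_ge0 ?exprn_ge0 // sumr_ge0 // => i _; rewrite mulr_ge0 ?normc_ge0 ?exprn_ge0.
rewrite mulr_suml; apply: ler_sum => i _.
rewrite normcM normcX -mulrA ler_wpM2l ?normc_ge0 //.
have -> : (2 * s) ^+ (n + i) * 2^-1 ^+ n = s ^+ (n + i) * 2 ^+ i :> R.
  by rewrite exprMn [2 ^+ (n + i)]exprD exprVn; field; rewrite expf_neq0.
rewrite (@le_trans _ _ (s ^+ (n + i))) ?lerXn2r ?nnegrE ?normc_ge0 //.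
by rewrite ler_peMr ?exprn_ge0 // exprn_ege1 // ler1n.
Qed.

(** The function [f] is approximated on the disc of radius [r] by polynomials that
    converge geometrically for [l1norm r].  This is stronger than analyticity there,
    and it has the form in which an iteration on polynomials delivers its limit. *)
Definition poly_limit r (f : C -> C) : Prop :=
  exists (P : nat -> {poly C}) (M : R),
    [/\ forall j, l1norm r (P j.+1 - P j) <= M * 2^-1 ^+ j
      & forall t, normc t < r -> forall e : R, 0 < e ->
          exists j0, forall j, (j0 <= j)%N -> normc ((P j).[t] - f t) < e].

Lemma poly_limit_cst r (c : C) : poly_limit r (fun=> c).
Proof.
exists (fun=> c%:P), 0; split=> [j|t _ e e0]; first by rewrite subrr l1norm0 mul0r.
by exists 0%N => j _; rewrite hornerC subrr normc0.
Qed.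

(** This recovers a root from its rescaled form: the difference to the root at
    parameter 0 is the parameter times the rescaled root. *)
Lemma poly_limit_affineX r (c : C) f : 0 < r -> poly_limit r f ->
  poly_limit r (fun t => c + t * f t).
Proof.
move=> r0 [P [M [hP hf]]].
exists (fun j => P j * 'X + c%:P), (M * r); split=> [j|t tr e e0].
  rewrite opprD addrACA subrr addr0 -mulrBl l1normMX mulrAC ler_wpM2r //; exact: ltW.
have [j0 h] := hf t tr (e / r) (divr_gt0 e0 r0).
exists j0 => j jj; rewrite hornerMXaddC.
have -> : (P j).[t] * t + c - (c + t * f t) = ((P j).[t] - f t) * t by ring.
rewrite normcM -[e](@divfK _ r) ?gt_eqF //.
apply: (@le_lt_trans _ _ (normc ((P j).[t] - f t) * r)).
  by rewrite ler_wpM2l ?normc_ge0 // ltW.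
by rewrite ltr_pM2r // h.
Qed.

Lemma poly_limit_opp r f : poly_limit r f -> poly_limit r (fun t => - f t).
Proof.
move=> [P [M [hP hf]]].
have l1N p : l1norm r (- p) = l1norm r p.
  by rewrite /l1norm size_polyN; apply: eq_bigr => k _; rewrite coefN normcN.
exists (fun j => - P j), M; split=> [j|t tr e e0].
  by rewrite -opprD l1N.
have [j0 h] := hf t tr e e0; exists j0 => j jj.
by rewrite hornerN -opprD normcN h.
Qed.

Lemma l1norm_mono r r' p : 0 <= r -> r <= r' -> l1norm r p <= l1norm r' p.
Proof.
move=> r0 rr; apply: ler_sum => k _; apply: ler_wpM2l; first exact: normc_ge0.
by rewrite lerXn2r // nnegrE // (le_trans r0).
Qed.

Lemma poly_limitW r r' f : 0 <= r' -> r' <= r -> poly_limit r f -> poly_limit r' f.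
Proof.
move=> r0 rr [P [M [hP hf]]]; exists P, M; split=> [j|t tr].
  by apply: le_trans (hP j); apply: l1norm_mono.
by apply: hf; apply: lt_le_trans rr.
Qed.

Lemma l1norm_telescope r (P : nat -> {poly C}) (M : R) : 0 <= r ->
  (forall j, l1norm r (P j.+1 - P j) <= M * 2^-1 ^+ j) ->
  forall j, l1norm r (P j) <= l1norm r (P 0%N) + M * 2.
Proof.
move=> r0 h j.
have M0 : 0 <= M by have := le_trans (l1norm_ge0 _ r0) (h 0%N); rewrite expr0 mulr1.
suff hj : l1norm r (P j) <= l1norm r (P 0%N) + M * 2 * (1 - 2^-1 ^+ j).
  rewrite (le_trans hj) // lerD2l ler_piMr ?mulr_ge0 // lerBlDr lerDl exprn_ge0 //.
elim: j => [|j IH]; first by rewrite expr0 subrr mulr0 addr0.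
rewrite -[P j.+1](subrK (P j)) addrC (le_trans (l1normD _ _ r0)) //.
rewrite (le_trans (lerD IH (h j))) //.
rewrite -addrA lerD2l exprS; set p := _ ^+ j.
by rewrite le_eqVlt; apply/orP; left; apply/eqP; field.
Qed.

(** The coefficients at a point [c] of the disc are the limits of those of
    the recentred polynomials; on half of the remaining radius the tails are
    uniformly small, which lets the two limits be exchanged. *)
Lemma poly_limit_analytic r f : poly_limit r f -> analytic_on (disc r) f.
Proof.
move=> [P [M [hP hf]]] c; rewrite /disc /= norm_normc ltcR => cr.
have r0 : 0 < r by apply: le_lt_trans cr; exact: normc_ge0.
pose s := (r - normc c) / 2.
have s0 : 0 < s by rewrite divr_gt0 // subr_gt0.
have s2 : 2 * s + normc c = r by rewrite /s mulrC divfK // subrK.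
have s20 : 0 <= 2 * s by rewrite mulr_ge0 // ltW.
pose T j := P j \Po ('X + c%:P).
have hT j : l1norm (2 * s) (T j.+1 - T j) <= M * 2^-1 ^+ j.
  rewrite /T -comp_polyB (le_trans (l1norm_shift _ _ s20)) // s2; exact: hP.
have hTc k j : normc ((T j.+1)`_k - (T j)`_k) <= M / (2 * s) ^+ k * 2^-1 ^+ j.
  rewrite mulrAC ler_pdivlMr ?exprn_gt0 ?mulr_gt0 ?subr_gt0 //.
  apply: le_trans (hT j); apply: le_trans (coef_l1norm (T j.+1 - T j) k s20).
  by rewrite coefB.

have [b hb] := choice (fun k => geometric_limit (hTc k)).
exists b.
have sC : (0 : C) < s%:C by rewrite ltcR.
near=> h.
have hs : normc h <= s.
  rewrite -lecR -norm_normc; near: h.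
  by apply/nbhs_normP; exists s%:C => // y; rewrite /= sub0r normrN => /ltW.
have [K [K0 HK]] : exists K, 0 < K /\ forall j, l1norm (2 * s) (T j) <= K.
  exists (l1norm (2 * s) (T 0%N) + M * 2 + 1); split.
    rewrite ltr_wpDl // (le_trans _ (l1norm_telescope s20 hT 0%N)) // l1norm_ge0 //.
  by move=> j; rewrite (le_trans (l1norm_telescope s20 hT j)) // lerDl.
(* the estimate of the tail does not depend on [j], so it survives the limit *)
have bound n : normc (f (c + h) - \sum_(k < n) b k * h ^+ k) <= K * 2^-1 ^+ n.
  have [U UU sU] := ultra_nat.
  apply: (@ulim_le _ U _ (fun j => (T j).[h] - \sum_(k < n) (T j)`_k * h ^+ k)).
    apply: ulimB.
      move=> e e0; apply: sU.
      have [|j0 hj] := hf (c + h) _ e e0.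
        rewrite (le_lt_trans (normcD _ _)) // -s2 addrC ltrD2r.
        by rewrite (le_lt_trans hs) // mulr_natl mulr2n ltrDl.
      apply: filterS (nbhs_infty_ge j0) => j /= jj.
      by rewrite /T horner_comp hornerD hornerX hornerC [h + c]addrC hj.
    apply: ulim_sum => k _; apply: ulimM; last exact: ulim_cst.
    move=> e e0; apply: sU.
    pose A := M / (2 * s) ^+ k * 2.
    have A1 : 0 < `|A| + 1 by rewrite ltr_wpDl.
    apply: filterS (nbhs_infty_half (divr_gt0 e0 A1)) => j /= hj.
    rewrite (le_lt_trans (hb k j)) // -/A.
    apply: (@le_lt_trans _ _ ((`|A| + 1) * 2^-1 ^+ j)).
      by rewrite ler_wpM2r ?exprn_ge0 // (le_trans (ler_norm _)) // lerDl.
    by rewrite mulrC -ltr_pdivlMr.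
  apply: filter_always => j /=.
  rewrite (le_trans (horner_tail _ _ (ltW s0) hs)) // ler_wpM2r ?exprn_ge0 //.
apply/(@cvgrPdist_lt R[i] (R[i]^o)) => e; case: e => e e' e0.
have e'0 : e' = 0 by move: e0; rewrite ltcE /= => /andP[/eqP].
have e1 : 0 < e by move: e0; rewrite ltcE /= => /andP[].
rewrite e'0.
apply: filterS (nbhs_infty_half (divr_gt0 e1 K0)) => n /= hn.
rewrite norm_normc ltcR seriesEord (le_lt_trans (bound n)) //.
by rewrite mulrC -ltr_pdivlMr.
Unshelve. all: by end_near.
Qed.

End PolyNorm.

(** * Strict differentiability, uniformly in the seminorm *)

(** Smaller radii work as well, so finitely many of them can be replaced by the least. *)
Lemma finite_uniform_radius (R : realType) (T : finType) (P : T -> R -> Prop) :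
  (forall i d d', 0 < d -> d <= d' -> P i d' -> P i d) ->
  (forall i, exists d, 0 < d /\ P i d) ->
  exists d, 0 < d /\ forall i, P i d.
Proof.
move=> mono h.
suff [d [d0 hd]] : exists d, 0 < d /\ forall i, i \in enum T -> P i d.
  by exists d; split=> // i; apply: hd; rewrite mem_enum.
elim: (enum T) => [|i s [d [d0 hd]]]; first by exists 1; split.
have [d' [d'0 hd']] := h i.
have m0 : 0 < Num.min d d' by rewrite lt_min d0.
exists (Num.min d d'); split=> // k; rewrite inE => /predU1P[->|ks].
  by apply: mono hd' => //; rewrite ge_min lexx orbT.
by apply: mono (hd k ks) => //; rewrite ge_min lexx.
Qed.

Section Implicit.
Context {R : realType}.
Local Notation C := R[i].
Local Notation A := {poly R[i]}.

Record algebra_seminorm (q : A -> R) : Prop := AlgebraSeminorm {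
  seminorm_ge0 : forall a, 0 <= q a;
  seminormD : forall a b, q (a + b) <= q a + q b;
  seminormM : forall a b, q (a * b) <= q a * q b;
  seminormC : forall c : C, q c%:P <= normc c }.

Lemma l1norm_seminorm (r : R) : 0 <= r -> algebra_seminorm (l1norm r).
Proof.
move=> r0; split=> [a|a b|a b|c].
- exact: l1norm_ge0.
- exact: l1normD.
- exact: l1normM.
- by rewrite l1normC.
Qed.

Lemma eval_seminorm (t : C) : algebra_seminorm (fun p => normc p.[t]).
Proof.
split=> [a|a b|a b|c]; first exact: normc_ge0.
- by rewrite hornerD normcD.
- by rewrite hornerM normcM.
- by rewrite hornerC.
Qed.

Section Theory.
Context {q : A -> R} (hq : algebra_seminorm q).

Lemma seminormZ (c : C) a : q (c *: a) <= normc c * q a.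
Proof.
rewrite -mul_polyC (le_trans (seminormM hq _ _)) // ler_wpM2r ?(seminorm_ge0 hq) //.
exact: seminormC.
Qed.

Lemma seminormN a : q (- a) = q a.
Proof.
have h b : q (- b) <= q b.
  by rewrite -scaleN1r (le_trans (seminormZ _ _)) // normcN normc1 mul1r.
by apply/eqP; rewrite eq_le h -{1}[a]opprK h.
Qed.

Lemma seminorm0 : q 0 = 0.
Proof.
apply/eqP; rewrite eq_le (seminorm_ge0 hq) andbT.
by have := seminormC hq 0; rewrite normc0.
Qed.

Lemma seminorm_sum (I : Type) (r : seq I) (P : pred I) (F : I -> A) :
  q (\sum_(i <- r | P i) F i) <= \sum_(i <- r | P i) q (F i).
Proof.
elim/big_ind2: _ => [|a b c d h1 h2|//]; first by rewrite seminorm0.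
by rewrite (le_trans (seminormD hq _ _)) // lerD.
Qed.

Lemma seminorm_lin n (J : 'I_n -> C) (x : 'I_n -> A) (d : R) :
  (forall k, q (x k) <= d) -> q (\sum_k J k *: x k) <= (\sum_k normc (J k)) * d.
Proof.
move=> h; rewrite (le_trans (seminorm_sum _ _ _)) // mulr_suml.
apply: ler_sum => k _; rewrite (le_trans (seminormZ _ _)) //.
by rewrite ler_wpM2l ?normc_ge0.
Qed.

End Theory.

Section Functions.
Context {N : nat} (nu : 'I_N -> C).
Implicit Types (G : A -> ('I_N -> A) -> A) (J : 'I_N -> C).

(** [G t x] is close to the constant [a] and strictly differentiable in [x],
    with derivative [J], when [t] is near 0 and [x] near [nu], with estimates
    that are the same for all algebra seminorms on polynomials in one variable.
    The seminorms that matter are evaluation at a point, for functions of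
    complex numbers, and [l1norm r] with ['X] for [t], for power series. *)
Definition strict_diff G (a : C) J : Prop :=
  forall eta : R, 0 < eta -> exists d, 0 < d /\
    forall q, algebra_seminorm q -> forall t x,
      q t <= d -> (forall k, q (x k - (nu k)%:P) <= d) ->
      q (G t x - a%:P) <= eta /\
      forall x', (forall k, q (x' k - (nu k)%:P) <= d) ->
      forall e, 0 <= e -> (forall k, q (x k - x' k) <= e) ->
      q (G t x - G t x' - \sum_k J k *: (x k - x' k)) <= eta * e.

Lemma strict_diff_cst (c : C) : strict_diff (fun _ _ => c%:P) c (fun=> 0).
Proof.
move=> eta eta0; exists 1; split=> // q hq t x _ _; split=> [|x' _ e e0 _].
  by rewrite subrr (seminorm0 hq) ltW.
rewrite subrr sub0r big1 => [|k _]; last by rewrite scale0r.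
by rewrite oppr0 (seminorm0 hq) mulr_ge0 // ltW.
Qed.

Lemma strict_diff_param : strict_diff (fun t _ => t) 0 (fun=> 0).
Proof.
move=> eta eta0; exists eta; split=> // q hq t x tq _; split=> [|x' _ e e0 _].
  by rewrite subr0.
rewrite subrr sub0r big1 => [|k _]; last by rewrite scale0r.
by rewrite oppr0 (seminorm0 hq) mulr_ge0 // ltW.
Qed.

Lemma strict_diff_proj i : strict_diff (fun _ x => x i) (nu i) (fun k => (k == i)%:R).
Proof.
move=> eta eta0; exists eta; split=> // q hq t x tq xq; split=> [|x' _ e e0 _].
  exact: xq.
rewrite (bigD1 i) //= eqxx scale1r big1 => [|k /negbTE->]; last by rewrite scale0r.
by rewrite addr0 subrr (seminorm0 hq) mulr_ge0 // ltW.
Qed.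

Lemma strict_diff_ext G G' a a' J J' : (forall t x, G t x = G' t x) -> a = a' ->
  (forall k, J k = J' k) -> strict_diff G a J -> strict_diff G' a' J'.
Proof.
move=> hG -> hJ.
have -> : J = J' by apply/funext.
by have -> : G = G' by apply/funext => t; apply/funext => x; apply: hG.
Qed.

Lemma strict_diffD G1 G2 a1 a2 J1 J2 :
  strict_diff G1 a1 J1 -> strict_diff G2 a2 J2 ->
  strict_diff (fun t x => G1 t x + G2 t x) (a1 + a2) (fun k => J1 k + J2 k).
Proof.
move=> h1 h2 eta eta0; have e2 : 0 < eta / 2 by rewrite divr_gt0.
have [d1 [d10 {}h1]] := h1 _ e2; have [d2 [d20 {}h2]] := h2 _ e2.
exists (Num.min d1 d2); split; first by rewrite lt_min d10.
move=> q hq t x; rewrite le_min => /andP[t1 t2] hx.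
have hx1 k : q (x k - (nu k)%:P) <= d1 by have := hx k; rewrite le_min => /andP[].
have hx2 k : q (x k - (nu k)%:P) <= d2 by have := hx k; rewrite le_min => /andP[].
have [c1 {}h1] := h1 q hq t x t1 hx1; have [c2 {}h2] := h2 q hq t x t2 hx2.
split=> [|x' hx' e e0 he].
  by rewrite polyCD opprD addrACA (le_trans (seminormD hq _ _)) // [eta]splitr lerD.
have hx1' k : q (x' k - (nu k)%:P) <= d1 by have := hx' k; rewrite le_min => /andP[].
have hx2' k : q (x' k - (nu k)%:P) <= d2 by have := hx' k; rewrite le_min => /andP[].
have {}h1 := h1 x' hx1' e e0 he; have {}h2 := h2 x' hx2' e e0 he.
under eq_bigr do rewrite scalerDl; rewrite big_split /=.
set S1 := \sum_k _ in h1 *; set S2 := \sum_k _ in h2 *.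
have -> : G1 t x + G2 t x - (G1 t x' + G2 t x') - (S1 + S2)
    = (G1 t x - G1 t x' - S1) + (G2 t x - G2 t x' - S2) by ring.
by rewrite (le_trans (seminormD hq _ _)) // [eta]splitr mulrDl lerD.
Qed.

Lemma strict_diffM G1 G2 a1 a2 J1 J2 :
  strict_diff G1 a1 J1 -> strict_diff G2 a2 J2 ->
  strict_diff (fun t x => G1 t x * G2 t x) (a1 * a2) (fun k => J1 k * a2 + a1 * J2 k).
Proof.
move=> h1 h2 eta eta0.
set j1 := \sum_k normc (J1 k); set j2 := \sum_k normc (J2 k).
have j10 : 0 <= j1 by apply: sumr_ge0 => k _; exact: normc_ge0.
have j20 : 0 <= j2 by apply: sumr_ge0 => k _; exact: normc_ge0.
have a10 := normc_ge0 a1; have a20 := normc_ge0 a2.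
set B := 2 + j1 + j2 + normc a1 + normc a2.
have B0 : 0 < B by rewrite /B; lra.
set eta' := Num.min 1 (eta / B).
have e0' : 0 < eta' by rewrite lt_min ltr01 divr_gt0.
have e1' : eta' <= 1 by rewrite ge_min lexx.
have eB : eta' * B <= eta.
  by rewrite -ler_pdivlMr // ge_min lexx orbT.
have [d1 [d10 {}h1]] := h1 _ e0'; have [d2 [d20 {}h2]] := h2 _ e0'.
exists (Num.min d1 d2); split; first by rewrite lt_min d10.
move=> q hq t x; rewrite le_min => /andP[t1 t2] hx.
have hx1 k : q (x k - (nu k)%:P) <= d1 by have := hx k; rewrite le_min => /andP[].
have hx2 k : q (x k - (nu k)%:P) <= d2 by have := hx k; rewrite le_min => /andP[].
have H1 := h1 q hq t; have H2 := h2 q hq t.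
have [c1 {}h1] := H1 x t1 hx1; have [c2 {}h2] := H2 x t2 hx2.
have q0 := seminorm_ge0 hq.
split=> [|x' hx' e e0 he].
  have -> : G1 t x * G2 t x - (a1 * a2)%:P
     = (G1 t x - a1%:P) * (G2 t x - a2%:P) + a1%:P * (G2 t x - a2%:P)
       + (G1 t x - a1%:P) * a2%:P by rewrite polyCM; ring.
  apply: le_trans eB.
  have p1 : q ((G1 t x - a1%:P) * (G2 t x - a2%:P)) <= eta' * 1.
    apply: le_trans (seminormM hq _ _) _; apply: ler_pM => //.
    exact: le_trans c2 e1'.
  have p2 : q (a1%:P * (G2 t x - a2%:P)) <= normc a1 * eta'.
    by apply: le_trans (seminormM hq _ _) _; apply: ler_pM => //; exact: seminormC.
  have p3 : q ((G1 t x - a1%:P) * a2%:P) <= eta' * normc a2.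
    by apply: le_trans (seminormM hq _ _) _; apply: ler_pM => //; exact: seminormC.
  rewrite (le_trans (seminormD hq _ _)) // (le_trans (lerD (seminormD hq _ _) p3)) //.
  rewrite (le_trans (lerD (lerD p1 p2) (lexx _))) // /B.
  have := mulr_ge0 (ltW e0') j10; have := mulr_ge0 (ltW e0') j20.
  have := ltW e0'; nra.
have hx1' k : q (x' k - (nu k)%:P) <= d1 by have := hx' k; rewrite le_min => /andP[].
have hx2' k : q (x' k - (nu k)%:P) <= d2 by have := hx' k; rewrite le_min => /andP[].
have [c1' _] := H1 x' t1 hx1'.
have {}h1 := h1 x' hx1' e e0 he; have {}h2 := h2 x' hx2' e e0 he.
have l1 := seminorm_lin hq J1 he; have l2 := seminorm_lin hq J2 he.
rewrite -/j1 in l1; rewrite -/j2 in l2.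
have -> : \sum_k (J1 k * a2 + a1 * J2 k) *: (x k - x' k)
   = (\sum_k J1 k *: (x k - x' k)) * a2%:P + a1%:P * (\sum_k J2 k *: (x k - x' k)).
  rewrite mulr_suml mulr_sumr -big_split /=; apply: eq_bigr => k _.
  by rewrite scalerDl -!mul_polyC !polyCM; ring.
set S1 := \sum_k _ in h1 l1 *; set S2 := \sum_k _ in h2 l2 *.
set D1 := G1 t x - G1 t x' in h1; set D2 := G2 t x - G2 t x' in h2.
have qD1 : q D1 <= (eta' + j1) * e.
  rewrite -(subrK S1 D1) (le_trans (seminormD hq _ _)) // mulrDl; exact: lerD.
have qD2 : q D2 <= (eta' + j2) * e.
  rewrite -(subrK S2 D2) (le_trans (seminormD hq _ _)) // mulrDl; exact: lerD.
have -> : G1 t x * G2 t x - G1 t x' * G2 t x' - (S1 * a2%:P + a1%:P * S2)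
  = D1 * (G2 t x - a2%:P) + (D1 - S1) * a2%:P + (G1 t x' - a1%:P) * D2
    + a1%:P * (D2 - S2) by rewrite /D1 /D2; ring.
have p1 : q (D1 * (G2 t x - a2%:P)) <= (eta' + j1) * e * eta'.
  by apply: le_trans (seminormM hq _ _) _; apply: ler_pM.
have p2 : q ((D1 - S1) * a2%:P) <= eta' * e * normc a2.
  by apply: le_trans (seminormM hq _ _) _; apply: ler_pM => //; exact: seminormC.
have p3 : q ((G1 t x' - a1%:P) * D2) <= eta' * ((eta' + j2) * e).
  by apply: le_trans (seminormM hq _ _) _; apply: ler_pM.
have p4 : q (a1%:P * (D2 - S2)) <= normc a1 * (eta' * e).
  by apply: le_trans (seminormM hq _ _) _; apply: ler_pM => //; exact: seminormC.
rewrite (le_trans (seminormD hq _ _)) //.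
rewrite (le_trans (lerD (seminormD hq _ _) p4)) //.
rewrite (le_trans (lerD (lerD (seminormD hq _ _) p3) (lexx _))) //.
rewrite (le_trans (lerD (lerD (lerD p1 p2) (lexx _)) (lexx _))) //.
apply: le_trans (ler_wpM2r e0 eB).
have -> : (eta' + j1) * e * eta' + eta' * e * normc a2 + eta' * ((eta' + j2) * e)
  + normc a1 * (eta' * e) = (2 * eta' + j1 + j2 + normc a1 + normc a2) * (eta' * e) by ring.
rewrite [eta' * B * e]mulrAC [leRHS]mulrC ler_wpM2r ?mulr_ge0 ?(ltW e0') //.
rewrite /B; lra.
Qed.

Lemma strict_diffN G a J : strict_diff G a J ->
  strict_diff (fun t x => - G t x) (- a) (fun k => - J k).
Proof.
move=> /(strict_diffM (strict_diff_cst (- 1))); apply: strict_diff_ext => [t x||k].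
- by rewrite polyCN polyC1 mulN1r.
- by rewrite mulN1r.
- by rewrite mul0r add0r mulN1r.
Qed.

Lemma strict_diff_prod (I : eqType) (r : seq I) (P : pred I)
    (G : I -> A -> ('I_N -> A) -> A) (a : I -> C) (J : I -> 'I_N -> C) :
  uniq r -> (forall s, P s -> strict_diff (G s) (a s) (J s)) ->
  strict_diff (fun t x => \prod_(s <- r | P s) G s t x) (\prod_(s <- r | P s) a s)
    (fun k => \sum_(s <- r | P s) J s k * \prod_(i <- r | P i && (i != s)) a i).
Proof.
move=> ur h; elim: r ur => [_|i r IH /= /andP[ir ur]].
  by apply: strict_diff_ext (strict_diff_cst 1) => [t x||k]; rewrite big_nil ?polyC1.
have {}IH := IH ur.
have hir s : s \in r -> (i != s) by move=> sr; apply: contraNneq ir => ->.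
have [Pi|Pi] := boolP (P i); last first.
  apply: strict_diff_ext IH => [t x||k]; rewrite big_cons (negbTE Pi) //.
  by apply: eq_bigr => s Ps; rewrite big_cons (negbTE Pi).
apply: strict_diff_ext (strict_diffM (h i Pi) IH) => [t x||k]; rewrite big_cons Pi //.
congr (_ * _ + _).
  rewrite big_cons eqxx andbF [LHS]big_seq_cond [RHS]big_seq_cond.
  by apply: eq_bigl => s; have [sr|//] := boolP (s \in r); rewrite eq_sym hir ?andbT.
rewrite mulr_sumr [LHS]big_seq_cond [RHS]big_seq_cond; apply: eq_bigr => s /andP[sr Ps].
by rewrite big_cons Pi hir //= mulrCA.
Qed.

End Functions.

Lemma strict_diff_all (N M : nat) (nu : 'I_N -> C) (G : 'I_M -> A -> ('I_N -> A) -> A)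
    (a : 'I_M -> C) (J : 'I_M -> 'I_N -> C) :
  (forall i, strict_diff nu (G i) (a i) (J i)) ->
  forall eta : R, 0 < eta -> exists d, 0 < d /\
    forall i q, algebra_seminorm q -> forall t x,
      q t <= d -> (forall k, q (x k - (nu k)%:P) <= d) ->
      q (G i t x - (a i)%:P) <= eta /\
      forall x', (forall k, q (x' k - (nu k)%:P) <= d) ->
      forall e, 0 <= e -> (forall k, q (x k - x' k) <= e) ->
      q (G i t x - G i t x' - \sum_k J i k *: (x k - x' k)) <= eta * e.
Proof.
move=> h eta eta0; apply: finite_uniform_radius => [i d d' d0 dd hd q hq t x td xd|i].
  have [|k|c hc] := hd q hq t x; first exact: le_trans dd.
    exact: le_trans (xd k) dd.
  split=> // x' x'd; apply: hc => k; exact: le_trans (x'd k) dd.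
exact: h.
Qed.

End Implicit.

(** * Implicit functions given by convergent power series *)

Section Solve.
Context {R : realType}.
Local Notation C := R[i].
Local Notation A := {poly R[i]}.

(** The Newton map with the derivative taken at the base point throughout is a
    contraction for every algebra seminorm that makes the data small.  Evaluation at a
    point gives uniqueness; with [l1norm r], for which ['X] has norm [r], the iterates
    are polynomials in the parameter and converge to an analytic solution. *)
Lemma implicit_function (N : nat) (nu : 'I_N -> C)
    (G : 'I_N -> A -> ('I_N -> A) -> A) (J : 'M[C]_N) (d0 : R) :
  (forall i, strict_diff nu (G i) 0 (fun k => J k i)) -> J \in unitmx ->
  (forall i t x tau,
     (G i t x).[tau]%:P = G i (t.[tau])%:P (fun k => (x k).[tau]%:P)) ->
  0 < d0 ->
  exists d r : R, [/\ 0 < d <= d0, 0 < r <= d0,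
    forall (t : C) (u u' : 'I_N -> C), normc t <= r ->
      (forall k, normc (u k - nu k) <= d) -> (forall k, normc (u' k - nu k) <= d) ->
      (forall i, (G i t%:P (fun k => (u k)%:P)).[0] = 0) ->
      (forall i, (G i t%:P (fun k => (u' k)%:P)).[0] = 0) -> forall k, u k = u' k
  & exists u : 'I_N -> C -> C, (forall k, poly_limit r (u k)) /\
      forall t, normc t < r -> (forall k, normc (u k t - nu k) <= d) /\
        forall i, (G i t%:P (fun k => (u k t)%:P)).[0] = 0].
Proof.
move=> hG Ju hom d00.
pose K := invmx J.
(* matrices act on rows here: [K] is the inverse of [J], read with the indices
   exchanged *)
have KJ k l : \sum_i K i k * J l i = (k == l)%:R.
  have /matrixP/(_ l k) := mulmxV Ju; rewrite !mxE eq_sym => <-.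
  by apply: eq_bigr => i _; rewrite mulrC.
pose B : R := 1 + \sum_i \sum_k normc (K i k).
have B0 : 0 < B.
  rewrite ltr_pwDl // sumr_ge0 // => i _; apply: sumr_ge0 => k _; exact: normc_ge0.
have KB k (e : R) (q : A -> R) (x : 'I_N -> A) : algebra_seminorm q -> 0 <= e ->
    (forall i, q (x i) <= e) -> q (\sum_i K i k *: x i) <= B * e.
  move=> hq e0 he; apply: le_trans (seminorm_lin hq _ he) _; apply: ler_wpM2r => //.
  rewrite /B ler_wpDl //; apply: ler_sum => i _; rewrite (bigD1 k) //= lerDl.
  by apply: sumr_ge0 => l _; exact: normc_ge0.
pose Phi t (x : 'I_N -> A) k := x k - \sum_i K i k *: G i t x.
have eta0 : 0 < (2 * B)^-1 by rewrite invr_gt0 mulr_gt0.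
have [d1 [d10 hd1]] := strict_diff_all hG eta0.
pose d := Num.min d1 d0.
have dp : 0 < d by rewrite lt_min d10.
have dd1 : d <= d1 by rewrite ge_min lexx.
have eta20 : 0 < d / (2 * B) by rewrite divr_gt0 // mulr_gt0.
have [r1 [r10 hr1]] := strict_diff_all hG eta20.
pose r := Num.min r1 d.
have rp : 0 < r by rewrite lt_min r10.
have rd : r <= d by rewrite ge_min lexx orbT.
have rd1 : r <= d1 by exact: le_trans dd1.
(* the linear part of [G] is cancelled by [K], so only the error of strict
   differentiability, enlarged by the bound [B] of [K], remains *)
have contr q (hq : algebra_seminorm q) t x x' e : q t <= r ->
    (forall k, q (x k - (nu k)%:P) <= d) -> (forall k, q (x' k - (nu k)%:P) <= d) ->
    0 <= e -> (forall k, q (x k - x' k) <= e) ->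
    forall k, q (Phi t x k - Phi t x' k) <= e / 2.
  move=> tr xd xd' e0 he k.
  have -> : Phi t x k - Phi t x' k
     = - \sum_i K i k *: (G i t x - G i t x' - \sum_l J l i *: (x l - x' l)).
    under [in RHS]eq_bigr do rewrite scalerBr.
    rewrite sumrB.
    have -> : \sum_i K i k *: (\sum_l J l i *: (x l - x' l)) = x k - x' k.
      under eq_bigr do rewrite scaler_sumr.
      rewrite exchange_big /= (bigD1 k) //= [X in _ + X]big1 => [|l lk].
        under eq_bigr do rewrite scalerA.
        by rewrite -scaler_suml KJ eqxx scale1r addr0.
      under eq_bigr do rewrite scalerA.
      by rewrite -scaler_suml KJ eq_sym (negbTE lk) scale0r.
    under eq_bigr do rewrite scalerBr.
    rewrite sumrB /Phi; ring.
  rewrite (seminormN hq).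
  have e2 : B * ((2 * B)^-1 * e) = e / 2 by field; rewrite gt_eqF.
  rewrite -e2; apply: KB => //.
    by rewrite mulr_ge0 // ltW.
  move=> i; have [||_ h] := hd1 i q hq t x.
  - exact: le_trans rd1.
  - by move=> l; exact: le_trans (xd l) dd1.
  by apply: h => // l; exact: le_trans (xd' l) dd1.
(* the ball is mapped into itself, because the base point moves by at most half its
   radius and distances are halved *)
have base q (hq : algebra_seminorm q) t : q t <= r ->
    forall k, q (Phi t (fun k => (nu k)%:P) k - (nu k)%:P) <= d / 2.
  move=> tr k; rewrite /Phi addrAC subrr add0r (seminormN hq).
  have e2 : B * (d / (2 * B)) = d / 2 by field; rewrite gt_eqF.
  rewrite -e2; apply: KB => //; first exact: ltW.
  move=> i; have [||h _] := hr1 i q hq t (fun k => (nu k)%:P).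
  - by apply: le_trans tr _; rewrite ge_min lexx.
  - by move=> l; rewrite subrr (seminorm0 hq) ltW.
  by move: h; rewrite polyC0 subr0.
have stable q (hq : algebra_seminorm q) t x : q t <= r ->
    (forall k, q (x k - (nu k)%:P) <= d) ->
    forall k, q (Phi t x k - (nu k)%:P) <= d.
  move=> tr xd k.
  rewrite -(subrK (Phi t (fun k => (nu k)%:P) k) (Phi t x k)) -addrA.
  rewrite (le_trans (seminormD hq _ _)) // [leRHS]splitr lerD ?base //.
  apply: contr => // [l|]; last exact: ltW.
  by rewrite subrr (seminorm0 hq) ltW.
exists d, r; split.
- by rewrite dp ge_min lexx orbT.
- by rewrite rp (le_trans rd) // ge_min lexx orbT.
- move=> t u u' tr ud ud' Gu Gu'.
  have hq := @eval_seminorm R 0.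
  have PhiE v k : (forall i, (G i t%:P (fun k => (v k)%:P)).[0] = 0) ->
      (Phi t%:P (fun k => (v k)%:P) k).[0] = v k.
    move=> h; rewrite /Phi hornerD hornerN hornerC horner_sum big1 ?subr0 //.
    by move=> i _; rewrite hornerZ h mulr0.
  have half e : 0 <= e -> (forall k, normc (u k - u' k) <= e) ->
      forall k, normc (u k - u' k) <= e / 2.
    move=> e0 he k.
    have := @contr _ hq t%:P (fun k => (u k)%:P) (fun k => (u' k)%:P) e.
    rewrite hornerC => /(_ tr) h.
    have := h _ _ e0 _ k; rewrite hornerD hornerN !PhiE //; apply => l.
    + by rewrite hornerD hornerN !hornerC.
    + by rewrite hornerD hornerN !hornerC.
    + by rewrite hornerD hornerN !hornerC.
  have iter n k : normc (u k - u' k) <= 2 * d * 2^-1 ^+ n.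
    elim: n k => [|n IH] k.
      have -> : u k - u' k = (u k - nu k) + (nu k - u' k) by ring.
      rewrite (le_trans (normcD _ _)) // expr0 mulr1 mulr_natl mulr2n lerD //.
      by rewrite normcB.
    rewrite exprSr mulrA; apply: half => //.
    by rewrite !mulr_ge0 ?exprn_ge0 // ltW.
  move=> k; apply/eqP; rewrite -subr_eq0 -normc_eq0; apply/negPn/negP => nz.
  have pz : 0 < normc (u k - u' k) by rewrite lt_def nz normc_ge0.
  have d2 : 0 < 2 * d by rewrite mulr_gt0.
  have [n _ /(_ n (leqnn n))] := nbhs_infty_half (divr_gt0 pz d2).
  by rewrite ltr_pdivlMr // mulrC ltNge iter.
pose p := fix p (j : nat) : 'I_N -> A :=
  if j is j'.+1 then Phi 'X (p j') else fun k => (nu k)%:P.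
have hq := l1norm_seminorm (ltW rp).
have Xr : l1norm r 'X <= r by rewrite l1normX.
have pd j : forall k, l1norm r (p j k - (nu k)%:P) <= d.
  elim: j => [|j IH] k /=; first by rewrite subrr l1norm0 ltW.
  exact: stable.
have pp j : forall k, l1norm r (p j.+1 k - p j k) <= d * 2^-1 ^+ j.
  elim: j => [|j IH] k; first by rewrite expr0 mulr1; exact: pd.
  rewrite [p j.+2]/(Phi 'X (p j.+1)) [p j.+1 in X in _ - X]/(Phi 'X (p j)).
  rewrite exprSr mulrA; apply: contr => //.
  by rewrite mulr_ge0 ?exprn_ge0 // ltW.
have ppt t : normc t <= r -> forall k j,
    normc ((p j.+1 k).[t] - (p j k).[t]) <= d * 2^-1 ^+ j.
  move=> tr k j; rewrite -hornerN -hornerD; apply: le_trans (pp j k).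
  exact: horner_l1norm.
have /choice[u hu] : forall kt : 'I_N * C, exists l : C, normc kt.2 < r ->
    forall j, normc ((p j kt.1).[kt.2] - l) <= d * 2 * 2^-1 ^+ j.
  move=> [k t] /=.
  have [tr|tr] := ltP (normc t) r; last by exists 0.
  by have [l hl] := geometric_limit (ppt t (ltW tr) k); exists l.
have small (x : R) (c : R) : 0 < c -> (forall j, x <= c * 2^-1 ^+ j) -> x <= 0.
  move=> c0 h; rewrite leNgt; apply/negP => x0.
  have [n _ /(_ n (leqnn n))] := nbhs_infty_half (divr_gt0 x0 c0).
  by rewrite ltr_pdivlMr // mulrC ltNge h.
exists (fun k t => u (k, t)); split=> [k|t tr].
  exists (fun j => p j k), d; split=> // t tr e e0.
  have d2 : 0 < d * 2 by rewrite mulr_gt0.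
  have [n _ hn] := nbhs_infty_half (divr_gt0 e0 d2).
  exists n => j jn; rewrite (le_lt_trans (hu (k, t) tr j)) //.
  by rewrite mulrC -ltr_pdivlMr // hn.
have hut k j : normc ((p j k).[t] - u (k, t)) <= d * 2 * 2^-1 ^+ j by exact: (hu (k, t)).
have ud k : normc (u (k, t) - nu k) <= d.
  rewrite -subr_le0; apply: (@small _ (d * 2)); first by rewrite mulr_gt0.
  move=> j; rewrite lerBlDr -(subrK (p j k).[t] (u (k, t))) -addrA.
  rewrite (le_trans (normcD _ _)) // lerD //; first by rewrite normcB.
  have := horner_l1norm (p j k - (nu k)%:P) (ltW tr).
  by rewrite hornerD hornerN hornerC => /le_trans; apply.
split=> // i.
have hq0 := @eval_seminorm R 0.
have PhiH j k : Phi t%:P (fun k => (p j k).[t]%:P) k = (p j.+1 k).[t]%:P.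
  rewrite /= /Phi hornerD hornerN horner_sum polyCD polyCN; congr (_ - _).
  rewrite (raddf_sum (@polyC C)); apply: eq_bigr => l _.
  rewrite hornerZ; apply: etrans (esym (polyCM _ _)).
  by rewrite hom hornerX mul_polyC.
(* both sides are close to the next iterate *)
have fixu k : (Phi t%:P (fun k => (u (k, t))%:P) k).[0] = u (k, t).
  apply/eqP; rewrite -subr_eq0 -normc_eq0 eq_le normc_ge0 andbT.
  apply: (@small _ (d * 2)); first by rewrite mulr_gt0.
  move=> j.
  rewrite -(subrK (p j.+1 k).[t] (Phi _ _ _).[0]) -addrA.
  rewrite (le_trans (normcD _ _)) //.
  have -> : d * 2 * 2^-1 ^+ j = d * 2 * 2^-1 ^+ j / 2 + d * 2 * 2^-1 ^+ j.+1.
    by rewrite exprSr mulrA -splitr.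
  rewrite lerD ?hut // normcB.
  have := @contr _ hq0 t%:P (fun k => (p j k).[t]%:P) (fun k => (u (k, t))%:P)
    (d * 2 * 2^-1 ^+ j).
  rewrite hornerC => /(_ (ltW tr)) h; have := h _ _ _ _ k.
  rewrite hornerD hornerN PhiH hornerC; apply => [l|l||l].
  - rewrite hornerD hornerN !hornerC.
    have := horner_l1norm (p j l - (nu l)%:P) (ltW tr).
    by rewrite hornerD hornerN hornerC => /le_trans; apply.
  - by rewrite hornerD hornerN !hornerC.
  - by rewrite !mulr_ge0 ?exprn_ge0 // ltW.
  - by rewrite hornerD hornerN !hornerC.
set g := fun i => (G i t%:P (fun k => (u (k, t))%:P)).[0].
have Kg k : \sum_i K i k * g i = 0.
  have := fixu k; rewrite /Phi hornerD hornerN hornerC horner_sum => /eqP.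
  rewrite -[X in _ == X]subr0 (inj_eq (addrI _)) eqr_opp => /eqP h.
  by apply: etrans h; apply: eq_bigr => l _; rewrite hornerZ.
have : \row_l g l *m K = 0.
  apply/rowP => k; rewrite !mxE; apply: etrans (Kg k).
  by apply: eq_bigr => l _; rewrite mxE mulrC.
move=> /(congr1 (mulmx^~ J)); rewrite -mulmxA mulVmx // mulmx1 mul0mx => /rowP/(_ i).
by rewrite !mxE.
Qed.

End Solve.

(** * The local problem: right-hand side a power of the variable *)

Section LocalProblem.
Context {R : realType}.
Local Notation C := R[i].
Implicit Types (f h df dh P Q : {poly C}).

(** The left-hand side of the qq-equation with parameter 1, to which the local problem
    is scaled. *)
Definition qq1 f h : {poly C} := f * h + (f * h^`() - h * f^`()).

Definition potential f h : {poly C} :=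
  f^`() * h + 2%:R * f^`() * h^`() + f^`() * h^`()^`() - f^`()^`() * h^`() - f^`()^`() * h.

(** The first factor of a solution solves a second order equation, whose zeroth
    order coefficient is bilinear in the solution. *)
Lemma potential_ode f h :
  qq1 f h * f^`()^`() - (qq1 f h)^`() * f^`() - qq1 f h * f^`() + potential f h * f = 0.
Proof. by rewrite /qq1 /potential !poly.derivE; ring. Qed.

(** Polarized form of [potential_ode]: the right-hand side of the qq-equation does not
    vary along a tangent vector, while the bilinear potential varies by the product
    rule. *)
Lemma potential_ode_tangent f h df dh : qq1 df h + qq1 f dh = 0 ->
  qq1 f h * df^`()^`() - (qq1 f h)^`() * df^`() - qq1 f h * df^`() + potential f h * df
  + (potential df h + potential f dh) * f = 0.
Proof.
move=> E0.
have -> : qq1 f h * df^`()^`() - (qq1 f h)^`() * df^`() - qq1 f h * df^`() + potential f h * df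
  + (potential df h + potential f dh) * f
  = - ((qq1 df h + qq1 f dh) * f^`()^`() - (qq1 df h + qq1 f dh)^`() * f^`()
       - (qq1 df h + qq1 f dh) * f^`()).
  by rewrite /qq1 /potential !poly.derivE; ring.
by rewrite E0 poly.derivE; ring.
Qed.

Lemma coefM_low P Q l : (forall i, (i <= l)%N -> P`_i = 0) -> (P * Q)`_l = 0.
Proof.
by move=> h; rewrite coefM big1 // => i _; rewrite h ?mul0r // -ltnS.
Qed.

Lemma coefM_low_cancel P f n : f`_0 != 0 ->
  (forall l, (l < n)%N -> (P * f)`_l = 0) -> forall l, (l < n)%N -> P`_l = 0.
Proof.
move=> f0 h; elim/ltn_ind => l IH ln.
have := h l ln; rewrite coefM big_ord_recr /= subnn big1 => [|i _].
  by rewrite add0r => /eqP; rewrite mulf_eq0 (negbTE f0) orbF => /eqP.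
by rewrite IH ?mul0r // (ltn_trans _ ln).
Qed.

Lemma poly_monomial P k : (size P <= k.+1)%N -> (forall l, (l < k)%N -> P`_l = 0) ->
  P = P`_k *: 'X^k.
Proof.
move=> sP h; apply/polyP => l; rewrite coefZ coefXn.
case: (ltngtP l k) => [lk|lk|->]; rewrite ?mulr1 ?mulr0 //; first exact: h.
by rewrite nth_default // (leq_trans sP).
Qed.

Lemma size_deriv_leq P : (size P^`() <= (size P).-1)%N.
Proof. by rewrite /deriv size_poly. Qed.

Lemma size_mul_leq_bound P Q a b n : (size P <= a)%N -> (size Q <= b)%N ->
  ((a + b).-1 <= n)%N -> (size (P * Q)%R <= n)%N.
Proof.
move=> sP sQ abn; apply: leq_trans (size_polyMleq _ _) _; apply: leq_trans abn.
by rewrite -!subn1 leq_sub2r // leq_add.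
Qed.

Lemma size_add_leq P Q n : (size P <= n)%N -> (size Q <= n)%N -> (size (P + Q)%R <= n)%N.
Proof. by move=> h1 h2; apply: leq_trans (size_polyD _ _) _; rewrite geq_max h1. Qed.

Lemma size_sub_leq P Q n : (size P <= n)%N -> (size Q <= n)%N -> (size (P - Q)%R <= n)%N.
Proof. by move=> h1 h2; apply: size_add_leq; rewrite ?size_polyN. Qed.

Lemma size_potential f h c e : (size f <= c.+1)%N -> (size h <= e.+1)%N ->
  (size (potential f h) <= c + e)%N.
Proof.
move=> sf sh.
have sf1 : (size f^`() <= c)%N by apply: leq_trans (size_deriv_leq _) _; lia.
have sh1 : (size h^`() <= e)%N by apply: leq_trans (size_deriv_leq _) _; lia.
have sf2 : (size f^`()^`() <= c)%N by apply: leq_trans (size_deriv_leq _) _; lia.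
have sh2 : (size h^`()^`() <= e)%N by apply: leq_trans (size_deriv_leq _) _; lia.
rewrite /potential -mulrA.
do ?[apply: size_sub_leq | apply: size_add_leq].
- by apply: size_mul_leq_bound sf1 sh _; lia.
- apply: (@size_mul_leq_bound _ _ 1 (c + e)).
  + by rewrite -polyC_natr size_polyC_leq1.
  + by apply: size_mul_leq_bound sf1 sh1 _; lia.
  + by lia.
- by apply: size_mul_leq_bound sf1 sh2 _; lia.
- by apply: size_mul_leq_bound sf2 sh1 _; lia.
- by apply: size_mul_leq_bound sf2 sh _; lia.
Qed.

Lemma size_qq1_lower f h c e : (size f <= c.+1)%N -> (size h <= e.+1)%N ->
  (size (f * h^`() - h * f^`())%R <= c + e)%N.
Proof.
move=> sf sh.
have sf1 : (size f^`() <= c)%N by apply: leq_trans (size_deriv_leq _) _; lia.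
have sh1 : (size h^`() <= e)%N by apply: leq_trans (size_deriv_leq _) _; lia.
apply: size_sub_leq.
  by apply: size_mul_leq_bound sf sh1 _; lia.
by apply: size_mul_leq_bound sh sf1 _; lia.
Qed.

Lemma size_qq1 f h c e : size f = c.+1 -> size h = e.+1 -> size (qq1 f h) = (c + e).+1.
Proof.
move=> sf sh.
have f0 : f != 0 by rewrite -size_poly_gt0 sf.
have h0 : h != 0 by rewrite -size_poly_gt0 sh.
have s : size (f * h) = (c + e).+1 by rewrite size_mul // sf sh addSn addnS.
by rewrite /qq1 size_polyDl s // ltnS size_qq1_lower ?sf ?sh.
Qed.

(** The lowest term of the left-hand side is that of [h * f^`()], whose order is one less
    than the order of [f]. *)
Lemma qq_vanishing_order f h (a : C) k : a != 0 ->
  (forall l, (l < k)%N -> (f * h + a *: (f * h^`() - h * f^`()))`_l = 0) ->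
  f`_0 = 0 -> h`_0 != 0 -> forall l, (l <= k)%N -> f`_l = 0.
Proof.
move=> a0 hl f0 h0; elim/ltn_ind => -[|l] IH lk //.
have low i : (i <= l)%N -> f`_i = 0 by move=> il; apply: IH; lia.
have := hl l lk; rewrite coefD coefZ coefB !(coefM_low _ low) add0r sub0r coefM.
rewrite big_ord_recl big1 => [|i _]; last first.
  have il := ltn_ord i; rewrite coef_deriv low ?mul0rn ?mulr0 //= /bump /=; lia.
rewrite addr0 subn0 coef_deriv => /eqP; rewrite mulf_eq0 (negbTE a0) oppr_eq0.
by rewrite mulf_eq0 (negbTE h0) mulrn_eq0 /= => /eqP.
Qed.

(** By [potential_ode] the product [potential f h * f] inherits, up to one order lost by
    differentiation, the vanishing of the right-hand side at the origin, and [f] can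
    be cancelled. *)
Lemma potential_low f h k : (forall l, (l < k.+1)%N -> (qq1 f h)`_l = 0) -> f`_0 != 0 ->
  forall l, (l < k)%N -> (potential f h)`_l = 0.
Proof.
move=> hl f0; apply: (coefM_low_cancel f0) => l lk.
have := congr1 (fun p : {poly C} => p`_l) (potential_ode f h).
have low i : (i <= l)%N -> (qq1 f h)`_i = 0 by move=> il; apply: hl; lia.
have low' i : (i <= l)%N -> (qq1 f h)^`()`_i = 0.
  by move=> il; rewrite coef_deriv hl ?mul0rn //; lia.
rewrite /= coefD !coefB coef0 !(coefM_low _ low) (coefM_low _ low').
by rewrite !subr0 add0r.
Qed.

(** For a monomial right-hand side the equation is Kummer's; its coefficients
    obey a two-term recursion. *)
Lemma kummer_recursion P (zeta theta : C) k :
  (zeta *: 'X^(k.+1)) * P^`()^`() - (zeta *: 'X^(k.+1))^`() * P^`() - (zeta *: 'X^(k.+1)) * P^`()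
    + (theta *: 'X^k) * P = 0 ->
  forall l, zeta * l.+1%:R * (l%:R - k.+1%:R) * P`_l.+1 = (zeta * l%:R - theta) * P`_l.
Proof.
have -> : (zeta *: 'X^(k.+1)) * P^`()^`() - (zeta *: 'X^(k.+1))^`() * P^`()
    - (zeta *: 'X^(k.+1)) * P^`() + (theta *: 'X^k) * P
  = (zeta *: (P^`()^`() * 'X - k.+1%:R *: P^`() - P^`() * 'X) + theta *: P) * 'X^k.
  by rewrite derivZ derivXn /= -!mul_polyC -mulr_natl -polyC_natr exprSr; ring.
move=> /eqP; rewrite mulf_eq0 expf_eq0 polyX_eq0 andbF orbF => /eqP/polyP h l.
have := h l; rewrite coefD !coefZ !coefB coefZ !coefMX coef0 !coef_deriv.
case: l => [|l] /=; rewrite ?coef_deriv => e; apply/eqP; rewrite -subr_eq0; apply/eqP.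
- by rewrite -[RHS]e; ring.
- by rewrite -[RHS]e; ring.
Qed.

Lemma natrB_neq0 (a b : nat) : a != b -> (a%:R - b%:R : C) != 0.
Proof. by rewrite subr_eq0 eqr_nat. Qed.

(** A local solution that does not vanish at the origin is isolated: its potential
    is forced to be a monomial, so it does not vary along a tangent vector, and
    then the degrees leave no room for one. *)
Lemma local_nondegenerate f h df dh c e k :
  f \is monic -> h \is monic -> size f = c.+1 -> size h = e.+1 -> (c + e = k.+1)%N ->
  qq1 f h = 'X^(k.+1) -> f`_0 != 0 ->
  (size df <= c)%N -> (size dh <= e)%N -> qq1 df h + qq1 f dh = 0 ->
  df = 0 /\ dh = 0.
Proof.
move=> fm hm sf sh ce E f0 sdf sdh dE.
have Elow l : (l < k.+1)%N -> (qq1 f h)`_l = 0.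
  by move=> lk; rewrite E coefXn ltn_eqF.
have Qm := poly_monomial (leq_trans (size_potential (eq_leq sf) (eq_leq sh)) (eq_leq ce))
  (potential_low Elow f0).
set theta := _`_k in Qm.
have E1 : qq1 f h = 1 *: 'X^(k.+1) by rewrite scale1r.
(* the recursion at the leading coefficient *)
have thetaE : theta = c%:R.
  have := potential_ode f h; rewrite Qm E1 => /kummer_recursion/(_ c).
  rewrite (nth_default _ (eq_leq sf)) mulr0 => /esym/eqP.
  have -> : f`_c = 1 by move/monicP: fm; rewrite lead_coefE sf.
  by rewrite mulr1 mul1r subr_eq0 => /eqP.
have dQ0 : potential df h + potential f dh = 0.
  have dQlow l : (l < k)%N -> (potential df h + potential f dh)`_l = 0.
    move: l; apply: (coefM_low_cancel f0) => l lk.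
    have := congr1 (fun p : {poly C} => p`_l) (potential_ode_tangent dE).
    have low i : (i <= l)%N -> ('X^(k.+1) : {poly C})`_i = 0.
      by move=> il; rewrite coefXn ltn_eqF //; lia.
    have low1 i : (i <= l)%N -> ('X^(k.+1) : {poly C})^`()`_i = 0.
      by move=> il; rewrite coef_deriv coefXn ltn_eqF ?mul0rn //; lia.
    have low2 i : (i <= l)%N -> (theta *: 'X^k)`_i = 0.
      by move=> il; rewrite coefZ coefXn ltn_eqF ?mulr0 //; lia.
    rewrite /= E Qm coefD coef0 [X in X + _]coefD !coefB !(coefM_low _ low).
    rewrite (coefM_low _ low1) (coefM_low _ low2).
    by rewrite !subr0 !add0r.
  have sQ : (size (potential df h + potential f dh)%R <= k)%N.
    apply: size_add_leq.
      case: c sdf ce {sf thetaE} => [|c'] sdf ce.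
        have -> : df = 0 by apply/eqP; rewrite -size_poly_leq0.
        by rewrite /potential !poly.derivE !(mul0r, mulr0) !subr0 !addr0 size_poly0.
      by apply: leq_trans (size_potential sdf (eq_leq sh)) _; lia.
    case: e sdh ce {sh} => [|e'] sdh ce.
      have -> : dh = 0 by apply/eqP; rewrite -size_poly_leq0.
      by rewrite /potential !poly.derivE !(mul0r, mulr0) !subr0 !addr0 size_poly0.
    by apply: leq_trans (size_potential (eq_leq sf) sdh) _; lia.
  apply/polyP => l; rewrite coef0; have [lk|lk] := ltnP l k; first exact: dQlow.
  by rewrite nth_default // (leq_trans sQ).
have df0 : df = 0.
  apply/eqP/negPn/negP => nz.
  have sp : (0 < size df)%N by rewrite size_poly_gt0.
  have := potential_ode_tangent dE; rewrite dQ0 mul0r addr0 Qm E1.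
  move=> /kummer_recursion/(_ (size df).-1).
  rewrite prednK // nth_default // mulr0 thetaE mul1r => /esym/eqP.
  rewrite mulf_eq0 -/(lead_coef df) lead_coef_eq0 (negbTE nz) orbF.
  by apply/negP/natrB_neq0; lia.
split=> //; move: dE; rewrite df0 /qq1 !poly.derivE !(mul0r, mulr0) subr0 !add0r => dE.
apply/eqP/negPn/negP => nz.
have sp : (0 < size dh)%N by rewrite size_poly_gt0.
have f1 : f != 0 by rewrite monic_neq0.
have : (size (f * dh)%R <= c + (size dh).-1)%N.
  rewrite -[f * dh](addrK (f * dh^`() - dh * f^`())) dE sub0r size_polyN.
  by apply: size_qq1_lower; rewrite ?sf // prednK.
by rewrite size_mul // sf; move: sp; case: (size dh) => // s _; rewrite addSn addnS /= ltnn.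
Qed.

Section Limit.
Context {U : set_system nat} {UU : UltraFilter U}.

Definition poly_ulim (F : nat -> {poly C}) P : Prop :=
  forall l, ulim U (fun j => (F j)`_l) P`_l.

Lemma poly_ulim_cst P : poly_ulim (fun=> P) P.
Proof. by move=> l; apply: ulim_cst. Qed.

Lemma poly_ulimD F G P Q : poly_ulim F P -> poly_ulim G Q ->
  poly_ulim (fun j => F j + G j) (P + Q).
Proof.
move=> hP hQ l; rewrite coefD.
by apply: eq_ulim (ulimD (hP l) (hQ l)) => j; rewrite coefD.
Qed.

Lemma poly_ulimN F P : poly_ulim F P -> poly_ulim (fun j => - F j) (- P).
Proof.
move=> hP l; rewrite coefN.
by apply: eq_ulim (ulimN (hP l)) => j; rewrite coefN.
Qed.

Lemma poly_ulimM F G P Q : poly_ulim F P -> poly_ulim G Q ->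
  poly_ulim (fun j => F j * G j) (P * Q).
Proof.
move=> hP hQ l; rewrite coefM.
apply: eq_ulim (@ulim_sum _ U _ _ (index_enum 'I_l.+1) xpredT
  (fun i j => (F j)`_i * (G j)`_(l - i)) (fun i : 'I_l.+1 => P`_i * Q`_(l - i))
  (fun i _ => ulimM (hP i) (hQ (l - i)%N))) => j.
by rewrite coefM.
Qed.

Lemma poly_ulim_deriv F P : poly_ulim F P -> poly_ulim (fun j => (F j)^`()) P^`().
Proof.
move=> hP l; rewrite coef_deriv -mulr_natr.
apply: eq_ulim (ulimM (hP l.+1) (ulim_cst _)) => j.
by rewrite coef_deriv mulr_natr.
Qed.

Lemma poly_ulim_prod (I : Type) (r : seq I) (B : pred I) (F : I -> nat -> {poly C})
    (G : I -> {poly C}) : (forall i, B i -> poly_ulim (F i) (G i)) ->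
  poly_ulim (fun j => \prod_(i <- r | B i) F i j) (\prod_(i <- r | B i) G i).
Proof.
move=> h; elim: r => [|i r IH].
  rewrite big_nil => l; apply: eq_ulim (poly_ulim_cst 1 l) => j; by rewrite big_nil.
rewrite big_cons; case: ifP => Bi l.
  by apply: eq_ulim (poly_ulimM (h i Bi) IH l) => j; rewrite big_cons Bi.
by apply: eq_ulim (IH l) => j; rewrite big_cons Bi.
Qed.

Lemma poly_ulim_coef0 F P l : poly_ulim F P -> U [set j | (F j)`_l = 0]%classic ->
  P`_l = 0.
Proof.
move=> hP h; apply: (@ulim_unique R U _ (fun j => (F j)`_l)); first exact: hP.
apply: ulim_near (ulim_cst 0).
by apply: filterS h => j /= ->.
Qed.

Lemma poly_ulim_qq1 F H f h : poly_ulim F f -> poly_ulim H h ->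
  poly_ulim (fun j => qq1 (F j) (H j)) (qq1 f h).
Proof.
move=> hF hH; apply: poly_ulimD; first exact: poly_ulimM.
by apply: poly_ulimD; [|apply: poly_ulimN]; apply: poly_ulimM => //; apply: poly_ulim_deriv.
Qed.

Lemma poly_ulim_potential F H f h : poly_ulim F f -> poly_ulim H h ->
  poly_ulim (fun j => potential (F j) (H j)) (potential f h).
Proof.
move=> hF hH.
have hF1 := poly_ulim_deriv hF; have hH1 := poly_ulim_deriv hH.
have hF2 := poly_ulim_deriv hF1; have hH2 := poly_ulim_deriv hH1.
exact: (poly_ulimD (poly_ulimD (poly_ulimD (poly_ulimD (poly_ulimM hF1 hH)
  (poly_ulimM (poly_ulimM (poly_ulim_cst _) hF1) hH1)) (poly_ulimM hF1 hH2))
  (poly_ulimN (poly_ulimM hF2 hH1))) (poly_ulimN (poly_ulimM hF2 hH))).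
Qed.

(** Vanishing of the solution at the origin cannot appear in the limit: away from
    the limit the potential is divisible by ['X^k], this passes to the limit, and
    then Kummer's recursion propagates a zero at the origin to all coefficients. *)
Lemma limit_nonvanishing F H f h c e k : (c + e = k.+1)%N ->
  poly_ulim F f -> poly_ulim H h -> size f = c.+1 -> size h = e.+1 ->
  U [set j | forall l, (l < k.+1)%N -> (qq1 (F j) (H j))`_l = 0]%classic ->
  U [set j | (F j)`_0 = 0 -> (H j)`_0 != 0]%classic ->
  f`_0 != 0 /\ h`_0 != 0.
Proof.
move=> ce hF hH sf sh hL cop.
have f0 : f != 0 by rewrite -size_poly_gt0 sf.
have h0 : h != 0 by rewrite -size_poly_gt0 sh.
have low0 P d : (size P <= d.+1)%N -> (d <= k.+1)%N ->
    (forall l, (l <= k.+1)%N -> P`_l = 0) -> P = 0.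
  move=> sP dk hl; apply/polyP => l; rewrite coef0.
  have [lk|lk] := leqP l k.+1; first exact: hl.
  by rewrite nth_default // (leq_trans sP) // (leq_ltn_trans dk).
have ck : (c <= k.+1)%N by rewrite -ce leq_addr.
have ek : (e <= k.+1)%N by rewrite -ce leq_addl.
(* otherwise [qq_vanishing_order] makes [F j], hence [f], vanish beyond its degree *)
have Fj0 : U [set j | (F j)`_0 != 0]%classic.
  have [//|hU] := in_ultra_setVsetC [set j | (F j)`_0 != 0]%classic UU.
  case/negP: f0; apply/eqP; apply: (low0 _ c) => //; first by rewrite sf.
  move=> l lk; apply: (poly_ulim_coef0 hF).
  apply: filterS (filterI hU (filterI hL cop)) => j /= [/negP/negPn/eqP a [b d]].
  apply: (@qq_vanishing_order (F j) (H j) 1 k.+1) => //.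
  - by move=> i; rewrite scale1r; apply: b.
  - exact: d.
have Llow l : (l < k.+1)%N -> (qq1 f h)`_l = 0.
  move=> lk; apply: (poly_ulim_coef0 (poly_ulim_qq1 hF hH)).
  by apply: filterS hL => j /=; apply.
have sL := size_qq1 sf sh; rewrite ce in sL.
have Lm := poly_monomial (eq_leq sL) Llow.
have zeta0 : (qq1 f h)`_k.+1 != 0.
  have : lead_coef (qq1 f h) != 0 by rewrite lead_coef_eq0 -size_poly_gt0 sL.
  by rewrite lead_coefE sL.
set zeta := _`_k.+1 in Lm zeta0.
have Qlow l : (l < k)%N -> (potential f h)`_l = 0.
  move=> lk; apply: (poly_ulim_coef0 (poly_ulim_potential hF hH)).
  apply: filterS (filterI Fj0 hL) => j /= [a b].
  exact: potential_low b a l lk.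
have Qm := poly_monomial (leq_trans (size_potential (eq_leq sf) (eq_leq sh)) (eq_leq ce)) Qlow.
have ode := potential_ode f h; rewrite Lm Qm in ode.
have rec := kummer_recursion ode.
have ff0 : f`_0 != 0.
  apply/negP => /eqP z; case/negP: f0; apply/eqP.
  apply: (low0 _ c) => //; first by rewrite sf.
  elim=> [//|l IH] lk; have := rec l; rewrite IH ?(ltnW lk) // mulr0 => /eqP.
  rewrite !mulf_eq0 (negbTE zeta0) pnatr_eq0 /=.
  have /negbTE -> : (l%:R - k.+1%:R : C) != 0 by apply: natrB_neq0; rewrite ltn_eqF.
  by move=> /eqP.
split=> //; apply/negP => /eqP z; case/negP: h0; apply/eqP.
apply: (low0 _ e) => //; first by rewrite sh.
have neg1 : (- 1 : C) != 0 by rewrite oppr_eq0 oner_neq0.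
apply: (qq_vanishing_order neg1 _ z ff0) => l lk.
by rewrite scaleN1r opprB [h * f]mulrC; exact: Llow.
Qed.

End Limit.
End LocalProblem.

(** * Polynomials with moving roots *)

Section RootsPoly.
Context {R : realType} {N : nat}.
Local Notation C := R[i].
Implicit Types (b : pred 'I_N) (w nu v : 'I_N -> C).

Definition roots_poly b w : {poly C} := \prod_(i | b i) ('X - (w i)%:P).

(** Derivative of [roots_poly b w] when the roots move with velocities [v]. *)
Definition roots_poly_tangent b w v : {poly C} :=
  - \sum_(i | b i) v i *: roots_poly (fun s => b s && (s != i)) w.

Lemma eq_roots_poly b b' w : b =1 b' -> roots_poly b w = roots_poly b' w.
Proof. by move=> e; apply: eq_bigl. Qed.

Lemma size_roots_poly b w : size (roots_poly b w) = #|b|.+1.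
Proof.
have -> : roots_poly b w = \prod_(i <- enum b) ('X - (w i)%:P) by rewrite big_enum.
by rewrite size_prod_XsubC cardE.
Qed.

Lemma monic_roots_poly b w : roots_poly b w \is monic.
Proof. exact: monic_prod_XsubC. Qed.

Lemma roots_poly_split b w i : b i ->
  roots_poly b w = ('X - (w i)%:P) * roots_poly (fun s => b s && (s != i)) w.
Proof. by move=> bi; rewrite /roots_poly (bigD1 i). Qed.

Lemma roots_polyID b sg w : roots_poly b w =
  roots_poly (fun s => b s && sg s) w * roots_poly (fun s => b s && ~~ sg s) w.
Proof. by rewrite /roots_poly (bigID sg). Qed.

Lemma horner_roots_poly b w x : (roots_poly b w).[x] = \prod_(i | b i) (x - w i).
Proof. by rewrite horner_prod; apply: eq_bigr => i _; rewrite hornerXsubC. Qed.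

Lemma roots_poly_eq0 b w i : b i -> (roots_poly b w).[w i] = 0.
Proof. by move=> bi; rewrite horner_roots_poly (bigD1 i) //= subrr mul0r. Qed.

Lemma deriv_roots_poly_at b w i : b i ->
  (roots_poly b w)^`().[w i] = \prod_(s | b s && (s != i)) (w i - w s).
Proof.
move=> bi; rewrite (roots_poly_split _ bi) derivM derivXsubC mul1r.
by rewrite hornerD hornerM hornerXsubC subrr mul0r addr0 horner_roots_poly.
Qed.

Lemma deriv_prod_cond (I : eqType) (r : seq I) (P : pred I) (F : I -> {poly C}) :
  uniq r -> (\prod_(s <- r | P s) F s)^`() =
    \sum_(s <- r | P s) (F s)^`() * \prod_(i <- r | P i && (i != s)) F i.
Proof.
elim: r => [_|i r IH /= /andP[ir ur]]; first by rewrite !big_nil -polyC1 derivC.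
have {}IH := IH ur.
have hir s : s \in r -> (i != s) by move=> sr; apply: contraNneq ir => ->.
have [Pi|Pi] := boolP (P i); last first.
  rewrite !big_cons (negbTE Pi) IH.
  by apply: eq_bigr => s Ps; rewrite big_cons (negbTE Pi).
rewrite !big_cons Pi derivM IH; congr (_ * _ + _).
  rewrite eqxx andbF [LHS]big_seq_cond [RHS]big_seq_cond.
  by apply: eq_bigl => s; have [sr|//] := boolP (s \in r); rewrite eq_sym hir ?andbT.
rewrite mulr_sumr [LHS]big_seq_cond [RHS]big_seq_cond; apply: eq_bigr => s /andP[sr Ps].
by rewrite big_cons Pi hir //= mulrCA.
Qed.

Lemma deriv_roots_poly b w :
  (roots_poly b w)^`() = \sum_(i | b i) roots_poly (fun s => b s && (s != i)) w.
Proof.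
rewrite deriv_prod_cond ?index_enum_uniq //.
by apply: eq_bigr => i _; rewrite derivXsubC mul1r.
Qed.

Lemma roots_poly_tangent_split b w v i : b i ->
  roots_poly_tangent b w v =
    - (v i *: roots_poly (fun s => b s && (s != i)) w)
    + ('X - (w i)%:P) * roots_poly_tangent (fun s => b s && (s != i)) w v.
Proof.
move=> bi; rewrite /roots_poly_tangent (bigD1 i) //= opprD mulrN; congr (_ - _).
rewrite mulr_sumr; apply: eq_bigr => s /andP[bs si].
rewrite (@roots_poly_split _ _ i) ?bi 1?eq_sym // -scalerAr; congr (_ *: (_ * _)).
by apply: eq_roots_poly => r; rewrite andbAC.
Qed.

Lemma roots_poly_tangentID b sg w v : roots_poly_tangent b w v =
  roots_poly_tangent (fun s => b s && sg s) w v * roots_poly (fun s => b s && ~~ sg s) w +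
  roots_poly (fun s => b s && sg s) w * roots_poly_tangent (fun s => b s && ~~ sg s) w v.
Proof.
rewrite /roots_poly_tangent (bigID sg) /= mulNr mulrN -opprD; congr (- (_ + _)).
  rewrite mulr_suml; apply: eq_bigr => i /andP[bi si].
  rewrite -scalerAl (roots_polyID _ sg); congr (_ *: (_ * _)).
    by apply: eq_roots_poly => s; rewrite andbAC.
  apply: eq_roots_poly => s; rewrite andbAC andb_idr // => /andP[_].
  by apply: contraNneq => ->.
rewrite mulr_sumr; apply: eq_bigr => i /andP[bi si].
rewrite -scalerAr (roots_polyID _ sg); congr (_ *: (_ * _)).
  apply: eq_roots_poly => s; rewrite andbAC andb_idr // => /andP[_].
  by apply: contraTneq => ->.
by apply: eq_roots_poly => s; rewrite andbAC.
Qed.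

Lemma size_roots_poly_tangent b w v : (size (roots_poly_tangent b w v) <= #|b|)%N.
Proof.
rewrite size_polyN; apply: (leq_trans (size_sum _ _ _)); apply/bigmax_leqP => i bi.
rewrite (leq_trans (size_scale_leq _ _)) // size_roots_poly.
by rewrite (cardD1 i b) [i \in b]bi add1n ltnS subset_leq_card //; apply/fintype.subsetP => s; rewrite !inE /in_mem /= andbC.
Qed.

Lemma roots_poly_tangent_at b w v i : b i ->
  (roots_poly_tangent b w v).[w i] = - (v i * (roots_poly b w)^`().[w i]).
Proof.
move=> bi; rewrite (roots_poly_tangent_split _ _ bi) hornerD hornerM hornerXsubC subrr.
by rewrite mul0r addr0 hornerN hornerZ deriv_roots_poly_at // horner_roots_poly.
Qed.

(** Variation of [\prod_(s != i) (w i - w s)], which is the value of the derivative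
    at a root that moves with the polynomial. *)
Lemma roots_poly_tangent_deriv_at b w v i : b i ->
  (roots_poly_tangent b w v)^`().[w i] + v i * (roots_poly b w)^`()^`().[w i] =
  \sum_(s | b s && (s != i)) (v i - v s) *
     \prod_(r | (b r && (r != i)) && (r != s)) (w i - w r).
Proof.
have aux (g dg : {poly C}) (a x : C) :
    (- (a *: g) + ('X - x%:P) * dg)^`().[x] + a * (('X - x%:P) * g)^`()^`().[x] =
    a * g^`().[x] + dg.[x].
  by rewrite !poly.derivE !(hornerD, hornerM, hornerN, hornerZ, hornerC, hornerX); ring.
move=> bi; rewrite (roots_poly_tangent_split _ _ bi) (roots_poly_split _ bi) aux.
rewrite deriv_roots_poly /roots_poly_tangent hornerN !horner_sum mulr_sumr -sumrB.
by apply: eq_bigr => s _; rewrite hornerZ -mulrBl horner_roots_poly.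
Qed.

End RootsPoly.

(** * The linearized equations of one cluster of roots *)

Section Cluster.
Context {R : realType} {N : nat}.
Local Notation C := R[i].
Implicit Types (b K sg : pred 'I_N) (w nu v : 'I_N -> C).

(** The sign with which the Wronskian enters at a root: only one of its two terms
    survives there, and which one depends on the factor that has the root. *)
Definition side_sign sg (i : 'I_N) : C := (-1) ^+ (~~ sg i).

Lemma side_sign_sqr sg i : side_sign sg i * side_sign sg i = 1.
Proof. by rewrite /side_sign; case: (sg i); rewrite ?mulr1 // expr1 mulrNN mulr1. Qed.

Lemma poly_eq0_on K w (D : {poly C}) : (size D <= #|K|)%N ->
  (forall i s, K i -> K s -> w i = w s -> i = s) ->
  (forall i, K i -> D.[w i] = 0) -> D = 0.
Proof.
move=> sD inj h; apply: (@roots_geq_poly_eq0 _ D [seq w i | i <- enum K]).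
- by apply/allP => _ /mapP[i ik ->]; apply/rootP/h; move: ik; rewrite mem_enum.
- rewrite map_inj_in_uniq ?enum_uniq // => i s; rewrite !mem_enum; exact: inj.
- by rewrite size_map -cardE.
Qed.

Lemma size_monicB (P Q : {poly C}) n : P \is monic -> Q \is monic ->
  size P = n.+1 -> size Q = n.+1 -> (size (P - Q)%R <= n)%N.
Proof.
move=> /monicP Pm /monicP Qm sP sQ; apply/leq_sizeP => j; rewrite leq_eqVlt => /orP[/eqP<-|nj].
  by rewrite coefB; move: Pm Qm; rewrite !lead_coefE sP sQ /= => -> ->; rewrite subrr.
by rewrite coefB !nth_default ?subrr ?sP ?sQ.
Qed.

Definition qq_at (a : C) (f h : {poly C}) := f * h + a *: (f * h^`() - h * f^`()).

Lemma qq_at_swap a f h : qq_at a f h = qq_at (- a) h f.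
Proof. by rewrite /qq_at mulrC scaleNr -scalerN opprB. Qed.

Lemma qq_at_root_plus (f h : {poly C}) a x : f.[x] = 0 ->
  (qq_at a f h).[x] = - (a * (f^`().[x] * h.[x])).
Proof. by move=> f0; rewrite /qq_at !(hornerD, hornerM, hornerN, hornerZ) f0; ring. Qed.

Lemma qq_at_root b sg w a i : b i ->
  (qq_at a (roots_poly (fun s => b s && sg s) w) (roots_poly (fun s => b s && ~~ sg s) w)).[w i]
  = - (side_sign sg i * a * \prod_(s | b s && (s != i)) (w i - w s)).
Proof.
move=> bi; rewrite (bigID sg) /= /side_sign; case: (boolP (sg i)) => si /=.
  rewrite qq_at_root_plus; last by apply: roots_poly_eq0; rewrite bi si.
  rewrite deriv_roots_poly_at ?bi ?si // horner_roots_poly expr0 mul1r.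
  congr (- (_ * (_ * _))); apply: eq_bigl => s; first by rewrite andbAC.
  by rewrite andbAC; apply/esym/andb_idr => /andP[_]; apply: contraNneq => ->.
rewrite qq_at_swap qq_at_root_plus; last by apply: roots_poly_eq0; rewrite bi si.
rewrite deriv_roots_poly_at ?bi ?si // horner_roots_poly expr1 mulN1r.
congr (- (_ * _)); rewrite mulrC; congr (_ * _); apply: eq_bigl => s.
  by rewrite andbAC; apply/esym/andb_idr => /andP[_]; apply: contraTneq => ->.
by rewrite andbAC.
Qed.

(** The difference of the two sides of the qq-equation varies as on the left at the fixed
    point [x], and as on the right at the moving root.  These variations agree, since
    they differ by the velocity times the derivative of the zero polynomial. *)
Lemma qq_at_tangent_root (f h df dh : {poly C}) (x vi a S : C) k :
  f.[x] = 0 -> df.[x] = - (vi * f^`().[x]) -> qq_at a f h = 'X^(k.+1) ->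
  (df * h + f * dh)^`().[x] + vi * (f * h)^`()^`().[x] = S ->
  (df * h + f * dh + a *: ((df * h^`() - h * df^`()) + (f * dh^`() - dh * f^`()))).[x]
  = - (k.+1%:R * x ^+ k * vi + a * S).
Proof.
move=> f0 df0 E <-.
have := congr1 (fun p : {poly C} => p^`().[x]) E.
rewrite /= /qq_at derivXn /= hornerMn hornerXn -mulr_natl => <-.
rewrite !poly.derivE !(hornerD, hornerM, hornerN, hornerZ) f0 df0; ring.
Qed.

(** A tangent vector in the kernel would be a tangent vector to the local qq-equation:
    the variation of the qq-polynomial vanishes at as many distinct points as the
    cluster has roots, which exceeds its degree.  Then [local_nondegenerate] applies. *)
Lemma cluster_nondegenerate K sg nu v k : #|K| = k.+1 ->
  (forall i s, K i -> K s -> nu i = nu s -> i = s) ->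
  (forall i, K i -> \prod_(s | K s && (s != i)) (nu i - nu s)
     + side_sign sg i * nu i ^+ k.+1 = 0) ->
  (forall i, K i ->
     \sum_(s | K s && (s != i)) (v i - v s) *
        \prod_(r | (K r && (r != i)) && (r != s)) (nu i - nu r)
     + side_sign sg i * (k.+1%:R * nu i ^+ k * v i) = 0) ->
  forall i, K i -> v i = 0.
Proof.
move=> Kk inj base tang.
pose Kp s := K s && sg s; pose Km s := K s && ~~ sg s.
pose f := roots_poly Kp nu; pose h := roots_poly Km nu.
pose df := roots_poly_tangent Kp nu v; pose dh := roots_poly_tangent Km nu v.
pose c := #|Kp|; pose e := #|Km|.
have ce : (c + e = k.+1)%N.
  rewrite /c /e -Kk -(cardID sg K); congr (_ + _)%N; apply: eq_card => s;
  by rewrite !inE /in_mem /= /Kp /Km; case: (sg s); rewrite ?andbT ?andbF.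
have sf : size f = c.+1 by exact: size_roots_poly.
have sh : size h = e.+1 by exact: size_roots_poly.
have fh : f * h = roots_poly K nu by rewrite (roots_polyID K sg).
have qq1E p q : qq1 p q = qq_at 1 p q by rewrite /qq_at scale1r.
have nz i : K i -> nu i != 0.
  move=> Ki; apply/eqP => z; have := base i Ki; rewrite z expr0n mulr0 addr0 => /eqP.
  apply/negP; apply/prodf_neq0 => s /andP[Ks si].
  by rewrite sub0r oppr_eq0 -z; apply: contraNneq si => /(inj s i Ks Ki) ->.
have E : qq1 f h = 'X^(k.+1).
  apply/eqP; rewrite -subr_eq0; apply/eqP; apply: (poly_eq0_on (K := K) (w := nu)) => //.
    rewrite Kk /qq1 fh addrAC; apply: size_add_leq.
      apply: size_monicB; rewrite ?monic_roots_poly ?monicXn ?size_polyXn //.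
      by rewrite size_roots_poly Kk.
    by rewrite -ce; apply: size_qq1_lower; rewrite ?sf ?sh.
  move=> i Ki; rewrite qq1E hornerD hornerN qq_at_root // hornerXn mulr1.
  have := base i Ki => /eqP; rewrite addr_eq0 => /eqP ->.
  by rewrite mulrN mulrA side_sign_sqr mul1r opprK subrr.
have f0 : f`_0 != 0.
  rewrite -horner_coef0 horner_roots_poly; apply/prodf_neq0 => s /andP[Ks _].
  by rewrite sub0r oppr_eq0 nz.
have sdf : (size df <= c)%N by exact: size_roots_poly_tangent.
have sdh : (size dh <= e)%N by exact: size_roots_poly_tangent.
have dE : qq1 df h + qq1 f dh = 0.
  have dEE : qq1 df h + qq1 f dh =
    df * h + f * dh + 1 *: ((df * h^`() - h * df^`()) + (f * dh^`() - dh * f^`())).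
    by rewrite scale1r /qq1; ring.
  have dEE' : qq1 df h + qq1 f dh =
    dh * f + h * df + (-1) *: ((dh * f^`() - f * dh^`()) + (h * df^`() - df * h^`())).
    by rewrite scaleN1r /qq1; ring.
  have S1 i : K i -> (df * h + f * dh)^`().[nu i] + v i * (f * h)^`()^`().[nu i] =
      \sum_(s | K s && (s != i)) (v i - v s) *
        \prod_(r | (K r && (r != i)) && (r != s)) (nu i - nu r).
    by move=> Ki; rewrite fh -roots_poly_tangent_deriv_at // (roots_poly_tangentID K sg).
  apply: (poly_eq0_on (K := K) (w := nu)) => //.
    rewrite Kk -ce dEE scale1r; apply: size_add_leq; apply: size_add_leq.
    - by apply: size_mul_leq_bound sdf (eq_leq sh) _; lia.
    - by apply: size_mul_leq_bound (eq_leq sf) sdh _; lia.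
    - by apply: size_qq1_lower; rewrite ?sh //; apply: leq_trans sdf _.
    - by apply: size_qq1_lower; rewrite ?sf //; apply: leq_trans sdh _.
  move=> i Ki.
  have := tang i Ki; set S := \sum_(s | _) _ => /eqP; rewrite addr_eq0 /side_sign.
  case: (boolP (sg i)) => si /=.
    have Kpi : Kp i by rewrite /Kp Ki.
    rewrite expr0 mul1r => /eqP SE; rewrite dEE.
    rewrite (qq_at_tangent_root (vi := v i) (S := S) (k := k)).
    - by rewrite mul1r SE subrr oppr0.
    - exact: roots_poly_eq0.
    - exact: roots_poly_tangent_at.
    - by rewrite -qq1E.
    - exact: S1.
  have Kmi : Km i by rewrite /Km Ki.
  rewrite expr1 mulN1r opprK => /eqP SE; rewrite dEE'.
  rewrite (qq_at_tangent_root (vi := v i) (S := S) (k := k)).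
  - by rewrite mulN1r SE subrr oppr0.
  - exact: roots_poly_eq0.
  - exact: roots_poly_tangent_at.
  - by rewrite -qq_at_swap -qq1E.
  - by rewrite /S -S1 // [h * f]mulrC [dh * f + _]addrC [h * df]mulrC [dh * f]mulrC.
have [df0 dh0] := local_nondegenerate (monic_roots_poly _ _) (monic_roots_poly _ _)
  sf sh ce E f0 sdf sdh dE.
move=> i Ki.
have concl b : b i -> (forall s, b s -> K s) -> roots_poly_tangent b nu v = 0 -> v i = 0.
  move=> bi bK b0; have := roots_poly_tangent_at nu v bi; rewrite b0 horner0 => /eqP.
  rewrite eq_sym oppr_eq0 mulf_eq0 deriv_roots_poly_at // => /orP[/eqP //|].
  move/prodf_eq0 => [s /andP[bs si]]; rewrite subr_eq0 => /eqP/(inj i s Ki (bK s bs)) e'.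
  by rewrite e' eqxx in si.
have [si|si] := boolP (sg i).
  by apply: (concl Kp) => //; [rewrite /Kp Ki | move=> s /andP[]].
by apply: (concl Km) => //; [rewrite /Km Ki | move=> s /andP[]].
Qed.

End Cluster.

(** * The rescaled equations *)

Section Rescaled.
Context {R : realType} {N : nat} (sg : pred 'I_N) (kappa : 'I_N -> R[i]).
Local Notation C := R[i].
Local Notation A := {poly C}.
Implicit Types (nu v u : 'I_N -> C) (i s : 'I_N).

(** Equations for the rescaled roots [u], where the root number [i] is [kappa i + t * u i]:
    evaluation of the qq-equation at that root, divided by the power of [t] that both
    sides contain.  The target [T] of the coefficients is [C] when the unknowns are
    numbers and [{poly C}] when they are polynomials in [t]. *)
Definition rescaled_equation (T : comNzRingType) (io : C -> T) i (t : T) (x : 'I_N -> T) : T :=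
  \prod_(s | s != i) (if kappa s == kappa i then x i - x s
                      else io (kappa i - kappa s) + t * (x i - x s))
  + io (side_sign sg i) *
    \prod_s (if kappa s == kappa i then x i else io (kappa i - kappa s) + t * x i).

Lemma rescaled_equation_morph (T T' : comNzRingType) (io : C -> T) (io' : C -> T')
    (phi : {rmorphism T -> T'}) i t x : (forall c, phi (io c) = io' c) ->
  phi (rescaled_equation io i t x) = rescaled_equation io' i (phi t) (fun k => phi (x k)).
Proof.
move=> hio; rewrite /rescaled_equation rmorphD rmorphM !rmorph_prod hio.
by congr (_ + _ * _); apply: eq_bigr => s _; case: ifP => _;
  rewrite ?(rmorphB, rmorphD, rmorphM) ?rmorphB ?hio.
Qed.

Local Notation same i := (fun s => kappa s == kappa i).

Definition diff_value nu i s := if kappa s == kappa i then nu i - nu s else kappa i - kappa s.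
Definition diff_jac i s k : C := if kappa s == kappa i then (k == i)%:R - (k == s)%:R else 0.
Definition zero_value nu i s := if kappa s == kappa i then nu i else kappa i - kappa s.
Definition zero_jac i s k : C := if kappa s == kappa i then (k == i)%:R else 0.

Lemma strict_diff_difference nu i s : strict_diff nu
  (fun t x => if kappa s == kappa i then x i - x s
              else (kappa i - kappa s)%:P + t * (x i - x s))
  (diff_value nu i s) (diff_jac i s).
Proof.
have h := strict_diffD (strict_diff_proj nu i) (strict_diffN (strict_diff_proj nu s)).
rewrite /diff_value /diff_jac; case: ifP => _; first exact: h.
have := strict_diffD (strict_diff_cst nu (kappa i - kappa s))
  (strict_diffM (strict_diff_param nu) h).
apply: strict_diff_ext => [//||k]; first by rewrite mul0r addr0.
by rewrite !mul0r !addr0.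
Qed.

Lemma strict_diff_zero nu i s : strict_diff nu
  (fun t x => if kappa s == kappa i then x i else (kappa i - kappa s)%:P + t * x i)
  (zero_value nu i s) (zero_jac i s).
Proof.
have h := strict_diff_proj nu i.
rewrite /zero_value /zero_jac; case: ifP => _; first exact: h.
have := strict_diffD (strict_diff_cst nu (kappa i - kappa s))
  (strict_diffM (strict_diff_param nu) h).
apply: strict_diff_ext => [//||k]; first by rewrite mul0r addr0.
by rewrite !mul0r !addr0.
Qed.

Definition rescaled_jac nu i k : C :=
  \sum_(s | s != i) diff_jac i s k * \prod_(r | (r != i) && (r != s)) diff_value nu i r
  + side_sign sg i *
    \sum_s zero_jac i s k * \prod_(r | r != s) zero_value nu i r.

Lemma strict_diff_rescaled nu i : strict_diff nu (rescaled_equation (@polyC C) i)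
  (\prod_(s | s != i) diff_value nu i s + side_sign sg i * \prod_s zero_value nu i s)
  (rescaled_jac nu i).
Proof.
have h1 := strict_diff_prod (P := fun s => s != i) (index_enum_uniq _)
  (fun s _ => strict_diff_difference nu i s).
have h2 := strict_diff_prod (P := xpredT) (index_enum_uniq _)
  (fun s _ => strict_diff_zero nu i s).
have := strict_diffD h1 (strict_diffM (strict_diff_cst nu (side_sign sg i)) h2).
apply: strict_diff_ext => // k.
by rewrite /rescaled_jac mul0r add0r.
Qed.

(** For parameter 0 the clusters decouple, since the factors that involve another
    cluster become constants; these are the remaining equations. *)
Definition base_solution nu : Prop :=
  (forall i s, kappa i = kappa s -> nu i = nu s -> i = s) /\
  forall i, \prod_(s | (kappa s == kappa i) && (s != i)) (nu i - nu s)
            + side_sign sg i * nu i ^+ #|same i| = 0.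

Definition other_clusters i := \prod_(r | kappa r != kappa i) (kappa i - kappa r).

Lemma other_clusters_neq0 i : other_clusters i != 0.
Proof. by apply/prodf_neq0 => r; rewrite subr_eq0 eq_sym. Qed.

Lemma card_same i : exists k : nat, #|same i| = k.+1.
Proof.
exists #|same i|.-1; rewrite prednK //; apply/card_gt0P; exists i.
by rewrite /in_mem /= eqxx.
Qed.

Lemma rescaled_base_value nu i :
  \prod_(s | s != i) diff_value nu i s + side_sign sg i * \prod_s zero_value nu i s =
  other_clusters i * (\prod_(s | (kappa s == kappa i) && (s != i)) (nu i - nu s)
             + side_sign sg i * nu i ^+ #|same i|).
Proof.
rewrite mulrDr; congr (_ + _).
  rewrite (bigID (same i)) /= mulrC; congr (_ * _).
    rewrite /other_clusters; apply: eq_big => [r|r /andP[_ /negbTE h]]; last by rewrite /diff_value h.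
    by rewrite andb_idl //; apply: contraNneq => ->.
  by apply: eq_big => [r|r /andP[_ h]]; [rewrite andbC|rewrite /diff_value h].
rewrite mulrCA; congr (_ * _); rewrite (bigID (same i)) /= mulrC; congr (_ * _).
  by apply: eq_bigr => r /negbTE h; rewrite /zero_value h.
by rewrite -prodr_const; apply: eq_big => // r h; rewrite /zero_value h.
Qed.

(** The factors of the other clusters have derivative zero for parameter 0, and their
    values have the common product [other_clusters]. *)
Lemma jac_tangent nu v i k : #|same i| = k.+1 ->
  \sum_l v l * rescaled_jac nu i l = other_clusters i *
    (\sum_(s | (kappa s == kappa i) && (s != i)) (v i - v s) *
        \prod_(r | ((kappa r == kappa i) && (r != i)) && (r != s)) (nu i - nu r)
     + side_sign sg i * (k.+1%:R * nu i ^+ k * v i)).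
Proof.
move=> hk.
have delta j : \sum_l v l * (l == j)%:R = v j.
  rewrite (bigD1 j) //= eqxx mulr1 big1 ?addr0 // => l /negbTE ->; exact: mulr0.
under eq_bigr do rewrite mulrDr; rewrite big_split /= mulrDr; congr (_ + _).
  under eq_bigr do rewrite mulr_sumr; rewrite exchange_big /= mulr_sumr.
  rewrite (bigID (same i)) /= [X in _ + X]big1 ?addr0 => [|s /andP[_ /negbTE h]]; last first.
    by rewrite big1 // => l _; rewrite /diff_jac h mul0r mulr0.
  apply: eq_big => [s|s /andP[si h]]; first by rewrite andbC.
  under eq_bigr do rewrite mulrA; rewrite -mulr_suml.
  have -> : \sum_l v l * diff_jac i s l = v i - v s.
    by rewrite /diff_jac h; under eq_bigr do rewrite mulrBr; rewrite sumrB !delta.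
  rewrite mulrCA; congr (_ * _); rewrite (bigID (same i)) /= mulrC; congr (_ * _).
    rewrite /other_clusters; apply: eq_big => [r|r /andP[_ /negbTE h']]; last by rewrite /diff_value h'.
    rewrite andb_idl // => hr; apply/andP; split; apply: contraNneq hr => -> //.
  apply: eq_big => [r|r /andP[_ h']]; last by rewrite /diff_value h'.
  by rewrite andbC andbA.
under eq_bigr do rewrite mulrCA; rewrite -mulr_sumr mulrCA; congr (_ * _).
under eq_bigr do rewrite mulr_sumr; rewrite exchange_big /=.
rewrite (bigID (same i)) /= [X in _ + X]big1 ?addr0 => [|s /negbTE h]; last first.
  by rewrite big1 // => l _; rewrite /zero_jac h mul0r mulr0.
have -> : other_clusters i * (k.+1%:R * nu i ^+ k * v i) =
    \sum_(s | kappa s == kappa i) v i * (other_clusters i * nu i ^+ k).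
  rewrite (sumr_const (same i)) hk -mulr_natl; ring.
apply: eq_bigr => s h.
under eq_bigr do rewrite mulrA; rewrite -mulr_suml /zero_jac h delta; congr (_ * _).
rewrite (bigID (same i)) /= mulrC; congr (_ * _).
  rewrite /other_clusters; apply: eq_big => [r|r /andP[_ /negbTE h']]; last by rewrite /zero_value h'.
  by rewrite andb_idl //; apply: contraNneq => ->.
have -> : k = #|[pred r | (r != s) && (kappa r == kappa i)]|.
  by apply/eqP; rewrite -eqSS -hk (cardD1 s) {1}/in_mem /= h.
by rewrite -prodr_const; apply: eq_big => // r /andP[_ h']; rewrite /zero_value h'.
Qed.

Lemma jac_unit nu : base_solution nu -> (\matrix_(k, i) rescaled_jac nu i k) \in unitmx.
Proof.
move=> [inj base]; rewrite -row_free_unit -kermx_eq0; apply/rowV0P => x /sub_kermxP xJ.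
pose v k := x ord0 k.
have tang i : \sum_l v l * rescaled_jac nu i l = 0.
  have /rowP/(_ i) := xJ; rewrite !mxE => e; apply: etrans e.
  by apply: eq_bigr => l _; rewrite mxE.
apply/rowP => i; rewrite mxE -/(v i).
have [k hk] := card_same i.
apply: (cluster_nondegenerate (K := same i) (sg := sg) (nu := nu) (v := v) hk) => [|j|j|//].
- by move=> j s /eqP e /eqP e' ; apply: inj; rewrite e e'.
- by move=> /eqP e; have := base j; rewrite e hk.
move=> /eqP e; have hk' : #|same j| = k.+1 by rewrite e.
have := tang j; rewrite (jac_tangent _ _ hk') e => /eqP.
by rewrite mulf_eq0 (negbTE (other_clusters_neq0 _)) => /eqP.
Qed.

End Rescaled.

(** * The analytic family through a solution of the limiting equations *)

Section BaseFamily.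
Context {R : realType} {N : nat} (sg : pred 'I_N) (kappa : 'I_N -> R[i]).
Local Notation C := R[i].
Local Notation A := {poly C}.
Implicit Types (nu v u : 'I_N -> C) (i s : 'I_N).

Local Notation Lambda := (roots_poly predT kappa).
Local Notation root_at t u := (fun i => kappa i + t * u i).
Local Notation minus := (fun i => ~~ sg i).

(** Each member of the cluster of [i] contributes one factor [t] to either side; on the
    left one of them is the [t] in front of the Wronskian. *)
Lemma rescaled_equationE (t : C) u i : let w := root_at t u in
  t * \prod_(s | s != i) (w i - w s) + side_sign sg i * \prod_s (w i - kappa s) =
  (\prod_s (if kappa s == kappa i then t else 1)) * rescaled_equation sg kappa id i t u.
Proof.
rewrite /= /rescaled_equation mulrDr; congr (_ + _).
  rewrite [in RHS](bigD1 i) //= eqxx -mulrA -big_split /=; congr (_ * _).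
  by apply: eq_bigr => s _; case: eqP => [->|_]; ring.
rewrite mulrCA -big_split /=; congr (_ * _).
by apply: eq_bigr => s _; case: eqP => [->|_]; ring.
Qed.

Lemma cluster_scale_neq0 (t : C) i : t != 0 ->
  \prod_s (if kappa s == kappa i then t else 1) != 0.
Proof. by move=> t0; apply/prodf_neq0 => s _; case: ifP => //; rewrite oner_neq0. Qed.

Lemma rescaled_of_qq (t : C) u : t != 0 ->
  finite_qq Lambda t (roots_poly sg (root_at t u)) (roots_poly minus (root_at t u)) ->
  forall i, rescaled_equation sg kappa id i t u = 0.
Proof.
move=> t0 E i; apply: (mulfI (cluster_scale_neq0 i t0)); rewrite mulr0 -rescaled_equationE /=.
set w := root_at t u.
have := qq_at_root (b := predT) sg w t (i := i) isT.
have -> : qq_at t (roots_poly (fun s => predT s && sg s) w)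
  (roots_poly (fun s => predT s && ~~ sg s) w) = Lambda by exact: E.
rewrite horner_roots_poly => ->.
by rewrite mulrN !mulrA side_sign_sqr mul1r subrr.
Qed.

(** Both sides of the qq-equation are monic of degree [N], so their difference is zero as
    soon as it vanishes at [N] distinct points. *)
Lemma qq_of_rescaled (t : C) u : t != 0 -> injective (root_at t u) ->
  (forall i, rescaled_equation sg kappa id i t u = 0) ->
  finite_qq Lambda t (roots_poly sg (root_at t u)) (roots_poly minus (root_at t u)).
Proof.
move=> t0 inj h; set w := root_at t u in inj *.
rewrite /finite_qq -/(qq_at t (roots_poly sg w) (roots_poly minus w)).
apply/eqP; rewrite -subr_eq0; apply/eqP.
have sT b : size (roots_poly b w) = #|b|.+1 := size_roots_poly b w.
apply: (poly_eq0_on (K := predT) (w := w)) => [|i s _ _|i _]; last 1 first.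
- rewrite hornerD hornerN horner_roots_poly.
  have -> : (qq_at t (roots_poly sg w) (roots_poly minus w)).[w i] = _ :=
    qq_at_root (b := predT) sg w t (i := i) isT.
  have := rescaled_equationE t u i; rewrite /= h mulr0 -/w => /eqP.
  rewrite addr_eq0 => /eqP tE; rewrite -mulrA tE mulrN opprK mulrA side_sign_sqr mul1r.
  by apply/eqP; rewrite subr_eq0; apply/eqP/eq_bigl.
- rewrite /qq_at addrAC; apply: size_add_leq.
    have -> : roots_poly sg w * roots_poly minus w = roots_poly predT w.
      by rewrite (roots_polyID predT sg).
    by apply: size_monicB; rewrite ?monic_roots_poly ?size_roots_poly.
  apply: (leq_trans (size_scale_leq _ _)).
  have <- : (#|sg| + #|minus| = #|'I_N|)%N by rewrite -(cardC sg); congr (_ + _)%N; apply: eq_card.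
  by apply: size_qq1_lower; rewrite sT.
- exact: inj.
Qed.

(** Each nondegenerate solution of the limiting rescaled equations extends to an
    analytic family of solutions, which contains all solutions near it. *)
Lemma base_family nu : base_solution sg kappa nu ->
  exists (d r : R) (u : 'I_N -> C -> C), [/\ 0 < d, 0 < r,
    forall k, poly_limit r (u k),
    forall t, normc t < r -> let w := root_at t (fun k => u k t) in
      finite_qq Lambda t (roots_poly sg w) (roots_poly minus w)
  & forall t v, normc t < r -> (forall k, normc (v k - nu k) <= d) ->
      (forall i, rescaled_equation sg kappa id i t v = 0) -> forall k, v k = u k t].
Proof.
move=> bs; have [inj base] := bs.
pose G := rescaled_equation sg kappa (@polyC C).
pose Ld (p : 'I_N * 'I_N) (t : A) (x : 'I_N -> A) : A :=
  if kappa p.2 == kappa p.1 then x p.1 - x p.2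
  else (kappa p.1 - kappa p.2)%:P + t * (x p.1 - x p.2).
have G0 : forall (t : C) v i, (G i t%:P (fun k => (v k)%:P)).[0] = rescaled_equation sg kappa id i t v.
  move=> t v i; rewrite /G.
  rewrite -/(horner_eval 0 _) (rescaled_equation_morph _ _ (io' := id)) ?horner_evalE.
    by congr rescaled_equation; [exact: hornerC | apply/funext => k; exact: hornerC].
  by move=> c; exact: hornerC.
(* near the base point the roots stay distinct for nonzero parameters *)
have [d0 [d00 hd0]] : exists d, 0 < d /\ forall p : 'I_N * 'I_N, forall (t : C) v,
    p.2 != p.1 -> normc t <= d -> (forall k, normc (v k - nu k) <= d) ->
    (Ld p t%:P (fun k => (v k)%:P)).[0] != 0.
  apply: finite_uniform_radius => [p d d' _ dd h t v ps td vd|[i s] /=].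
    by apply: h => // [|k]; [exact: le_trans dd | exact: le_trans (vd k) dd].
  have [->|si] := eqVneq s i; first by exists 1; split.
  have [a [a0 [J hJ]]] : exists a, a != 0 /\ exists J, strict_diff nu (Ld (i, s)) a J.
    have := strict_diff_difference kappa nu i s.
    set a := (X in strict_diff _ _ X _) => hJ; exists a; split; last by eexists; exact: hJ.
    rewrite /a /diff_value; case: (eqVneq (kappa s) (kappa i)) => e; rewrite subr_eq0; last by rewrite eq_sym.
    by apply: contraNneq si => /(inj _ _ (esym e)) ->.
  have e0 : 0 < normc a / 2 by rewrite divr_gt0 // normc_gt0.
  have [d [dp h]] := hJ _ e0; exists d; split=> // t v _ td vd.
  have [||h1 _] := h _ (@eval_seminorm R 0) t%:P (fun k => (v k)%:P).
  - by rewrite hornerC.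
  - by move=> k; rewrite hornerD hornerN !hornerC.
  apply/eqP => z; move: h1; rewrite hornerD hornerN hornerC z sub0r normcN.
  by rewrite ler_pdivlMr // mulr2n mulrDr mulr1 gerDl leNgt normc_gt0 a0.
have hom i (t : A) (x : 'I_N -> A) (tau : C) :
    (G i t x).[tau]%:P = G i (t.[tau])%:P (fun k => (x k).[tau]%:P).
  rewrite -/(horner_eval tau _) (rescaled_equation_morph _ _ (io' := id)).
    by rewrite (rescaled_equation_morph _ _ (io' := @polyC C)).
  by move=> c; exact: hornerC.
have sd i : strict_diff nu (G i) 0 (fun k => (\matrix_(k, i) rescaled_jac sg kappa nu i k) k i).
  apply: strict_diff_ext (strict_diff_rescaled sg kappa nu i) => //.
    by rewrite rescaled_base_value base mulr0.
  by move=> k; rewrite mxE.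
have [d [r [/andP[dp dd] /andP[rp rd] uniq [u [hu1 hu2]]]]] :=
  implicit_function sd (jac_unit bs) hom d00.
exists d, r, u; split=> // [t tr w|t v tr vd hv k].
  have [ud uE] := hu2 t tr.
  have [t0|t0] := eqVneq t 0.
    have wE : w = kappa by apply/funext => i; rewrite /w t0 mul0r addr0.
    by rewrite /finite_qq wE t0 scale0r addr0 (roots_polyID predT sg).
  apply: qq_of_rescaled => // [i s|i]; last by rewrite -G0.
  move=> e; apply/eqP/negPn/negP => is'.
  have := hd0 (i, s) t (fun k => u k t); rewrite /= eq_sym => /(_ is').
  move=> /(_ (le_trans (ltW tr) rd) (fun k => le_trans (ud k) dd)).
  have e' : kappa i + t * u i t - (kappa s + t * u s t) = 0 by apply/eqP; rewrite subr_eq0; apply/eqP.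
  rewrite /Ld /=; case: (eqVneq (kappa s) (kappa i)) => [ks|_]; rewrite !(hornerD, hornerN, hornerM, hornerC).
    move=> /negP; apply; move: e'; rewrite ks opprD addrACA subrr add0r -mulrBr => /eqP.
    by rewrite mulf_eq0 (negbTE t0).
  move=> /negP; apply; rewrite -e'; apply/eqP; ring.
have [ud uE] := hu2 t tr.
by apply: (uniq t v (fun k => u k t) (ltW tr) vd ud _ uE k) => i; rewrite G0.
Qed.

End BaseFamily.

(** * One-sided clusters and a bound for the roots *)

Section OneSided.
Context {R : realType}.
Local Notation C := R[i].

(** Differentiation is nilpotent on polynomials of bounded degree. *)
Lemma solve_first_order (a : C) (P : {poly C}) : exists S : {poly C}, S + a *: S^`() = P.
Proof.
have [n] := ubnP (size P); elim: n P => // n IH P.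
rewrite ltnS leq_eqVlt => /orP[/eqP sP|]; last by move=> sP; apply: IH.
have [->|P0] := eqVneq P 0; first by exists 0; rewrite deriv0 scaler0 addr0.
have [|S hS] := IH (- (a *: P^`())).
  rewrite size_polyN -sP (leq_ltn_trans (size_scale_leq _ _)) //.
  exact: lt_size_deriv.
exists (P + S); rewrite derivD scalerDr addrACA hS -addrA; ring.
Qed.

Lemma solve_first_order_monic (a : C) (P S : {poly C}) : P \is monic ->
  S + a *: S^`() = P -> size S = size P /\ S \is monic.
Proof.
move=> Pm E.
have S0 : S != 0.
  apply/eqP => S0; move: E; rewrite S0 deriv0 scaler0 addr0 => P0.
  by have := monic_neq0 Pm; rewrite -P0 eqxx.
have lt : (size (a *: S^`()) < size S)%N.
  by rewrite (leq_ltn_trans (size_scale_leq _ _)) // lt_size_deriv.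
split; first by rewrite -E size_polyDl.
by move: Pm; rewrite -E !monicE lead_coefDl.
Qed.

Lemma uniq_simple_roots (rs : seq C) :
  (forall z, z \in rs -> (\prod_(y <- rs) ('X - y%:P))^`().[z] != 0) -> uniq rs.
Proof.
move=> h; apply: count_mem_uniq => z; case: (boolP (z \in rs)) => zr; last exact/count_memPn.
have p := perm_to_rem zr.
have := h z zr; rewrite (perm_big _ p) big_cons derivM derivXsubC mul1r.
rewrite hornerD hornerM hornerXsubC subrr mul0r addr0.
rewrite (seq.permP p) /= eqxx add1n => nz; congr _.+1; apply/count_memPn.
by apply: contra nz; rewrite -root_prod_XsubC => /rootP ->.
Qed.

(** A multiple root would be a root of the right-hand side, hence zero, but at the origin
    [qq_vanishing_order] forbids it. *)
Lemma one_sided_roots (a : C) k : a != 0 -> exists rs : seq C,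
  [/\ uniq rs, size rs = k.+1 &
      let phi := \prod_(z <- rs) ('X - z%:P) in phi + a *: phi^`() = 'X^(k.+1)].
Proof.
move=> a0; have [phi E] := solve_first_order a 'X^(k.+1).
have [sphi mphi] := solve_first_order_monic (monicXn _ _) E.
rewrite size_polyXn in sphi.
have [rs phiE] := closed_field_poly_normal phi.
move: phiE; rewrite (monicP mphi) scale1r => phiE.
have phi0 : phi`_0 != 0.
  apply/eqP => z; have a0' : - a != 0 by rewrite oppr_eq0.
  have low : forall l, (l <= k.+1)%N -> phi`_l = 0.
    apply: (@qq_vanishing_order R phi 1 (- a) k.+1 a0') => //; last first.
      by rewrite -polyC1 coefC eqxx oner_neq0.
    move=> l lk; rewrite -[1]polyC1 derivC mulr0 sub0r polyC1 mulr1 mul1r scalerN scaleNr opprK.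
    by rewrite E coefXn ltn_eqF.
  by move/monicP: mphi; rewrite lead_coefE sphi /= low // => /eqP; rewrite eq_sym oner_eq0.
exists rs; split=> /=; last by rewrite -phiE.
- apply: uniq_simple_roots => z zr; rewrite -phiE; apply/eqP => d0.
  have pz : phi.[z] = 0 by apply/rootP; rewrite phiE root_prod_XsubC.
  have := congr1 (fun p : {poly C} => p.[z]) E.
  rewrite /= hornerD hornerZ pz d0 mulr0 addr0 hornerXn => /esym/eqP.
  rewrite expf_eq0 /= => /eqP z0; move: pz; rewrite z0 horner_coef0 => /eqP.
  by rewrite (negbTE phi0).
- by apply/eqP; rewrite -eqSS -sphi phiE size_prod_XsubC.
Qed.

(** When a cluster contains roots of only one of the two factors, the limiting equations
    are linear of first order in the polynomial that has these roots. *)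
Lemma one_sided_base (N : nat) (sg : pred 'I_N) (kappa : 'I_N -> C) :
  (forall i s, kappa i = kappa s -> sg i = sg s) -> exists nu, base_solution sg kappa nu.
Proof.
move=> hs.
have /choice[rs hrs] : forall p : bool * nat, exists rs : seq C,
    [/\ uniq rs, size rs = p.2.+1 &
      let phi := \prod_(z <- rs) ('X - z%:P) in
      phi + (- (-1) ^+ (~~ p.1)) *: phi^`() = 'X^(p.2.+1)].
  by move=> [b k]; apply: one_sided_roots; rewrite oppr_eq0 signr_eq0.
pose K i := fun s => kappa s == kappa i.
pose nu i := nth 0 (rs (sg i, #|K i|.-1)) (index i (enum (K i))).
have Kp i : (#|K i|.-1.+1 = #|K i|)%N.
  by rewrite prednK //; apply/card_gt0P; exists i; rewrite /in_mem /= /K eqxx.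
have KE i s : kappa i = kappa s -> K i = K s.
  by move=> e; apply/funext => r; rewrite /K e.
have mapE i : [seq nu s | s <- enum (K i)] = rs (sg i, #|K i|.-1).
  have [ur sr _] := hrs (sg i, #|K i|.-1); rewrite /= Kp in sr.
  apply: (@eq_from_nth _ 0) => [|j]; rewrite size_map -cardE ?sr // => jK.
  have jK' : (j < size (enum (K i)))%N by rewrite -cardE.
  rewrite (nth_map i) //; set s := nth i _ j.
  have sK : kappa s = kappa i.
    have : s \in enum (K i) by rewrite mem_nth.
    by rewrite mem_enum => /eqP.
  by rewrite /nu (hs _ _ sK) (KE _ _ sK) index_uniq ?enum_uniq.
exists nu; split=> [i s e|i].
  have [ur sr _] := hrs (sg i, #|K i|.-1); rewrite /= Kp in sr.
  rewrite /nu -(hs _ _ e) -(KE _ _ e) => /eqP.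
  have iK : i \in enum (K i) by rewrite mem_enum /in_mem /= /K.
  have sK : s \in enum (K i) by rewrite mem_enum /in_mem /= /K e.
  have idx x : x \in enum (K i) -> (index x (enum (K i)) < size (rs (sg i, #|K i|.-1)))%N.
    by move=> xK; rewrite sr cardE index_mem.
  rewrite nth_uniq ?idx // => /eqP e'.
  by rewrite -(nth_index i iK) e' nth_index.
have [_ _ /=] := hrs (sg i, #|K i|.-1).
rewrite -mapE big_map big_enum /= -/(roots_poly (K i) nu) Kp => E.
have Ki : K i i by rewrite /K.
have := congr1 (fun p : {poly C} => p.[nu i]) E.
rewrite /= hornerD hornerZ roots_poly_eq0 // add0r hornerXn deriv_roots_poly_at //.
move=> <-; rewrite /side_sign mulrA mulrN -expr2 sqrr_sign mulN1r subrr //.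
Qed.

(** Seen from a point of maximal modulus, the others are at distance at most twice that
    modulus, so the hypothesis bounds a power of it by the preceding power. *)
Lemma max_modulus_bound (N : nat) (K : pred 'I_N) (u : 'I_N -> C) (a B : R) :
  0 <= a -> 0 <= B ->
  (forall i, K i -> B <= normc (u i) ->
     normc (u i) ^+ #|K| <= a * \prod_(s | K s && (s != i)) normc (u i - u s)) ->
  forall i, K i -> normc (u i) <= B + a * 2 ^+ #|K|.
Proof.
move=> a0 B0 h i0 Ki0.
have [i Ki imax] : exists2 i, K i & forall s, K s -> normc (u s) <= normc (u i).
  by have [i Ki hi] := @Order.TotalTheory.arg_maxP _ R _ i0 K (fun i => normc (u i)) Ki0; exists i.
apply: le_trans (imax i0 Ki0) _.
have rhs0 : 0 <= a * 2 ^+ #|K| by rewrite mulr_ge0 // exprn_ge0.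
have [iB|/ltW iB] := leP (normc (u i)) B; first by rewrite ler_wpDr.
have [u0|u0] := eqVneq (normc (u i)) 0; first by rewrite u0 addr_ge0.
have up : 0 < normc (u i) by rewrite lt_def u0 normc_ge0.
rewrite ler_wpDl //.
have [k hk] : exists k, #|K| = k.+1.
  by exists #|K|.-1; rewrite prednK //; apply/card_gt0P; exists i.
have := h i Ki iB; rewrite hk => hi.
have bd : \prod_(s | K s && (s != i)) normc (u i - u s) <= (2 * normc (u i)) ^+ k.
  have -> : k = #|[pred s | K s && (s != i)]|.
    apply/eqP; rewrite -eqSS -hk (cardD1 i) {1}/in_mem /= Ki add1n eqSS.
    by apply/eqP; apply: eq_card => s; rewrite !inE /in_mem /= andbC.
  rewrite -prodr_const; apply: ler_prod => s /andP[Ks _]; rewrite normc_ge0 /=.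
  by rewrite (le_trans (normcD _ _)) // normcN mulr_natl mulr2n lerD2l imax.
have : normc (u i) ^+ k.+1 <= a * 2 ^+ k * normc (u i) ^+ k.
  by rewrite (le_trans hi) // -mulrA -exprMn ler_wpM2l.
rewrite exprS ler_pM2r ?exprn_gt0 // => /le_trans; apply.
by rewrite exprS ler_wpM2l // ler_peMl ?exprn_ge0 // ler1n.
Qed.

End OneSided.

(** * Limits of rescaled solutions *)

Section Compactness.
Context {R : realType} {N : nat} (sg : pred 'I_N).
Local Notation C := R[i].
Implicit Types (kappa nu w u : 'I_N -> C) (i s : 'I_N).
Local Notation minus := (fun i => ~~ sg i).
Local Notation root_at kappa t u := (fun i => kappa i + t * u i).

(** The factors of a solution seen at scale [t] around the cluster of [i0], with the powers
    of [t] removed. *)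
Definition zoomed_poly kappa (b : pred 'I_N) (t : C) u i0 : {poly C} :=
  \prod_(s | b s) (if kappa s == kappa i0 then 'X - (u s)%:P
                   else (kappa i0 - kappa s)%:P + t *: ('X - (u s)%:P)).

Lemma zoom_comp (b : pred 'I_N) (l : {poly C}) (F G : 'I_N -> {poly C}) (c : 'I_N -> C) :
  (forall s, F s \Po l = c s *: G s) ->
  (\prod_(s | b s) F s) \Po l = (\prod_(s | b s) c s) *: \prod_(s | b s) G s.
Proof.
move=> h; rewrite -scaler_prod.
rewrite (big_morph (fun p => p \Po l) (fun p q => comp_polyM p q l) (comp_polyC 1 l)).
by apply: eq_bigr.
Qed.

(** The substitution of [kappa i0 + t * 'X] for ['X] turns the factor [t] of the Wronskian
    into the chain rule. *)
Lemma zoomed_qq kappa (t : C) u i0 : t != 0 ->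
  finite_qq (roots_poly predT kappa) t
    (roots_poly sg (root_at kappa t u)) (roots_poly minus (root_at kappa t u)) ->
  qq1 (zoomed_poly kappa sg t u i0) (zoomed_poly kappa minus t u i0) =
  \prod_s (if kappa s == kappa i0 then 'X else (kappa i0 - kappa s)%:P + t *: 'X).
Proof.
move=> t0; set w := root_at kappa t u; rewrite /finite_qq -/(qq_at t _ _) => E.
pose l : {poly C} := (kappa i0)%:P + t *: 'X.
pose c s := if kappa s == kappa i0 then t else 1.
have zoomE b : roots_poly b w \Po l = (\prod_(s | b s) c s) *: zoomed_poly kappa b t u i0.
  apply: zoom_comp => s; rewrite comp_polyB comp_polyX comp_polyC /l /w /c.
  rewrite polyCD polyCM polyCB -!mul_polyC.
  by case: eqP => [->|_]; rewrite ?polyC1; ring.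
have zoomL : roots_poly predT kappa \Po l = (\prod_s c s) *:
    \prod_s (if kappa s == kappa i0 then 'X else (kappa i0 - kappa s)%:P + t *: 'X).
  apply: zoom_comp => s; rewrite comp_polyB comp_polyX comp_polyC /l /c.
  by rewrite polyCB -!mul_polyC; case: eqP => [->|_]; rewrite ?polyC1; ring.
have dl (p : {poly C}) : t *: (p^`() \Po l) = (p \Po l)^`().
  by rewrite deriv_comp /l derivD derivC add0r derivZ derivX -mul_polyC mulrC -mul_polyC mulr1.
have comp_qq (p q : {poly C}) : qq_at t p q \Po l = qq1 (p \Po l) (q \Po l).
  rewrite /qq_at /qq1 comp_polyD comp_polyZ comp_polyB !comp_polyM -!dl.
  by rewrite scalerBr -!scalerAr.
have qq1Z (a b : C) p q : qq1 (a *: p) (b *: q) = (a * b) *: qq1 p q.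
  by rewrite /qq1 !derivZ -!mul_polyC polyCM; ring.
have cE : (\prod_(s | sg s) c s) * \prod_(s | ~~ sg s) c s = \prod_s c s.
  by rewrite [RHS](bigID sg).
have := congr1 (fun p => p \Po l) E; rewrite /= comp_qq !zoomE zoomL qq1Z cE.
by apply: scalerI; apply/prodf_neq0 => s _; rewrite /c; case: ifP => //; rewrite oner_neq0.
Qed.

Section Sequences.
Context {U : set_system nat} {UU : UltraFilter U}.
Context (kappa nu : 'I_N -> C) (t : nat -> C) (u : nat -> 'I_N -> C).
Context (t_lim : ulim U t 0).
Context (u_lim : forall i, ulim U (fun j => u j i) (nu i)).

Lemma ulim_rescaled i :
  ulim U (fun j => rescaled_equation sg kappa id i (t j) (u j))
    (\prod_(s | s != i) diff_value kappa nu i s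
     + side_sign sg i * \prod_s zero_value kappa nu i s).
Proof.
apply: ulimD; last (apply: ulimM; first exact: ulim_cst).
  apply: ulim_prod => s _; rewrite /diff_value; case: ifP => _; first exact: ulimB.
  rewrite -[X in ulim _ _ X]addr0 -(mul0r (nu i - nu s)).
  by apply: ulimD; [exact: ulim_cst | apply: ulimM => //; exact: ulimB].
apply: ulim_prod => s _; rewrite /zero_value; case: ifP => _; first exact: u_lim.
rewrite -[X in ulim _ _ X]addr0 -(mul0r (nu i)).
by apply: ulimD; [exact: ulim_cst | exact: ulimM].
Qed.

Lemma poly_ulim_zoomed (b : pred 'I_N) i0 :
  poly_ulim (U := U) (fun j => zoomed_poly kappa b (t j) (u j) i0)
    (\prod_(s | b s) (if kappa s == kappa i0 then 'X - (nu s)%:P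
                      else (kappa i0 - kappa s)%:P)).
Proof.
have polyC_lim (a : nat -> C) (c : C) : ulim U a c -> poly_ulim (U := U) (fun j => (a j)%:P) c%:P.
  move=> h l; rewrite coefC; case: ifP => l0; last first.
    by apply: eq_ulim (ulim_cst 0) => j; rewrite coefC l0.
  by apply: eq_ulim h => j; rewrite coefC l0.
have X_lim s : poly_ulim (U := U) (fun j => 'X - (u j s)%:P) ('X - (nu s)%:P).
  by apply: poly_ulimD; [exact: poly_ulim_cst | apply: poly_ulimN; exact: polyC_lim].
apply: poly_ulim_prod => s _; case: ifP => _; first exact: X_lim.
have := poly_ulimD (poly_ulim_cst (U := U) (kappa i0 - kappa s)%:P)
   (poly_ulimM (polyC_lim _ _ t_lim) (X_lim s)).
rewrite polyC0 mul0r addr0 => h l.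
apply: eq_ulim (h _ _ _ l) => j.
by rewrite mul_polyC.
Qed.

Context (t_neq0 : U [set j | t j != 0]%classic).
Context (qq : U [set j | finite_qq (roots_poly predT kappa) (t j)
  (roots_poly sg (root_at kappa (t j) (u j)))
  (roots_poly minus (root_at kappa (t j) (u j)))]%classic).
Context (coprime_qq : U [set j | forall i s, sg i -> ~~ sg s ->
  kappa i + t j * u j i != kappa s + t j * u j s]%classic).

(** Near the cluster of [i0], the right-hand side is exactly a power of the variable times a
    unit, also before the limit; for solutions without common root this is what
    [limit_nonvanishing] needs. *)
Lemma rescaled_limit_neq0 i0 : nu i0 != 0.
Proof.
pose K s := kappa s == kappa i0.
pose Kp s := sg s && K s; pose Km s := ~~ sg s && K s.
have [k hk] := card_same kappa i0.
have ce : (#|Kp| + #|Km| = k.+1)%N.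
  rewrite -(hk : #|K| = k.+1) -(cardID sg K); congr (_ + _)%N; apply: eq_card => s;
  by rewrite !inE /in_mem /= /Kp /Km /K; case: (sg s); rewrite ?andbT ?andbF.
have limE (b : pred 'I_N) : \prod_(s | b s) (if kappa s == kappa i0 then 'X - (nu s)%:P
      else (kappa i0 - kappa s)%:P) =
    roots_poly (fun s => b s && K s) nu * (\prod_(s | b s && ~~ K s) (kappa i0 - kappa s))%:P.
  rewrite (bigID K) /=; congr (_ * _).
    by apply: eq_bigr => s /andP[_]; rewrite /K => ->.
  rewrite rmorph_prod; apply: eq_bigr => s /andP[_]; rewrite /K => /negbTE -> //.
have cst0 (b : pred 'I_N) : \prod_(s | b s && ~~ K s) (kappa i0 - kappa s) != 0.
  by apply/prodf_neq0 => s /andP[_]; rewrite /K subr_eq0 eq_sym.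
have size_lim (b : pred 'I_N) : size (\prod_(s | b s) (if kappa s == kappa i0
      then 'X - (nu s)%:P else (kappa i0 - kappa s)%:P)) = #|fun s => b s && K s|.+1.
  by rewrite limE mulrC mul_polyC size_scale // size_roots_poly.
have low : U [set j | forall l, (l < k.+1)%N ->
    (qq1 (zoomed_poly kappa sg (t j) (u j) i0)
         (zoomed_poly kappa minus (t j) (u j) i0))`_l = 0]%classic.
  apply: filterS (filterI t_neq0 qq) => j /= [tj E] l lk.
  rewrite (zoomed_qq i0 tj E) (bigID K) /= (eq_bigr (fun=> 'X)); last first.
    by move=> s; rewrite /K => ->.
  rewrite (prodr_const K) hk coefM big1 // => i _.
  rewrite coefXn ltn_eqF ?mul0r // (leq_ltn_trans _ lk) // -ltnS; exact: ltn_ord.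
have zoom0 j b : t j != 0 -> (zoomed_poly kappa b (t j) (u j) i0)`_0 = 0 ->
    exists2 s, b s & kappa s + t j * u j s = kappa i0.
  move=> tj; rewrite -horner_coef0 horner_prod => /eqP/prodf_eq0[s bs].
  case: (eqVneq (kappa s) (kappa i0)) => [e|_];
    rewrite ?hornerXsubC ?hornerD ?hornerZ ?hornerXsubC ?hornerC sub0r ?oppr_eq0.
    by move=> /eqP us; exists s => //; rewrite us mulr0 addr0.
  rewrite mulrN -addrA -opprD subr_eq0 => /eqP us; by exists s.
have cop : U [set j | (zoomed_poly kappa sg (t j) (u j) i0)`_0 = 0 ->
    (zoomed_poly kappa minus (t j) (u j) i0)`_0 != 0]%classic.
  apply: filterS (filterI t_neq0 coprime_qq) => j /= [tj cj] /(zoom0 j _ tj)[s sgs es].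
  apply/eqP => /(zoom0 j _ tj)[r sgr er].
  by have := cj s r sgs sgr; rewrite es er eqxx.
have [f0 h0] := limit_nonvanishing ce (poly_ulim_zoomed sg i0) (poly_ulim_zoomed minus i0)
  (size_lim sg) (size_lim minus) low cop.
have concl (b : pred 'I_N) : b i0 -> (\prod_(s | b s) (if kappa s == kappa i0
      then 'X - (nu s)%:P else (kappa i0 - kappa s)%:P))`_0 != 0 -> nu i0 != 0.
  move=> bi; rewrite -horner_coef0 horner_prod => /prodf_neq0/(_ i0 bi).
  by rewrite eqxx hornerXsubC sub0r oppr_eq0.
have [si|si] := boolP (sg i0); first exact: (concl sg).
exact: (concl minus).
Qed.

(** The limiting equations say that the product of the differences to the other roots of the
    cluster is, up to sign, a power of the root; as the root is not zero, the roots
    are distinct. *)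
Lemma base_solution_limit : base_solution sg kappa nu.
Proof.
have base i : \prod_(s | (kappa s == kappa i) && (s != i)) (nu i - nu s)
            + side_sign sg i * nu i ^+ #|fun s => kappa s == kappa i| = 0.
  apply: (mulfI (other_clusters_neq0 kappa i)); rewrite mulr0 -rescaled_base_value.
  apply: (ulim_unique (ulim_rescaled i)); apply: ulim_near (ulim_cst 0).
  by apply: filterS (filterI t_neq0 qq) => j /= [tj E]; rewrite (rescaled_of_qq tj E).
split=> // i s e e'; apply/eqP/negPn/negP => is'.
have := base i; rewrite (bigD1 s) /=; last by rewrite e eqxx eq_sym.
rewrite {1}e' subrr mul0r add0r => /eqP; apply/negP.
by rewrite mulf_neq0 ?expf_neq0 ?rescaled_limit_neq0 // signr_eq0.
Qed.

End Sequences.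
End Compactness.

(** * Solutions without a common root *)

Section CoprimeFamilies.
Context {R : realType} {N : nat} (sg : pred 'I_N).
Local Notation C := R[i].
Implicit Types (kappa nu w u : 'I_N -> C) (i s : 'I_N).
Local Notation minus := (fun i => ~~ sg i).

Definition in_family (eps : R) (Lambda : {poly C}) (t : C) w : Prop :=
  exists W : 'I_N -> C -> C, [/\ forall i, poly_limit eps (W i),
    forall tau, normc tau < eps -> finite_qq Lambda tau
      (roots_poly sg (fun i => W i tau)) (roots_poly minus (fun i => W i tau))
  & forall i, W i t = w i].

(** For parameter 0 the rescaled roots do not influence the roots, which is why the
    conditions on them are restricted to nonzero parameters. *)
Lemma base_in_family kappa nu : base_solution sg kappa nu ->
  exists d r : R, [/\ 0 < d, 0 < r & forall t u eps, 0 < eps <= r -> normc t < eps ->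
    (forall k, t != 0 -> normc (u k - nu k) <= d) ->
    (forall i, t != 0 -> rescaled_equation sg kappa id i t u = 0) ->
    in_family eps (roots_poly predT kappa) t (fun i => kappa i + t * u i)].
Proof.
move=> bs; have [d [r [u0 [d0 r0 lim qq uniq]]]] := base_family bs.
exists d, r; split=> // t u eps /andP[e0 er] te ud hu.
exists (fun i tau => kappa i + tau * u0 i tau); split=> [i|tau te'|i].
- apply: poly_limit_affineX => //; exact: (poly_limitW (ltW e0) er).
- exact: (qq tau (lt_le_trans te' er)).
- have [->|t0] := eqVneq t 0; first by rewrite !mul0r.
  rewrite -(uniq t u (lt_le_trans te er)) // => k; [exact: ud | exact: hu].
Qed.

Lemma qq_root_modulus (Lambda : {poly C}) t w i :
  finite_qq Lambda t (roots_poly sg w) (roots_poly minus w) ->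
  normc Lambda.[w i] = normc t * \prod_(s | s != i) normc (w i - w s).
Proof.
move=> E; have := qq_at_root (b := predT) sg w t (i := i) isT.
have -> : qq_at t (roots_poly (fun s => predT s && sg s) w)
  (roots_poly (fun s => predT s && ~~ sg s) w) = Lambda by exact: E.
move=> ->; rewrite normcN !normcM normc_prod /side_sign normcX normcN normc1 expr1n mul1r //.
Qed.

(** Far away from the zeros of the right-hand side, its value at the farthest root is
    comparable to the power [N] of the modulus, whereas the Wronskian only provides
    a product of [N - 1] distances. *)
Lemma qq_roots_bounded kappa t w (beta : R) : normc t <= 1 ->
  (forall i, normc (kappa i) <= beta) ->
  finite_qq (roots_poly predT kappa) t (roots_poly sg w) (roots_poly minus w) ->
  forall i, normc (w i) <= 2 * beta + 2 ^+ N * 2 ^+ N.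
Proof.
move=> t1 kb E i0.
have beta0 : 0 <= beta by apply: le_trans (kb i0); exact: normc_ge0.
have := @max_modulus_bound R N predT w (2 ^+ N) (2 * beta) _ _ _ i0 isT.
have cN : #|(predT : pred 'I_N)| = N by rewrite -[RHS]card_ord; apply: eq_card.
rewrite cN; apply; rewrite ?exprn_ge0 ?mulr_ge0 //.
move=> i _ wb; have := qq_root_modulus i E.
rewrite horner_roots_poly normc_prod => e.
have h : normc (w i) ^+ N <= \prod_(s < N) (2 * normc (w i - kappa s)).
  rewrite -[X in _ ^+ X]cN -prodr_const; apply: ler_prod => s _; rewrite normc_ge0 /=.
  have := normc_dist_le (w i) (kappa s); have := kb s; lra.
apply: le_trans h _; rewrite big_split /= prodr_const card_ord ler_wpM2l ?exprn_ge0 //.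
rewrite e ler_piMl //; apply: prodr_ge0 => s _; exact: normc_ge0.
Qed.

Section Sequence.
Context {U : set_system nat} {UU : UltraFilter U}.

Lemma ulim_ratio (P Q : nat -> C) (l : C) : l != 0 -> ulim U P l -> ulim U Q l ->
  U [set j | 0 < normc (P j) /\ normc (Q j) <= 4 * normc (P j)]%classic.
Proof.
move=> l0 hP hQ; have lp : 0 < normc l by rewrite normc_gt0.
have e0 : 0 < normc l / 2 by rewrite divr_gt0.
apply: filterS (filterI (hP _ e0) (hQ _ e0)) => j /= [h1 h2].
have := normc_dist_le l (P j); rewrite normcB => h3.
have := normc_dist_le (Q j) l; lra.
Qed.

Context (kappa : 'I_N -> C) (t : nat -> C) (w : nat -> 'I_N -> C).
Context (t_lim : ulim U t 0) (w_lim : forall i, ulim U (fun j => w j i) (kappa i)).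

Lemma poly_ulim_roots b : poly_ulim (U := U) (fun j => roots_poly b (w j)) (roots_poly b kappa).
Proof.
apply: poly_ulim_prod => s _; apply: poly_ulimD; first exact: poly_ulim_cst.
apply: poly_ulimN => l; rewrite coefC; case: ifP => l0.
  by apply: eq_ulim (w_lim s) => j; rewrite coefC l0.
by apply: eq_ulim (ulim_cst 0) => j; rewrite coefC l0.
Qed.

(** The Wronskians stay bounded, so their multiples by [t] disappear in the limit. *)
Lemma limit_factorization (Lambda : {poly C}) :
  (forall j, finite_qq Lambda (t j) (roots_poly sg (w j)) (roots_poly minus (w j))) ->
  Lambda = roots_poly predT kappa.
Proof.
move=> E; rewrite (roots_polyID predT sg) /=.
have tC : poly_ulim (U := U) (fun j => (t j)%:P) 0%:P.
  move=> l; rewrite coefC; case: ifP => l0.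
    by apply: eq_ulim t_lim => j; rewrite coefC l0.
  by apply: eq_ulim (ulim_cst 0) => j; rewrite coefC l0.
have f := poly_ulim_roots sg; have h := poly_ulim_roots minus.
pose proof (poly_ulimD (poly_ulimM f h) (poly_ulimM tC
  (poly_ulimD (poly_ulimM f (poly_ulim_deriv h))
    (poly_ulimN (poly_ulimM h (poly_ulim_deriv f)))))) as L.
rewrite mul0r addr0 in L.
apply/polyP => l; apply: (ulim_unique _ (L l)).
apply: eq_ulim (ulim_cst Lambda`_l) => j.
by rewrite -{1}(E j) mul_polyC.
Qed.

Lemma ulim_eventually_neq i :
  U [set j | forall s, kappa s != kappa i -> w j i != kappa s]%classic.
Proof.
apply: filter_forall => s.
have [->|ks] := eqVneq (kappa s) (kappa i); first by apply: filter_always.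
have d0 : kappa i - kappa s != 0 by rewrite subr_eq0 eq_sym.
apply: filterS (ulim_neq0 (ulimB (w_lim i) (ulim_cst (kappa s))) d0) => j /= h _.
by rewrite -subr_eq0.
Qed.

(** Within a cluster the roots approach the root of the right-hand side at least
    linearly in the parameter: at the farthest one, both sides of the qq-equation
    are products of distances, and the other clusters contribute comparable
    factors. *)
Lemma rescaled_roots_bounded i0 :
  U [set j | t j != 0]%classic ->
  U [set j | finite_qq (roots_poly predT kappa) (t j)
    (roots_poly sg (w j)) (roots_poly minus (w j))]%classic ->
  U [set j | normc ((w j i0 - kappa i0) / t j)
     <= 4 * 2 ^+ #|fun s => kappa s == kappa i0|]%classic.
Proof.
move=> t0 qq.
pose K s := kappa s == kappa i0.
have ratio : U [set j | forall i, K i ->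
    0 < normc (\prod_(s | ~~ K s) (w j i - kappa s)) /\
    normc (\prod_(s | ~~ K s) (w j i - w j s)) <=
      4 * normc (\prod_(s | ~~ K s) (w j i - kappa s))]%classic.
  apply: filter_forall => i.
  have [Ki|Ki] := boolP (K i); last by apply: filter_always.
  have l0 : \prod_(s | ~~ K s) (kappa i - kappa s) != 0.
    apply/prodf_neq0 => s; rewrite /K subr_eq0 (eqP Ki) eq_sym //.
  have hP : ulim U (fun j => \prod_(s | ~~ K s) (w j i - kappa s))
      (\prod_(s | ~~ K s) (kappa i - kappa s)).
    by apply: ulim_prod => s _; apply: ulimB => //; exact: ulim_cst.
  have hQ : ulim U (fun j => \prod_(s | ~~ K s) (w j i - w j s))
      (\prod_(s | ~~ K s) (kappa i - kappa s)).
    by apply: ulim_prod => s _; apply: ulimB.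
  by apply: filterS (ulim_ratio l0 hP hQ).
apply: filterS (filterI t0 (filterI qq ratio)) => j /= [tj [E rat]].
pose u i := (w j i - kappa i) / t j.
have wE i : kappa i + t j * u i = w j i by rewrite /u mulrC divfK // addrC subrK.
suff key : forall i, K i ->
    normc (u i) ^+ #|K| <= 4 * \prod_(s | K s && (s != i)) normc (u i - u s).
  have := @max_modulus_bound R N K u 4 0 _ _ (fun i Ki _ => key i Ki) i0 (eqxx _).
  by rewrite add0r; apply.
clearbody u => i Ki.
have E' : finite_qq (roots_poly predT kappa) (t j)
    (roots_poly sg (fun i => kappa i + t j * u i))
    (roots_poly minus (fun i => kappa i + t j * u i)).
  by have -> : (fun i => kappa i + t j * u i) = w j by apply/funext.
have := rescaled_of_qq tj E' i; rewrite /rescaled_equation => /eqP.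
rewrite addr_eq0 => /eqP /(congr1 (@normc R)).
rewrite normcN normcM /side_sign normcX normcN normc1 expr1n mul1r.
rewrite (bigID K) /= [in X in _ = X](bigID K) /= !normcM.
have KE s : (kappa s == kappa i) = K s by rewrite /K (eqP Ki).
have -> : \prod_(s | (s != i) && K s) (if kappa s == kappa i then u i - u s
     else kappa i - kappa s + t j * (u i - u s)) = \prod_(s | K s && (s != i)) (u i - u s).
  by apply: eq_big => [s|s /andP[_ h]]; [rewrite andbC | rewrite KE h].
have -> : \prod_(s | (s != i) && ~~ K s) (if kappa s == kappa i then u i - u s
     else kappa i - kappa s + t j * (u i - u s)) = \prod_(s | ~~ K s) (w j i - w j s).
  apply: eq_big => [s|s /andP[_ h]]; last by rewrite KE (negbTE h) -!wE; ring.
  by rewrite andb_idl //; apply: contraNneq => ->.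
have -> : \prod_(s | K s) (if kappa s == kappa i then u i
     else kappa i - kappa s + t j * u i) = u i ^+ #|K|.
  by rewrite -prodr_const; apply: eq_big => // s h; rewrite KE ifT.
have -> : \prod_(s | ~~ K s) (if kappa s == kappa i then u i
     else kappa i - kappa s + t j * u i) = \prod_(s | ~~ K s) (w j i - kappa s).
  by apply: eq_bigr => s h; rewrite KE (negbTE h) -wE; ring.
have [P0 PQ] := rat i Ki.
set P := normc (\prod_(s | ~~ K s) (w j i - kappa s)) in P0 PQ *.
set Q := normc (\prod_(s | ~~ K s) (w j i - w j s)) in PQ *.
rewrite normcX normc_prod => e.
rewrite -(ler_pM2r P0) -e mulrAC mulrC ler_wpM2r //.
by apply: prodr_ge0 => s _; exact: normc_ge0.
Qed.

End Sequence.

(** If no radius worked, there would be a sequence of solutions outside all families with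
    parameters tending to 0.  Along an ultrafilter their rescaled roots converge to a
    solution of the limiting equations, whose family contains all nearby solutions,
    hence members of the sequence.  If the parameters are eventually 0 instead, the
    solutions themselves are eventually constant and their clusters one-sided. *)
Lemma coprime_families (Lambda : {poly C}) : Lambda \is monic -> size Lambda = N.+1 ->
  exists eps : R, 0 < eps /\ forall t w, normc t < eps ->
    finite_qq Lambda t (roots_poly sg w) (roots_poly minus w) ->
    (forall i s, sg i -> ~~ sg s -> w i != w s) -> in_family eps Lambda t w.
Proof.
move=> mL sL; apply: contrapT => H.
have /choice[p hp] : forall j, exists p : C * ('I_N -> C),
    [/\ normc p.1 < 2^-1 ^+ j,
        finite_qq Lambda p.1 (roots_poly sg p.2) (roots_poly minus p.2),
        forall i s, sg i -> ~~ sg s -> p.2 i != p.2 s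
      & ~ in_family (2^-1 ^+ j) Lambda p.1 p.2].
  move=> j; apply: contrapT => nex; apply: H.
  exists (2^-1 ^+ j); split; first by rewrite exprn_gt0.
  by move=> t w tr E cop; apply: contrapT => nf; apply: nex; exists (t, w).
pose t j := (p j).1; pose w j := (p j).2.
have tj j : normc (t j) < 2^-1 ^+ j by have [] := hp j.
have qq j : finite_qq Lambda (t j) (roots_poly sg (w j)) (roots_poly minus (w j)).
  by have [] := hp j.
have cop j i s : sg i -> ~~ sg s -> w j i != w j s by have [_ _ h _] := hp j; exact: h.
have bad j : ~ in_family (2^-1 ^+ j) Lambda (t j) (w j) by have [] := hp j.
have [U UU sU] := ultra_nat.
have small (e : R) : 0 < e -> U [set j | 2^-1 ^+ j < e]%classic.
  by move=> e0; apply: sU; exact: nbhs_infty_half.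
have t_lim : ulim U t 0.
  move=> e e0; apply: filterS (small e e0) => j /=; rewrite subr0; apply: lt_trans; exact: tj.
have [rs LE] := closed_field_poly_normal Lambda.
rewrite (monicP mL) scale1r in LE.
have srs : size rs = N by apply/eqP; rewrite -eqSS -sL LE size_prod_XsubC.
have LE0 : Lambda = roots_poly predT (fun i : 'I_N => rs`_i).
  by rewrite LE /roots_poly (big_nth 0) srs big_mkord.
have /choice[kappa w_lim] : forall i, exists k, ulim U (fun j => w j i) k.
  move=> i.
  pose beta := \sum_(k < N) normc rs`_k.
  apply: (@ultra_limit _ _ _ _ (2 * beta + 2 ^+ N * 2 ^+ N)).
  apply: filter_always => j /=.
  apply: (@qq_roots_bounded (fun i : 'I_N => rs`_i) (t j)) => [|k|].
  - apply: le_trans (ltW (tj j)) _; rewrite exprn_ile1 //.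
    by rewrite invf_le1 // ler1n.
  - rewrite /beta (bigD1 k) //= lerDl; apply: sumr_ge0 => l _; exact: normc_ge0.
  - by rewrite -LE0.
have LK := limit_factorization t_lim w_lim qq.
have concl nu : base_solution sg kappa nu ->
    (forall d, 0 < d -> U [set j | exists u : 'I_N -> C,
        [/\ w j = (fun i => kappa i + t j * u i),
            forall k, t j != 0 -> normc (u k - nu k) <= d
          & forall i, t j != 0 -> rescaled_equation sg kappa id i (t j) u = 0]]%classic) -> False.
  move=> bs hu; have [d [r [d0 r0 fam]]] := base_in_family bs.
  have [j /= [[u [wE ud ue]] jr]] := filter_ex (filterI (hu d d0) (small r r0)).
  apply: (bad j); rewrite wE LK; apply: fam => //.
  by rewrite exprn_gt0 //= ltW.
have [tU|tU] := in_ultra_setVsetC [set j | t j != 0]%classic UU; last first.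
  have wk : U [set j | t j = 0 /\ forall i, w j i = kappa i]%classic.
    have near : U [set j | forall i s, kappa s != kappa i -> w j i != kappa s]%classic.
      by apply: filter_forall => i; exact: (ulim_eventually_neq w_lim).
    apply: filterS (filterI tU near) => j /= [/negP/negPn/eqP t0 hj]; split=> // i.
    have := qq_root_modulus i (qq j); rewrite t0 normc0 mul0r => /eqP.
    rewrite normc_eq0 LK horner_roots_poly => /prodf_eq0[s _]; rewrite subr_eq0 => /eqP e.
    have [ks|ks] := eqVneq (kappa s) (kappa i); first by rewrite e.
    by have := hj i s ks; rewrite e eqxx.
  have [j0 /= [_ wj0]] := filter_ex wk.
  have sided i s : kappa i = kappa s -> sg i = sg s.
    rewrite -!wj0 => e; case: (boolP (sg i)) => si; case: (boolP (sg s)) => ss //.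
      by have := cop j0 i s si ss; rewrite e eqxx.
    by have := cop j0 s i ss si; rewrite e eqxx.
  have [nu bs] := one_sided_base sided.
  apply: (concl nu bs) => d d0; apply: filterS wk => j /= [t0 wj].
  exists nu; split=> [|k|i]; rewrite t0 ?eqxx //.
  by apply/funext => i; rewrite mul0r addr0.
pose u j i := (w j i - kappa i) / t j.
have uE j : t j != 0 -> w j = (fun i => kappa i + t j * u j i).
  by move=> t0; apply/funext => i; rewrite /u mulrC divfK // addrC subrK.
have qqK : U [set j | finite_qq (roots_poly predT kappa) (t j)
    (roots_poly sg (w j)) (roots_poly minus (w j))]%classic.
  by apply: filter_always => j /=; rewrite -LK.
have qqU : U [set j | finite_qq (roots_poly predT kappa) (t j)
    (roots_poly sg (fun i => kappa i + t j * u j i))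
    (roots_poly minus (fun i => kappa i + t j * u j i))]%classic.
  by apply: filterS (filterI tU qqK) => j /= [t0]; rewrite (uE j t0).
have /choice[nu u_lim] : forall i, exists c, ulim U (fun j => u j i) c.
  by move=> i; apply: ultra_limit; apply: (rescaled_roots_bounded w_lim i tU qqK).
have copU : U [set j | forall i s, sg i -> ~~ sg s ->
    kappa i + t j * u j i != kappa s + t j * u j s]%classic.
  apply: filterS tU => j /= t0 i s si ss.
  by have := cop j i s si ss; rewrite (uE j t0).
apply: (concl nu (base_solution_limit t_lim u_lim tU qqU copU)) => d d0.
have close : U [set j | forall k, normc (u j k - nu k) < d]%classic.
  by apply: filter_forall => k; exact: u_lim.
apply: filterS (filterI tU (filterI qqU close)) => j /= [t0 [E cl]].
exists (u j); split=> [|k _|i _]; [exact: uE | exact/ltW | exact: (rescaled_of_qq t0 E)].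
Qed.

End CoprimeFamilies.

(** * All solutions *)

Section AllFamilies.
Context {R : realType}.
Local Notation C := R[i].

Definition poly_family (m n : nat) (eps : R) (Lambda : {poly C}) (t : C) (qp qm : {poly C}) :=
  exists (X : 'I_m -> C -> C) (Y : 'I_n -> C -> C),
    [/\ (forall i, poly_limit eps (X i)) /\ (forall j, poly_limit eps (Y j)),
        forall tau, normc tau < eps -> finite_qq Lambda tau
          (roots_poly predT (fun i => X i tau)) (roots_poly predT (fun j => Y j tau)),
        qp = roots_poly predT (fun i => X i t) & qm = roots_poly predT (fun j => Y j t)].

Lemma poly_familyW m n (e e' : R) Lambda t qp qm : 0 < e' -> e' <= e ->
  poly_family m n e Lambda t qp qm -> poly_family m n e' Lambda t qp qm.
Proof.
move=> e0 ee [X [Y [[hX hY] qq hp hm]]]; exists X, Y; split=> // [|tau te].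
  by split=> i; apply: (poly_limitW (ltW e0) ee).
by apply: qq; apply: lt_le_trans ee.
Qed.

Lemma Wronskian_mul (g p q : {poly C}) :
  Wronskian (g * p) (g * q) = g ^+ 2 * Wronskian p q.
Proof. by rewrite /Wronskian !derivM; ring. Qed.

Lemma finite_qq_mul (g Lambda p q : {poly C}) t : finite_qq Lambda t p q ->
  finite_qq (g ^+ 2 * Lambda) t (g * p) (g * q).
Proof.
by rewrite /finite_qq => <-; rewrite Wronskian_mul -!mul_polyC; ring.
Qed.

Lemma roots_poly_ord m n (W : 'I_(m + n) -> C) :
  roots_poly (fun i => (i < m)%N) W = roots_poly predT (fun i => W (lshift n i)) /\
  roots_poly (fun i => ~~ (i < m)%N) W = roots_poly predT (fun j => W (rshift m j)).
Proof.
rewrite /roots_poly !big_split_ord /=; split.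
  rewrite [X in _ * X]big_pred0 ?mulr1 => [|i]; last by rewrite ltnNge leq_addr.
  by apply: eq_bigl => i; rewrite /= ltn_ord.
rewrite big_pred0 ?mul1r => [|i]; last by rewrite ltn_ord.
by apply: eq_bigl => i; rewrite -leqNgt leq_addr.
Qed.

Lemma monic_roots (q : {poly C}) m : q \is monic -> size q = m.+1 ->
  exists a : 'I_m -> C, q = roots_poly predT a.
Proof.
move=> qm sq; have [rs E] := closed_field_poly_normal q.
rewrite (monicP qm) scale1r in E.
have srs : size rs = m by apply/eqP; rewrite -eqSS -sq E size_prod_XsubC.
by exists (fun i => rs`_i); rewrite E /roots_poly (big_nth 0) srs big_mkord.
Qed.

Lemma roots_poly_recl m (a : 'I_m.+1 -> C) : roots_poly predT a =
  ('X - (a ord0)%:P) * roots_poly predT (fun i => a (lift ord0 i)).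
Proof. by rewrite /roots_poly big_ord_recl. Qed.

Lemma monic_root_divide (q : {poly C}) m z : q \is monic -> size q = m.+1 -> root q z ->
  exists m' p, [/\ m = m'.+1, q = ('X - z%:P) * p, p \is monic & size p = m'.+1].
Proof.
move=> qm sq /factor_theorem[p E].
have p0 : p != 0.
  by apply: contraTneq (monic_neq0 qm) => p0; rewrite E p0 mul0r eqxx.
have s : size q = (size p).+1.
  by rewrite E size_mul ?polyXsubC_eq0 // size_XsubC addnS addn1.
have sp : (0 < size p)%N by rewrite size_poly_gt0.
exists (size p).-1, p; split.
- by apply/eqP; rewrite prednK // -eqSS -sq s.
- by rewrite mulrC.
- by move: qm; rewrite E monicMr // monicXsubC.
- by rewrite prednK.
Qed.

(** Transcription of [coprime_families] from indexed roots to the two factors. *)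
Lemma coprime_poly_families m n (Lambda : {poly C}) : Lambda \is monic ->
  size Lambda = (m + n).+1 -> exists eps : R, 0 < eps /\ forall t qp qm, normc t < eps ->
    qp \is monic -> size qp = m.+1 -> qm \is monic -> size qm = n.+1 ->
    finite_qq Lambda t qp qm -> (forall z, root qp z -> ~~ root qm z) ->
    poly_family m n eps Lambda t qp qm.
Proof.
move=> mL sL.
have [eps [e0 H]] := coprime_families (fun i : 'I_(m + n) => (i < m)%N) mL sL.
exists eps; split=> // t qp qm te mp sp mm sm E cop.
have [a aE] := monic_roots mp sp; have [b bE] := monic_roots mm sm.
pose w (i : 'I_(m + n)) := match fintype.split i with inl k => a k | inr k => b k end.
have wl k : w (lshift n k) = a k by rewrite /w -[lshift n k]/(unsplit (inl k)) unsplitK.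
have wr k : w (rshift m k) = b k by rewrite /w -[rshift m k]/(unsplit (inr k)) unsplitK.
have [plusE minusE] := roots_poly_ord w.
have ap : roots_poly (fun i : 'I_(m + n) => (i < m)%N) w = qp.
  by rewrite plusE aE; apply: eq_bigr => i _; rewrite wl.
have bp : roots_poly (fun i : 'I_(m + n) => ~~ (i < m)%N) w = qm.
  by rewrite minusE bE; apply: eq_bigr => i _; rewrite wr.
have [||W [lim qq Wt]] := H t w te.
- by rewrite ap bp.
- move=> i s im sn; apply/eqP => e.
  have r1 : root qp (w i) by apply/rootP; rewrite -ap roots_poly_eq0.
  have := cop _ r1; rewrite e; apply/negP/negPn; apply/rootP.
  by rewrite -bp (roots_poly_eq0 (b := fun i : 'I_(m + n) => ~~ (i < m)%N)).
exists (fun i => W (lshift n i)), (fun j => W (rshift m j)); split=> //.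
- move=> tau te'; have := qq tau te'.
  by have [-> ->] := roots_poly_ord (fun i => W i tau).
- by rewrite aE; apply: eq_bigr => i _; rewrite Wt wl.
- by rewrite bE; apply: eq_bigr => i _; rewrite Wt wr.
Qed.

(** A common root of [q+] and [q-] is a double root of [Lambda], so it can be kept constant
    along the family; dividing it out reduces the degrees. *)
Lemma all_families m n (Lambda : {poly C}) : Lambda \is monic ->
  size Lambda = (m + n).+1 -> exists eps : R, 0 < eps /\ forall t qp qm, normc t < eps ->
    qp \is monic -> size qp = m.+1 -> qm \is monic -> size qm = n.+1 ->
    finite_qq Lambda t qp qm -> poly_family m n eps Lambda t qp qm.
Proof.
elim: m n Lambda => [|m IH] n Lambda mL sL.
  have [eps [e0 H]] := coprime_poly_families mL sL; exists eps; split=> // t qp qm te mp sp mm sm E.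
  apply: H => // z; have [a ->] := monic_roots mp sp.
  by rewrite /roots_poly big_ord0 (negbTE (root1 z)).
have [eps1 [e10 H1]] := coprime_poly_families mL sL.
have [rs LE] := closed_field_poly_normal Lambda.
rewrite (monicP mL) scale1r in LE.
have srs : size rs = (m.+1 + n)%N by apply/eqP; rewrite -eqSS -sL LE size_prod_XsubC.
have [eps2 [e20 H2]] : exists eps : R, 0 < eps /\ forall k : 'I_(m.+1 + n),
    forall n' Lambda', n = n'.+1 -> Lambda = ('X - (rs`_k)%:P) ^+ 2 * Lambda' ->
    forall t qp qm, normc t < eps ->
    qp \is monic -> size qp = m.+1 -> qm \is monic -> size qm = n'.+1 ->
    finite_qq Lambda' t qp qm -> poly_family m n' eps Lambda' t qp qm.
  apply: finite_uniform_radius => [k e e' e0 ee h n' L' nE LE' t qp qm te mp sp mm sm E|k].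
    by apply: (poly_familyW e0 ee); apply: (h n' L') => //; apply: lt_le_trans ee.
  have [[n' [L' [nE LE']]]|no] := pselect (exists n' L', n = n'.+1 /\
      Lambda = ('X - (rs`_k)%:P) ^+ 2 * L'); last first.
    by exists 1; split=> // n' L' nE LE'; case: no; exists n', L'.
  have g0 : ('X - (rs`_k)%:P) ^+ 2 != 0 by rewrite expf_neq0 // polyXsubC_eq0.
  have mL' : L' \is monic.
    by move: mL; rewrite LE' monicMl ?monic_exp ?monicXsubC.
  have sL' : size L' = (m + n').+1.
    have := sL; rewrite LE' size_mul ?g0 ?monic_neq0 //.
    rewrite (_ : size _ = 3%N) ?nE; last exact: size_exp_XsubC.
    by move: (size L') => l; rewrite addSn addnS => -[].
  have [e [e0 h]] := IH n' L' mL' sL'; exists e; split=> // n2 L2 nE2 LE2.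
  move: nE2; rewrite nE => -[<-].
  have <- : L' = L2 by apply: (mulfI g0); rewrite -LE' LE2.
  exact: h.
exists (Num.min eps1 eps2); split; first by rewrite lt_min e10.
move=> t qp qm; rewrite lt_min => /andP[t1 t2] mp sp mm sm E.
have m0 : 0 < Num.min eps1 eps2 by rewrite lt_min e10.
have [cop|] := pselect (forall z, root qp z -> ~~ root qm z).
  by apply: (@poly_familyW _ _ eps1) => //; [rewrite ge_min lexx | exact: H1].
move=> /existsNP[z /not_implyP[zp /negP/negPn zm]].
have [m' [p [[<-] pE mp' sp']]] := monic_root_divide mp sp zp.
have [n' [q [nE qE mq' sq']]] := monic_root_divide mm sm zm.
pose g : {poly C} := 'X - z%:P.
have g0 : g != 0 by rewrite polyXsubC_eq0.
pose L' := p * q + t *: Wronskian p q.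
have LE' : Lambda = g ^+ 2 * L'.
  have : finite_qq L' t p q by [].
  by move/(finite_qq_mul g); rewrite -pE -qE /finite_qq => <-.
have zr : z \in rs.
  rewrite -root_prod_XsubC -LE LE' rootM root_exp_XsubC //.
  by rewrite eqxx.
have zi : (index z rs < m.+1 + n)%N by rewrite -srs index_mem.
have zk : rs`_(Ordinal zi) = z by rewrite /= nth_index.
have [||X [Y [[lX lY] qq pX qY]]] := H2 (Ordinal zi) n' L' nE _ t p q t2 mp' sp' mq' sq'.
- by rewrite zk.
- by [].
pose X' (i : 'I_m.+1) := if unlift ord0 i is Some k then X k else fun=> z.
pose Y' (i : 'I_n'.+1) := if unlift ord0 i is Some k then Y k else fun=> z.
have XE tau : roots_poly predT (fun i => X' i tau) = g * roots_poly predT (fun i => X i tau).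
  rewrite roots_poly_recl /X' unlift_none; congr (_ * _).
  by apply: eq_bigr => i _; rewrite liftK.
have YE tau : roots_poly predT (fun i => Y' i tau) = g * roots_poly predT (fun i => Y i tau).
  rewrite roots_poly_recl /Y' unlift_none; congr (_ * _).
  by apply: eq_bigr => i _; rewrite liftK.
rewrite nE; apply: (@poly_familyW _ _ eps2) => //; first by rewrite ge_min lexx orbT.
exists X', Y'; split=> [|tau te||].
- split=> i; rewrite /X' /Y'; case: unlift => [k|//]; by [exact: poly_limit_cst | ].
- by rewrite XE YE LE'; apply/finite_qq_mul/qq.
- by rewrite XE pE -pX.
- by rewrite YE qE -qY.
Qed.

End AllFamilies.

(** * The Bethe equations *)

Section Bethe.
Context {R : realType}.
Local Notation C := R[i].

Lemma roots_poly_dvd m (w : 'I_m -> C) (P : {poly C}) : injective w ->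
  (forall i, P.[w i] = 0) -> exists q, P = roots_poly predT w * q.
Proof.
move=> inj h.
have [||q E] := @uniq_roots_prod_XsubC _ P [seq w i | i <- enum 'I_m].
- by apply/allP => _ /mapP[i _ ->]; apply/rootP.
- by rewrite uniq_rootsE map_inj_uniq ?enum_uniq.
by exists q; rewrite E big_map big_enum mulrC.
Qed.

Lemma roots_poly_interpolate m (w v : 'I_m -> C) : injective w ->
  exists h : {poly C}, forall i, h.[w i] = v i.
Proof.
move=> inj.
pose g i := roots_poly (fun s => predT s && (s != i)) w.
have g0 i : (g i).[w i] != 0.
  rewrite horner_roots_poly; apply/prodf_neq0 => s /= si.
  by rewrite subr_eq0; apply: contraNneq si => /inj ->.
exists (\sum_i (v i / (g i).[w i]) *: g i) => i.
rewrite horner_sum (bigD1 i) //= hornerZ divfK // big1 ?addr0 // => s si.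
by rewrite hornerZ [X in _ * X](roots_poly_eq0 (b := fun r => predT r && (r != s))) ?mulr0 //= eq_sym.
Qed.

(** The Bethe equation at the root [x] of [f], free of denominators. *)
Definition bethe_at (Lambda f : {poly C}) (t x : C) : Prop :=
  Lambda.[x] * f^`().[x] + t * (Lambda^`().[x] * f^`().[x] - Lambda.[x] * f^`()^`().[x]) = 0.

Lemma qq_bethe_at (Lambda f h : {poly C}) (t x : C) : finite_qq Lambda t f h ->
  f.[x] = 0 -> bethe_at Lambda f t x.
Proof.
rewrite /finite_qq /Wronskian => <- fx; rewrite /bethe_at !poly.derivE.
by rewrite !(hornerD, hornerM, hornerN, hornerZ) fx; ring.
Qed.

(** Conversely, the second factor is found by interpolation: once [h0] has the right
    values at the roots of [f], the Bethe equations say that the remaining defect is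
    divisible by the square of [f], and then it is removed by adding to [h0] a
    multiple of [f]. *)
Lemma bethe_at_qq m (w : 'I_m -> C) (Lambda : {poly C}) (t : C) : injective w -> t != 0 ->
  (forall l, bethe_at Lambda (roots_poly predT w) t (w l)) ->
  exists h, finite_qq Lambda t (roots_poly predT w) h.
Proof.
move=> inj t0 B; set f := roots_poly predT w in B *.
have f'0 l : f^`().[w l] != 0.
  rewrite deriv_roots_poly_at //; apply/prodf_neq0 => s /= si.
  by rewrite subr_eq0; apply: contraNneq si => /inj ->.
have f0 l : f.[w l] = 0 by exact: roots_poly_eq0.
have [h0 hv] := roots_poly_interpolate (fun l => - (Lambda.[w l] / (t * f^`().[w l]))) inj.
pose D := Lambda - qq_at t f h0.
have D0 l : D.[w l] = 0.
  rewrite /D hornerD hornerN qq_at_root_plus // hv; field.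
  by rewrite t0 f'0.
have [g gE] := roots_poly_dvd inj D0.
have g0 l : g.[w l] = 0.
  have : D^`().[w l] = f^`().[w l] * g.[w l].
    by rewrite gE -/f derivM hornerD !hornerM f0 mul0r addr0.
  have := B l; rewrite /bethe_at /D /qq_at !poly.derivE.
  rewrite !(hornerD, hornerM, hornerN, hornerZ) f0 hv => b e.
  apply: (mulfI (f'0 l)); rewrite -e mulr0.
  set L := Lambda.[w l] in b *; set L' := Lambda^`().[w l] in b *.
  set a := f^`().[w l] in b *; set a2 := f^`()^`().[w l] in b *.
  have a0 : a != 0 by exact: f'0.
  have -> : forall y z : C, L' + - (a * - (L / (t * a)) + 0 * y
     + t * (a * y + 0 * z + - (y * a + - (L / (t * a)) * a2)))
     = (L * a + t * (L' * a - L * a2)) / (t * a).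
    by move=> y z; field; rewrite t0 a0.
  by rewrite b mul0r.
have [k kE] := roots_poly_dvd inj g0.
have [p pE] := solve_first_order t k.
exists (h0 + f * p).
have DE : D = f ^+ 2 * k by rewrite gE kE -/f; ring.
rewrite /finite_qq /Wronskian -[RHS](subrK (qq_at t f h0)) -/D DE -pE /qq_at !poly.derivE.
by rewrite -!mul_polyC; ring.
Qed.

(** The product of the factors has larger degree than their Wronskian. *)
Lemma qq_second_factor m n (Lambda f h : {poly C}) (t : C) : Lambda \is monic ->
  size Lambda = (m + n).+1 -> f \is monic -> size f = m.+1 -> finite_qq Lambda t f h ->
  h \is monic /\ size h = n.+1.
Proof.
move=> mL sL mf sf E.
have h0 : h != 0.
  apply: contraTneq (monic_neq0 mL) => h0; rewrite -E h0 /Wronskian deriv0 !mulr0 mul0r.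
  by rewrite subr0 scaler0 addr0 eqxx.
have sh : (0 < size h)%N by rewrite size_poly_gt0.
have sfh : size (f * h) = (m + size h)%N by rewrite size_mul ?(monic_neq0 mf) // sf.
have lt : (size (t *: Wronskian f h) < size (f * h)%R)%N.
  rewrite sfh (leq_ltn_trans (size_scale_leq _ _)) //.
  apply: (@leq_ltn_trans (m + (size h).-1)); last by rewrite ltn_add2l prednK.
  by apply: size_qq1_lower; [rewrite sf | rewrite prednK].
split.
  by move: mL; rewrite -E !monicE lead_coefDl // lead_coefM (monicP mf) mul1r.
apply/eqP; rewrite -(eqn_add2l m) -sfh -(size_polyDl lt) E sL addnS //.
Qed.

Lemma logderiv_prod (I : finType) (P : pred I) (F : I -> {poly C}) (x : C) :
  (forall i, P i -> (F i).[x] != 0) ->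
  (\prod_(i | P i) F i)^`().[x] = (\prod_(i | P i) F i).[x] *
    \sum_(i | P i) (F i)^`().[x] / (F i).[x].
Proof.
move=> h; rewrite deriv_prod_cond ?index_enum_uniq // horner_sum mulr_sumr.
apply: eq_bigr => i Pi; rewrite hornerM !horner_prod [in RHS](bigD1 i) //=.
by field; exact: h.
Qed.

(** The two sums are the logarithmic derivatives of [Lambda] and of the derivative of the
    polynomial with roots [w]. *)
Lemma bethe_atE m N (w : 'I_m -> C) (z : 'I_N -> C) (nn : 'I_N -> nat) (t zeta : C) l :
  let Lambda := \prod_(k < N) ('X - (z k)%:P) ^+ nn k in
  injective w -> (forall k, (0 < nn k)%N) -> Lambda.[w l] != 0 -> t != 0 ->
  2%:R * zeta = t^-1 ->
  2%:R * zeta + \sum_(j < N) (nn j)%:R / (w l - z j)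
    - \sum_(s < m | s != l) 2%:R / (w l - w s) = 0
  <-> bethe_at Lambda (roots_poly predT w) t (w l).
Proof.
move=> Lambda inj nn0 L0 t0 ->; set f := roots_poly predT w; set x := w l.
have xz j : x - z j != 0.
  move: L0; rewrite /Lambda horner_prod => /prodf_neq0/(_ j isT).
  by rewrite horner_exp hornerXsubC expf_eq0 nn0.
have LE : Lambda^`().[x] = Lambda.[x] * \sum_(j < N) (nn j)%:R / (x - z j).
  rewrite /Lambda logderiv_prod => [|i _]; last first.
    by rewrite horner_exp hornerXsubC expf_neq0.
  congr (_ * _); apply: eq_bigr => j _; rewrite deriv_exp derivXsubC mul1r.
  rewrite hornerMn !horner_exp hornerXsubC; case: (nn j) (nn0 j) => // k _ /=.
  rewrite exprS -mulr_natl.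
  by field; rewrite xz expf_neq0.
pose g := roots_poly (fun s => predT s && (s != l)) w.
have fE : f = ('X - x%:P) * g by rewrite /f (roots_poly_split _ (i := l)).
have gx : g.[x] != 0.
  rewrite horner_roots_poly; apply/prodf_neq0 => s /= si.
  by rewrite subr_eq0; apply: contraNneq si => /inj ->.
have f1 : f^`().[x] = g.[x].
  by rewrite fE !poly.derivE !(hornerD, hornerM, hornerN, hornerX, hornerC); ring.
have f2 : f^`()^`().[x] = g.[x] * \sum_(s < m | s != l) 2%:R / (x - w s).
  have -> : f^`()^`().[x] = 2%:R * g^`().[x].
    by rewrite fE !poly.derivE !(hornerD, hornerM, hornerN, hornerX, hornerC); ring.
  rewrite /g /roots_poly logderiv_prod => [|i /= il]; last first.
    by rewrite hornerXsubC subr_eq0; apply: contraNneq il => /inj ->.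
  rewrite mulrCA; congr (_ * _); rewrite mulr_sumr; apply: eq_bigr => s _.
  by rewrite derivXsubC hornerC hornerXsubC mul1r.
rewrite /bethe_at LE f1 f2.
set S1 := \sum_(j < N) _; set S2 := \sum_(s < m | _) _.
have -> : Lambda.[x] * g.[x] + t * (Lambda.[x] * S1 * g.[x] - Lambda.[x] * (g.[x] * S2))
   = (t * Lambda.[x] * g.[x]) * (t^-1 + S1 - S2) by field.
split=> [->|/eqP]; first by rewrite mulr0.
by rewrite mulf_eq0 !mulf_eq0 (negbTE t0) (negbTE L0) (negbTE gx) => /eqP.
Qed.

End Bethe.

(** * Numbering the roots of a family *)

Section Assembly.
Context {R : realType}.
Local Notation C := R[i].

Lemma prodXaddCE m (x : 'I_m -> C) : prodXaddC x = roots_poly predT (fun i => - x i).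
Proof. by apply: eq_bigr => i _; rewrite polyCN opprK. Qed.

Lemma discE (eps : R) (t : C) : disc eps t <-> normc t < eps.
Proof. by rewrite /disc /= norm_normc ltcR. Qed.

Lemma roots_poly_perm m (a b : 'I_m -> C) : roots_poly predT a = roots_poly predT b ->
  exists s : 'S_m, forall i, a (s i) = b i.
Proof.
move=> E.
have toseq (c : 'I_m -> C) :
    \prod_(x <- [tuple c i | i < m]) ('X - x%:P) = roots_poly predT c.
  by rewrite big_tuple; apply: eq_bigr => i _; rewrite tnth_mktuple.
have : perm_eq [tuple b i | i < m] [tuple a i | i < m].
  by apply: prod_XsubC_eq; rewrite !toseq.
move=> /tuple_permP[s hs]; exists s => i.
by have := congr1 (fun r : m.-tuple C => tnth r i) (val_inj hs); rewrite !tnth_mktuple.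
Qed.

(** The roots of a family may be numbered so that they match a given numbering at one
    chosen parameter: the initial one, or that of a Bethe solution. *)
Lemma poly_family_roots m n (eps : R) Lambda t (a : 'I_m -> C) (b : 'I_n -> C) : 0 < eps ->
  poly_family m n eps Lambda t (roots_poly predT a) (roots_poly predT b) ->
  exists (x : 'I_m -> C -> C) (y : 'I_n -> C -> C),
    [/\ infinite_qq Lambda (prodXaddC (fun i => x i 0)) (prodXaddC (fun j => y j 0)),
        qq_family Lambda eps (fun i => x i 0) (fun j => y j 0) x y,
        forall i, x i t = - a i & forall j, y j t = - b j].
Proof.
move=> e0 [X [Y [[lX lY] qq]]] /esym/roots_poly_perm[s hs] /esym/roots_poly_perm[s' hs'].
pose x i tau := - X (s i) tau; pose y j tau := - Y (s' j) tau.
have permE k (p : 'S_k) (Z : 'I_k -> C -> C) tau :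
    prodXaddC (fun i => - Z (p i) tau) = roots_poly predT (fun i => Z i tau).
  rewrite prodXaddCE /roots_poly [RHS](reindex_inj (@perm_inj _ p)) /=.
  by apply: eq_bigr => i _; rewrite opprK.
have qqE tau : normc tau < eps ->
    finite_qq Lambda tau (prodXaddC (fun i => x i tau)) (prodXaddC (fun j => y j tau)).
  by move=> te; rewrite !permE; exact: qq.
exists x, y; split=> [||i|j]; last 2 first.
- by rewrite /x hs.
- by rewrite /y hs'.
- have := qqE 0; rewrite normc0 => /(_ e0).
  by rewrite /finite_qq scale0r addr0.
split=> [i|j|tau /discE]; [| |exact: qqE].
- by split=> //; apply/poly_limit_analytic/poly_limit_opp.
- by split=> //; apply/poly_limit_analytic/poly_limit_opp.
Qed.

End Assembly.

Theorem theorem4p3 (R : realType) (m n : nat) (Lambda : {poly R[i]})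
    (Lambda_monic : Lambda \is monic) (Lambda_deg : size Lambda = (m + n).+1)
    (Lambda0 : Lambda.[0] != 0) :
  (forall (x0 : 'I_m -> R[i]) (y0 : 'I_n -> R[i]),
     infinite_qq Lambda (prodXaddC x0) (prodXaddC y0) ->
     exists eps : R, 0 < eps /\
       exists (x : 'I_m -> R[i] -> R[i]) (y : 'I_n -> R[i] -> R[i]),
         qq_family Lambda eps x0 y0 x y) /\
  (exists eps : R, 0 < eps /\
     (forall (t : R[i]) (qp qm : {poly R[i]}), disc eps t ->
        qp \is monic -> size qp = m.+1 -> qm \is monic -> size qm = n.+1 ->
        finite_qq Lambda t qp qm ->
        exists (x0 : 'I_m -> R[i]) (y0 : 'I_n -> R[i])
               (x : 'I_m -> R[i] -> R[i]) (y : 'I_n -> R[i] -> R[i]),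
          [/\ infinite_qq Lambda (prodXaddC x0) (prodXaddC y0),
              qq_family Lambda eps x0 y0 x y,
              qp = prodXaddC (fun i => x i t) & qm = prodXaddC (fun j => y j t)]) /\
     (forall (N : nat) (z : 'I_N -> R[i]) (nn : 'I_N -> nat),
        injective z -> (forall k, (0 < nn k)%N) ->
        Lambda = \prod_(k < N) ('X - (z k)%:P) ^+ nn k ->
        forall (t zeta : R[i]) (w : 'I_m -> R[i]),
          disc eps t -> t != 0 -> 2%:R * zeta = t^-1 ->
          (Bethe_solution z nn zeta w <->
           exists (x0 : 'I_m -> R[i]) (y0 : 'I_n -> R[i])
                  (x : 'I_m -> R[i] -> R[i]) (y : 'I_n -> R[i] -> R[i]),
             [/\ infinite_qq Lambda (prodXaddC x0) (prodXaddC y0),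
                 qq_family Lambda eps x0 y0 x y,
                 injective (fun i => x i t),
                 forall i, ~~ root Lambda (- x i t)
               & forall l, w l = - x l t]))).
Proof.
have [eps [e0 H]] := all_families Lambda_monic Lambda_deg.
have fam t (a : 'I_m -> R[i]) (b : 'I_n -> R[i]) : normc t < eps ->
    finite_qq Lambda t (roots_poly predT a) (roots_poly predT b) ->
    exists (x : 'I_m -> R[i] -> R[i]) (y : 'I_n -> R[i] -> R[i]),
    [/\ infinite_qq Lambda (prodXaddC (fun i => x i 0)) (prodXaddC (fun j => y j 0)),
        qq_family Lambda eps (fun i => x i 0) (fun j => y j 0) x y,
        forall i, x i t = - a i & forall j, y j t = - b j].
  move=> te E; apply: poly_family_roots => //; apply: H => //; rewrite ?monic_roots_poly //.
  - by rewrite size_roots_poly; congr _.+1; rewrite -[RHS]card_ord; apply: eq_card.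
  - by rewrite size_roots_poly; congr _.+1; rewrite -[RHS]card_ord; apply: eq_card.
split=> [x0 y0 E0|].
  exists eps; split=> //.
  have E1 : finite_qq Lambda 0 (roots_poly predT (fun i => - x0 i))
      (roots_poly predT (fun j => - y0 j)).
    by rewrite /finite_qq scale0r addr0 -!prodXaddCE.
  have [|x [y [_ [hx hy hqq] xE yE]]] := fam 0 _ _ _ E1; first by rewrite normc0.
  exists x, y; split=> // [i|j].
    by have [? _] := hx i; split=> //; rewrite xE opprK.
  by have [? _] := hy j; split=> //; rewrite yE opprK.
exists eps; split=> //; split.
  move=> t qp qm /discE te mp sp mm sm E.
  have [a aE] := monic_roots mp sp; have [b bE] := monic_roots mm sm.
  have [|x [y [E0 hqq xE yE]]] := fam t a b te; first by rewrite -aE -bE.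
  exists (fun i => x i 0), (fun j => y j 0), x, y; split=> //.
  - by rewrite prodXaddCE aE; apply: eq_bigr => i _; rewrite xE opprK.
  - by rewrite prodXaddCE bE; apply: eq_bigr => i _; rewrite yE opprK.
move=> N z nn _ nn0 LE t zeta w /discE te t0 tz; split.
  move=> [winj wroot B].
  have Bat l : bethe_at Lambda (roots_poly predT w) t (w l).
    have := B l; rewrite (bethe_atE (t := t)) -?LE //.
    by have := wroot l; rewrite -LE.
  have [h E] := bethe_at_qq winj t0 Bat.
  have sw : size (roots_poly predT w) = m.+1.
    by rewrite size_roots_poly; congr _.+1; rewrite -[RHS]card_ord; apply: eq_card.
  have [mh sh] := qq_second_factor Lambda_monic Lambda_deg (monic_roots_poly _ _) sw E.
  have [b bE] := monic_roots mh sh.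
  have [|x [y [E0 hqq xE _]]] := fam t w b te; first by rewrite -bE.
  exists (fun i => x i 0), (fun j => y j 0), x, y; split=> //.
  - by move=> i s; rewrite !xE => /oppr_inj/winj.
  - by move=> i; rewrite xE opprK LE.
  - by move=> l; rewrite xE opprK.
move=> [x0 [y0 [x [y [_ [_ _ hqq] xinj xroot wE]]]]].
have winj : injective w by move=> i s; rewrite !wE => /oppr_inj/xinj.
have wroot l : ~~ root Lambda (w l) by rewrite wE.
have := hqq t (proj2 (discE eps t) te); rewrite prodXaddCE.
have -> : roots_poly predT (fun i => - x i t) = roots_poly predT w.
  by apply: eq_bigr => i _; rewrite wE.
move=> E; split=> // l; first by rewrite -LE.
have L0 : (\prod_(k < N) ('X - (z k)%:P) ^+ nn k).[w l] != 0.
  by rewrite -LE; exact: wroot.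
apply: (proj2 (bethe_atE winj nn0 L0 t0 tz)); rewrite -LE.
by apply: (qq_bethe_at E); apply: roots_poly_eq0.
Qed.
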